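(* For every integer $n \geq 1$, $\chi_g(P_4 \square P_n) \leq 4$. Moreover, $\chi_g(P_4 \square P_n) = 4$ for every $n \geq 18$.
   Context: $P_n$ denotes the path on $n$ vertices and $P_4 \square P_n$ is the Cartesian product of $P_4$ and $P_n$ (the $4 \times n$ grid): vertex set $V(P_4)\times V(P_n)$, with $(a,x)$ adjacent to $(b,y)$ iff either $a=b$ and $xy$ is an edge of $P_n$, or $x=y$ and $ab$ is an edge of $P_4$. The $k$-coloring game on a graph $G$: Alice and Bob alternately, starting with Alice, choose an uncolored vertex and assign it a color from $\{1,\dots,k\}$ such that the partial coloring stays proper (no two adjacent colored vertices share a color). Alice wins if eventually all vertices are colored; Bob wins otherwise, i.e. if at some point some uncolored vertex has, for every $i\in\{1,\dots,k\}$, a neighbor colored $i$. The game chromatic number $\chi_g(G)$ is the smallest $k$ such that Alice has a winning strategy in the $k$-coloring game on $G$. *)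

(* Defs.v *)
From mathcomp Require Import all_boot.
From mathcomp Require Import boolp.

Set Implicit Arguments.
Unset Strict Implicit.
Unset Printing Implicit Defensive.

(** Finite simple graphs *)

Record sgraph := SGraph {
  vertex :> finType;
  edge : rel vertex;
  edge_sym : symmetric edge;
  edge_irr : irreflexive edge }.

Section PathGraph.
Variable n : nat.

Definition path_edge : rel 'I_n :=
  fun i j => (i.+1 == j :> nat) || (j.+1 == i :> nat).

Lemma path_edge_sym : symmetric path_edge.
Proof. by move=> i j; rewrite /path_edge orbC. Qed.

Lemma path_edge_irr : irreflexive path_edge.
Proof. by move=> i; rewrite /path_edge orbb gtn_eqF. Qed.

Definition path_graph : sgraph := SGraph path_edge_sym path_edge_irr.
End PathGraph.

Section CartesianProduct.
Variables G H : sgraph.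

Definition box_edge : rel (G * H)%type := fun u v =>
  ((u.1 == v.1) && edge u.2 v.2) || ((u.2 == v.2) && edge u.1 v.1).

Lemma box_edge_sym : symmetric box_edge.
Proof.
by move=> u v; rewrite /box_edge (eq_sym u.1) (eq_sym u.2) (edge_sym u.1)
  (edge_sym u.2).
Qed.

Lemma box_edge_irr : irreflexive box_edge.
Proof. by move=> u; rewrite /box_edge !edge_irr !andbF. Qed.

Definition box_graph : sgraph := SGraph box_edge_sym box_edge_irr.
End CartesianProduct.

(** The k-coloring game *)

Section Game.
Variables (G : sgraph) (k : nat).

(* [None] means uncolored *)
Definition coloring := {ffun G -> option 'I_k}.

Definition proper (c : coloring) : bool :=
  [forall u, forall v, edge u v ==> (c u != None) ==> (c u != c v)].

Definition move := (G * 'I_k)%type.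

Definition paint (c : coloring) (m : move) : coloring :=
  [ffun v => if v == m.1 then Some m.2 else c v].

Definition legal (c : coloring) (m : move) : bool :=
  (c m.1 == None) && proper (paint c m).

(* A history lists the moves in chronological order; since Alice starts, she is
   to move exactly when its length is even. *)
Definition history := seq move.

Definition position (h : history) : coloring :=
  foldl paint [ffun=> None] h.

Definition alice_turn (h : history) : bool := ~~ odd (size h).

Definition complete (h : history) : bool :=
  [forall v, position h v != None].

Definition finished (h : history) : bool :=
  [forall m, ~~ legal (position h) m].

(* [None] means that no move is proposed, so that strategies also exist when
   there are no moves at all (empty graph, or k = 0). *)
Definition strategy := history -> option move.

(* The histories of the (possibly unfinished) legal plays in which Alice follows
   [s] and Bob moves arbitrarily. *)
Inductive play (s : strategy) : history -> Prop :=
| play_start : play s [::]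
| play_alice h m : play s h -> alice_turn h -> s h = Some m ->
    legal (position h) m -> play s (rcons h m)
| play_bob h m : play s h -> ~~ alice_turn h ->
    legal (position h) m -> play s (rcons h m).

(* Every play lasts at most #|G| moves, so "eventually all vertices are colored"
   is a condition on finished plays; the first clause prevents Alice from
   stalling in an unfinished one. *)
Definition winning (s : strategy) : Prop :=
  forall h, play s h ->
    (alice_turn h -> ~~ finished h ->
       exists2 m, s h = Some m & legal (position h) m)
    /\ (finished h -> complete h).

Definition alice_wins : Prop := exists s, winning s.
End Game.

Lemma play_proper (G : sgraph) k (s : strategy G k) h :
  play s h -> proper (position h).
Proof.
case=> [|h' m _ _ _|h' m _ _]; last 2 first.
- by rewrite /position foldl_rcons => /andP[].
- by rewrite /position foldl_rcons => /andP[].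
by apply/forallP=> u; apply/forallP=> v; rewrite !ffunE eqxx /= implybT.
Qed.

Lemma alice_wins_card (G : sgraph) : alice_wins G #|G|.
Proof.
exists (fun h => [pick m | legal (position h) m]) => h hP; split.
  move=> _ /forallPn[m]; rewrite negbK => mL.
  by case: pickP => [m' m'L|/(_ m)]; [exists m' | rewrite mL].
move=> /forallP fin; apply/forallP=> v; apply/negP=> /eqP cv.
set c := position h in fin cv *.
have pc : proper c := play_proper hP.
have [i iP] : exists i, i \notin [set i | [exists u, c u == Some i]].
  apply/existsP; rewrite -negb_forall; apply/negP=> /forallP allc.
  pose f (i : 'I_#|G|) := odflt v [pick u | c u == Some i].
  have fK i : c (f i) = Some i.
    rewrite /f; case: pickP => [u /eqP//|no].
    by have := allc i; rewrite inE => /existsP[u]; rewrite no.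
  have f_inj : injective f.
    by move=> i j /(congr1 c); rewrite !fK => -[].
  have [g _ gK] : bijective f by apply: inj_card_bij; rewrite // card_ord.
  by have := fK (g v); rewrite gK cv.
have nc u : (c u == Some i) = false.
  by apply: contraNF iP => cu; rewrite inE; apply/existsP; exists u.
have /negP[] := fin (v, i); rewrite /legal cv eqxx /=.
apply/forallP=> u; apply/forallP=> w; apply/implyP=> uw.
rewrite !ffunE /=; case: (eqVneq u v) => [uv|uv]; case: (eqVneq w v) => [wv|wv] //=.
- by rewrite uv wv edge_irr in uw.
- by rewrite eq_sym nc.
- by rewrite nc implybT.
- by move/forallP: pc => /(_ u)/forallP/(_ w)/implyP/(_ uw).
Qed.

Lemma ex_alice_wins (G : sgraph) : exists k, `[< alice_wins G k >].
Proof. by exists #|G|; apply/asboolP/alice_wins_card. Qed.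

Definition game_chromatic_number (G : sgraph) : nat := ex_minn (ex_alice_wins G).

(* Main.v *)
(** With four colours, an uncoloured cell can only be lost if its four neighbours get
    pairwise distinct colours, so Alice only has to watch the open inner cells without
    a repeated colour around them ("unsafe" cells) outside of the columns that are
    still empty ("fresh"). She restores after each of her moves an invariant saying
    that unsafe cells have two open neighbours and are pairwise independent, that a
    column next to a fresh one has one of four shapes, and that no fresh column is
    squeezed between two crossing columns. A move of Bob outside of the fresh columns
    endangers at most one unsafe cell, which Alice colours; a move in a fresh column is
    answered in that column, or in the next one. When nothing is endangered, she
    colours an unsafe cell, or fills the column to the left of the first fresh one.

    With at most three colours, Bob plays an inner cell in the middle of five empty
    columns. Whatever Alice answers, a second stone next to it threatens two cells at
    once. This is a finite game in a 4 x 5 window in which Alice may also pass, decided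
    by computation: since Bob only plays in the three middle columns, his moves are
    legal in the grid if they are in the window. *)

From Stdlib Require Import ZArith Lia Classical.

(** Tempo counts lie behind the invariant. An unsafe cell needs two open neighbours because Bob may
    take one, and the other still leaves Alice a colour; independence keeps a single move of Bob
    from endangering two such cells. Fresh columns are exempt, since the two adjacent inner cells of
    an empty column could never be independent; the price is that every entry into a fresh column
    must leave one of the four shapes where fresh columns remain alongside. The crossings come from
    the obligation to move. When nothing is unsafe and the column left of the first fresh one is
    full, Alice has to enter that fresh column, and reuses there a colour of its neighbours to
    create a repetition. If every such choice is blocked, the two neighbours read x,y,x,y and
    y,x,y,x. A pattern with two open cells can still be broken after Bob's next move, hence the
    bound of one open cell. Filling a column next to a fresh one may use up an open neighbour of an
    unsafe cell behind it. The clause [IA] prepares for this; its alternative [marked] stems from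
    the one configuration where the natural answer would itself complete a crossing. *)

Section Grid.
Local Open Scope Z_scope.

(* [b k v] is the colour of the cell in column [k] and row [v]: the grid has the
   columns 1..n and the rows 0..3, and 0 stands for an uncoloured cell. *)
Definition board := Z -> nat -> Z.
(* the other inner row, and the outer row next to an inner row *)
Definition mate (v : nat) : nat := match v with 1%nat => 2%nat | _ => 1%nat end.
Definition pend (v : nat) : nat := match v with 1%nat => 0%nat | _ => 3%nat end.
Definition inner (v : nat) := v = 1%nat \/ v = 2%nat.
Definition nx (k f : Z) := f = k - 1 \/ f = k + 1.
Definition adj (k : Z) (v : nat) (k' : Z) (v' : nat) :=
  (k = k' /\ (v' = S v \/ v = S v')) \/ (v = v' /\ nx k k').
Definition rep4 (w x y z : Z) :=
  w <> 0 /\ (w = x \/ w = y \/ w = z) \/ x <> 0 /\ (x = y \/ x = z) \/ y <> 0 /\ y = z.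
Definition two0 (w x y z : Z) :=
  w = 0 /\ (x = 0 \/ y = 0 \/ z = 0) \/ x = 0 /\ (y = 0 \/ z = 0) \/ y = 0 /\ z = 0.
Definition o (x : Z) : Z := if Z.eq_dec x 0 then 1 else 0.
Definition upd (b : board) (k : Z) (v : nat) (c : Z) : board :=
  fun k' v' => if Z.eq_dec k' k then if Nat.eq_dec v' v then c else b k' v' else b k' v'.

(** * The invariant kept by Alice *)

Section Alice.
Variable n : Z.

(** The columns 1 and [n] never count as fresh: their cells have at most three neighbours and cannot
    be lost, so they act as walls. *)
Definition freshcol (b : board) (k : Z) :=
  1 < k < n /\ b k 0%nat = 0 /\ b k 1%nat = 0 /\ b k 2%nat = 0 /\ b k 3%nat = 0.
(* An open inner cell can lose its last colour only if its four neighbours get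
   pairwise distinct colours. *)
Definition repeats (b : board) (k : Z) (v : nat) :=
  rep4 (b k (mate v)) (b k (pend v)) (b (k - 1) v) (b (k + 1) v).
Definition unsafe (b : board) (k : Z) (v : nat) :=
  1 < k < n /\ ~ freshcol b k /\ b k v = 0 /\ ~ repeats b k v.
(* The shapes allowed for a nonfresh column [k] next to a fresh column [f]. In H and
   U the open inner cell is safe thanks to its own column, resp. the column on the
   other side; in A the cell [(k, mate p)] is unsafe. *)
Definition formC (b : board) (k : Z) := b k 1%nat <> 0 /\ b k 2%nat <> 0.
Definition formH (b : board) (k : Z) (v : nat) :=
  inner v /\ b k v = 0 /\ b k (mate v) <> 0 /\ b k (pend v) = b k (mate v) /\ b k (pend (mate v)) = 0.
Definition formU (b : board) (k f : Z) (v : nat) :=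
  inner v /\ b k v = 0 /\ b k (mate v) <> 0 /\ b (2 * k - f) v <> 0 /\
  (b (2 * k - f) v = b k (mate v) \/ b (2 * k - f) v = b k (pend v)).
Definition formA (b : board) (k f : Z) (p : nat) :=
  inner p /\ b k p = 0 /\ b k (mate p) = 0 /\ b k 0%nat <> 0 /\ b k 3%nat = b k 0%nat /\
  b (2 * k - f) p = b k 0%nat /\ b (2 * k - f) (mate p) = 0 /\
  (b (3 * k - 2 * f) (mate p) <> 0 \/ ~ 1 < 3 * k - 2 * f < n).
Definition form (b : board) (k f : Z) :=
  formC b k \/ (exists v, formH b k v) \/ (exists v, formU b k f v) \/ (exists p, formA b k f p).
Definition zeros (b : board) (s : Z) := o (b s 0%nat) + o (b s 1%nat) + o (b s 2%nat) + o (b s 3%nat).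
(* Columns [l], [r] coloured x,y,x,y and y,x,y,x would leave no good colour to the
   fresh column between them; [zeros] counts the cells still open. *)
Definition crossing (b : board) (s p q : Z) :=
  (b s 0%nat = 0 \/ b s 0%nat = p) /\ (b s 2%nat = 0 \/ b s 2%nat = p) /\
  (b s 1%nat = 0 \/ b s 1%nat = q) /\ (b s 3%nat = 0 \/ b s 3%nat = q).
(** The bound 1 counts tempi: from two open cells, a move of Bob leaves one in which Alice can put a
    third colour; from one, Bob could complete the pattern himself. *)
Definition crossing_gap (b : board) (l r : Z) := exists x y, x <> y /\ x <> 0 /\ y <> 0 /\
  crossing b l x y /\ crossing b r y x /\ zeros b l + zeros b r <= 1.
Definition crossed (b : board) (s : Z) := exists p q, p <> q /\ p <> 0 /\ q <> 0 /\
  crossing b s p q /\ zeros b s <= 1.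

Definition wf (b : board) :=
  (forall k v, 0 <= b k v <= 4) /\ (forall k v, k < 1 \/ n < k \/ (3 < v)%nat -> b k v = 0) /\
  (forall k v k' v', adj k v k' v' -> b k v <> 0 -> b k v <> b k' v').
Definition allowed (b : board) (k : Z) (v : nat) (c : Z) :=
  1 <= k <= n /\ (v <= 3)%nat /\ 1 <= c <= 4 /\ b k v = 0 /\
  forall k' v', adj k v k' v' -> b k' v' <> c.

(** One open neighbour is for Bob to take; the other ensures that at most three colours then
    surround the cell. *)
Definition IL (b : board) := forall k v, inner v -> unsafe b k v ->
  two0 (b k (mate v)) (b k (pend v)) (b (k - 1) v) (b (k + 1) v).
(* When a column [x] between two A columns stops being fresh, their unsafe cells may
   share an open cell of [x]: the only exception to the independence in [IS]. *)
Definition twin (b : board) (x : Z) (u : nat) :=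
  formA b (x - 1) x (mate u) /\ formA b (x + 1) x (mate u).
Definition IS (b : board) := forall k v k' v', inner v -> inner v' -> unsafe b k v -> unsafe b k' v' ->
  k <> k' \/ v <> v' -> ~ adj k v k' v' /\
  forall x u, adj x u k v -> adj x u k' v' -> b x u = 0 -> ~ freshcol b x -> v = u /\ v' = u /\ twin b x u.
Definition IN (b : board) := forall k f, 1 < k < n -> ~ freshcol b k -> nx k f -> freshcol b f -> form b k f.
Definition IZ1 (b : board) := forall k, freshcol b k -> ~ crossing_gap b (k - 1) (k + 1).
(** Such a column could become part of a crossing gap on both of its sides at once, and one answer
    in a farther column repairs only one gap. *)
Definition IZ2 (b : board) := forall k, 1 < k < n -> freshcol b (k - 1) -> freshcol b (k + 1) -> ~ crossed b k.
(* Filling the open cell [(k, v)] must not hurt the unsafe cell [(2 * k - f, v)] behind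
   it: either that cell keeps two open neighbours, or ([marked]) one of its neighbours
   already has a colour which fits in [(k, v)] and breaks the crossing. *)
Definition slack (b : board) (k f : Z) (v : nat) :=
  (b (2 * k - f) (mate v) = 0 /\ b (2 * k - f) (pend v) = 0 \/
   b (2 * k - f) (mate v) = 0 /\ b (3 * k - 2 * f) v = 0 \/
   b (2 * k - f) (pend v) = 0 /\ b (3 * k - 2 * f) v = 0) /\
  ~ (b (3 * k - 2 * f) v = 0 /\ freshcol b (4 * k - 3 * f)).
Definition marked (b : board) (k f : Z) (v : nat) :=
  b (2 * f - k) (mate v) <> 0 /\ b (2 * k - f) (pend v) = b (2 * f - k) (mate v) /\
  b (2 * k - f) (pend (mate v)) = b (2 * f - k) (mate v).
Definition IA (b : board) := forall k f v, inner v -> 1 < k < n -> nx k f -> freshcol b f ->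
  b k v = 0 -> b k (mate v) <> 0 -> unsafe b (2 * k - f) v -> slack b k f v \/ marked b k f v.
Definition Inv (b : board) := wf b /\ IL b /\ IS b /\ IN b /\ IZ1 b /\ IZ2 b /\ IA b.

(** * Boards, legal moves and monotonicity *)

Lemma o_spec x : x = 0 /\ o x = 1 \/ x <> 0 /\ o x = 0.
Proof. unfold o; destruct (Z.eq_dec x 0); auto. Qed.

Lemma upd_eq b k v c : upd b k v c k v = c.
Proof. unfold upd; destruct (Z.eq_dec k k), (Nat.eq_dec v v); congruence. Qed.
Lemma upd_ne b k v c k' v' : k' <> k \/ v' <> v -> upd b k v c k' v' = b k' v'.
Proof. unfold upd; destruct (Z.eq_dec k' k), (Nat.eq_dec v' v); intuition congruence. Qed.
Lemma adj_sym k v k' v' : adj k v k' v' -> adj k' v' k v.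
Proof.
intros [[E [H|H]]|[E [H|H]]]; [left; auto|left; auto|right|right]; (split; [auto|]); [right|left]; lia.
Qed.
Lemma adj_irr k v : ~ adj k v k v.
Proof. intros [[_ H]|[_ [H|H]]]; lia. Qed.

Lemma wf_upd b k v c : wf b -> allowed b k v c -> wf (upd b k v c).
Proof.
intros (R & O & P) (Hk & Hv & Hc & H0 & Hl); split; [|split].
- intros k' v'; unfold upd; destruct (Z.eq_dec k' k), (Nat.eq_dec v' v); auto; lia.
- intros k' v' H; rewrite upd_ne; [now apply O|lia].
- intros k1 v1 k2 v2 Ha; unfold upd.
  destruct (Z.eq_dec k1 k) as [->|], (Nat.eq_dec v1 v) as [->|],
    (Z.eq_dec k2 k) as [->|], (Nat.eq_dec v2 v) as [->|]; try (now apply P); intros Hn;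
    try (now apply not_eq_sym; apply Hl); try (now apply Hl, adj_sym); exfalso; revert Ha; apply adj_irr.
Qed.

Lemma pick3 x y z : exists c, 1 <= c <= 4 /\ c <> x /\ c <> y /\ c <> z.
Proof.
destruct (Z.eq_dec 1 x), (Z.eq_dec 1 y), (Z.eq_dec 1 z); try (exists 1; lia);
destruct (Z.eq_dec 2 x), (Z.eq_dec 2 y), (Z.eq_dec 2 z); try (exists 2; lia);
destruct (Z.eq_dec 3 x), (Z.eq_dec 3 y), (Z.eq_dec 3 z); try (exists 3; lia);
exists 4; lia.
Qed.

Lemma legal_inner b k v c : inner v -> 1 <= k <= n -> 1 <= c <= 4 -> b k v = 0 ->
  c <> b k (mate v) -> c <> b k (pend v) -> c <> b (k - 1) v -> c <> b (k + 1) v -> allowed b k v c.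
Proof.
intros [->| ->]; simpl; intros; (split; [|split; [|split; [|split]]]; try lia);
  intros k' v' [[<- [->|E]]|[<- [->| ->]]]; try injection E as <-; auto.
Qed.

Lemma legal_pend b k v c : inner v -> 1 <= k <= n -> 1 <= c <= 4 -> b k (pend v) = 0 -> wf b ->
  c <> b k v -> c <> b (k - 1) (pend v) -> c <> b (k + 1) (pend v) -> allowed b k (pend v) c.
Proof.
intros [->| ->]; simpl; intros ? ? ? (R & O & P); intros; (split; [|split; [|split; [|split]]]; try lia);
  intros k' v' [[<- [->|E]]|[<- [->| ->]]]; try injection E as <-; try discriminate E; auto;
  rewrite O; lia.
Qed.

Lemma legalN b k v c k' v' : allowed b k v c -> adj k v k' v' -> c <> b k' v'.
Proof. intros H Ha E; apply (proj2 (proj2 (proj2 (proj2 H))) k' v' Ha); auto. Qed.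

(** The order along which everything is compared: repetitions persist, while open cells and fresh
    columns can only disappear. *)
Definition ext (b b' : board) := forall k v, b k v <> 0 -> b' k v = b k v.

Lemma ext_upd b k v c : b k v = 0 -> ext b (upd b k v c).
Proof.
intros H k' v' H'; apply upd_ne; destruct (Z.eq_dec k' k) as [->|]; [right|now left].
intros ->; contradiction.
Qed.

Lemma ext_trans b1 b2 b3 : ext b1 b2 -> ext b2 b3 -> ext b1 b3.
Proof. intros H H' k v Hk; rewrite H'; rewrite H; auto. Qed.

Lemma ext0 b b' k v : ext b b' -> b' k v = 0 -> b k v = 0.
Proof. intros H E; destruct (Z.eq_dec (b k v) 0) as [|N]; auto. rewrite <- (H _ _ N); auto. Qed.

Lemma fr_anti b b' x : ext b b' -> freshcol b' x -> freshcol b x.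
Proof.
intros E (H & H0 & H1 & H2 & H3); split; [auto|]; repeat split; now apply (ext0 _ _ _ _ E).
Qed.

Lemma rep4_mono w x y z w' x' y' z' : (w <> 0 -> w' = w) -> (x <> 0 -> x' = x) ->
  (y <> 0 -> y' = y) -> (z <> 0 -> z' = z) -> rep4 w x y z -> rep4 w' x' y' z'.
Proof.
intros A B C D [[N [E|[E|E]]]|[[N [E|E]]|[N E]]]; unfold rep4;
  rewrite ?(A N), ?(B N), ?(C N); [left|left|left|right; left|right; left|right; right];
  (split; [assumption|]); rewrite E in N.
- left; rewrite (B N); auto.
- right; left; rewrite (C N); auto.
- right; right; rewrite (D N); auto.
- left; rewrite (C N); auto.
- right; rewrite (D N); auto.
- rewrite (D N); auto.
Qed.

Lemma rp_mono b b' k v : ext b b' -> repeats b k v -> repeats b' k v.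
Proof. intros E; apply rep4_mono; apply E. Qed.

(** New unsafe cells arise only when a fresh column receives its first stone; elsewhere the set of
    unsafe cells shrinks. *)
Lemma uns_anti b b' k v : ext b b' -> ~ freshcol b k -> unsafe b' k v -> unsafe b k v.
Proof.
intros E Nf (H & _ & H0 & Hr); repeat split; try tauto; try lia.
- now apply (ext0 _ _ _ _ E).
- intros R; apply Hr; now apply (rp_mono b).
Qed.

(** Unsafe cells and open cells only disappear, so independence persists by itself; the exception
    [twin] requires certain cells to be open and has to be carried along separately. *)
Lemma IS_keep b b' : ext b b' -> (forall x, freshcol b x -> freshcol b' x) -> IS b ->
  (forall x u, inner u -> ~ freshcol b x -> unsafe b' (x - 1) u -> unsafe b' (x + 1) u -> twin b x u -> twin b' x u) ->
  IS b'.
Proof.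
intros E F S T k v k' v' i i' U U' D.
assert (G : forall x, freshcol b' x -> freshcol b x) by (intros x; now apply fr_anti).
assert (V : forall x u, unsafe b' x u -> unsafe b x u).
{ intros x u W; apply (uns_anti _ _ _ _ E); auto; intros Fx; apply (proj1 (proj2 W)); auto. }
destruct (S k v k' v' i i' (V _ _ U) (V _ _ U') D) as [Na C]; split; auto.
intros x u a a' H Nf.
destruct (C x u a a' (ext0 _ _ _ _ E H)) as (-> & -> & Tw); [now intros Fx; apply Nf, F|].
split; [auto|split; auto].
assert (Hx : nx x k /\ nx x k').
{ split; [destruct a as [[_ ?]|[_ ?]]|destruct a' as [[_ ?]|[_ ?]]]; auto; lia. }
apply T; auto.
- destruct Hx as [[->| ->] [->| ->]]; auto; lia.
- destruct Hx as [[->| ->] [->| ->]]; auto; lia.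
Qed.

Lemma op_inn v : inner v -> inner (mate v).
Proof. intros [->| ->]; [right|left]; reflexivity. Qed.
Lemma op_op v : inner v -> mate (mate v) = v.
Proof. intros [->| ->]; reflexivity. Qed.
Lemma op_ne v : inner v -> mate v <> v.
Proof. intros [->| ->]; discriminate. Qed.
Lemma ot_nx k f : nx k f -> nx k (2 * k - f).
Proof. unfold nx; lia. Qed.

(** With [f] for one neighbouring column and [2 * k - f] for the other, left and right become
    interchangeable in all later arguments. *)
Lemma nx_rp b k f v : nx k f ->
  repeats b k v <-> rep4 (b k (mate v)) (b k (pend v)) (b f v) (b (2 * k - f) v).
Proof.
unfold repeats; intros [->| ->];
  [replace (2 * k - (k - 1)) with (k + 1) by lia | replace (2 * k - (k + 1)) with (k - 1) by lia];
  unfold rep4; lia.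
Qed.

Lemma nx_two0 b k f v : nx k f ->
  two0 (b k (mate v)) (b k (pend v)) (b (k - 1) v) (b (k + 1) v) <->
  two0 (b k (mate v)) (b k (pend v)) (b f v) (b (2 * k - f) v).
Proof.
intros [->| ->];
  [replace (2 * k - (k - 1)) with (k + 1) by lia | replace (2 * k - (k + 1)) with (k - 1) by lia];
  unfold two0; lia.
Qed.

Lemma nx_zz b k f : nx k f -> crossing_gap b (k - 1) (k + 1) <-> crossing_gap b f (2 * k - f).
Proof.
intros [->| ->];
  [replace (2 * k - (k - 1)) with (k + 1) by lia | replace (2 * k - (k + 1)) with (k - 1) by lia].
- tauto.
- unfold crossing_gap; split; intros (x & y & H1 & H2 & H3 & H4 & H5 & H6); exists y, x; refine (conj _ (conj _ (conj _ (conj H5 (conj H4 _))))); auto; lia.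
Qed.

(** * Moves outside of the fresh columns *)

(** C and U survive every move, U possibly as C. H becomes C once its open inner cell is coloured,
    and only a stone on its open end can spoil it. A becomes U when its unsafe cell is coloured, and
    C when both inner cells are; otherwise it needs its open cells untouched. *)
Lemma form_keep b b' k f : ext b b' -> form b k f ->
  (forall v, formH b k v -> b' k v = 0 -> b' k (pend (mate v)) = 0) ->
  (forall p, formA b k f p -> b' k (mate p) <> 0 \/ b' k p = 0 /\ b' (2 * k - f) (mate p) = 0) ->
  form b' k f.
Proof.
intros E F HH HA; destruct F as [[C1 C2]|[[v Hv]|[[v Hv]|[p Hp]]]].
- left; split; rewrite E; auto.
- pose proof (HH v Hv) as X; destruct Hv as (i & H0 & H1 & H2 & H3).
  destruct (Z.eq_dec (b' k v) 0) as [Z0|Z0].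
  + right; left; exists v; repeat split; auto; rewrite ?(E k (mate v)) by auto; auto.
    rewrite E; congruence.
  + left; assert (b' k (mate v) <> 0) by (rewrite E; auto).
    destruct i as [->| ->]; simpl in *; split; auto.
- destruct Hv as (i & H0 & H1 & H2 & H3).
  assert (X : b' k (mate v) = b k (mate v)) by (now apply E).
  assert (Y : b' (2 * k - f) v = b (2 * k - f) v) by (now apply E).
  destruct (Z.eq_dec (b' k v) 0) as [Z0|Z0].
  + right; right; left; exists v; unfold formU; rewrite X, Y.
    repeat split; auto. destruct H3 as [|H3]; auto; right; rewrite (E k (pend v)); congruence.
  + left; destruct i as [->| ->]; simpl in *; split; congruence.
- pose proof (HA p Hp) as X; destruct Hp as (i & H0 & H1 & H2 & H3 & H4 & H5 & H6).
  assert (Y0 : b' k 0%nat = b k 0%nat) by (now apply E).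
  assert (Y3 : b' k 3%nat = b k 3%nat) by (apply E; congruence).
  assert (Yo : b' (2 * k - f) p = b (2 * k - f) p) by (apply E; congruence).
  destruct (Z.eq_dec (b' k (mate p)) 0) as [Zq|Zq].
  + destruct X as [X|[X1 X2]]; [contradiction|].
    right; right; right; exists p; unfold formA; repeat split; auto; try congruence.
    destruct H6 as [H6|H6]; [left; rewrite E; auto|now right].
  + destruct (Z.eq_dec (b' k p) 0) as [Zp|Zp].
    * right; right; left; exists p; repeat split; auto; [congruence|right].
      destruct i as [->| ->]; simpl in *; congruence.
    * left; destruct i as [->| ->]; simpl in *; split; auto.
Qed.

(** Rows 0 and 3 carry different colours in a crossing, so a column of shape A never takes part in
    one. *)
Lemma crA b k x y : b k 0%nat <> 0 -> b k 3%nat = b k 0%nat -> crossing b k x y -> x = y.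
Proof. unfold crossing; lia. Qed.

Lemma cr_ext b b' s p q : ext b b' -> crossing b' s p q -> crossing b s p q.
Proof.
intros E (H1 & H2 & H3 & H4); repeat split;
  match goal with |- b ?k ?v = 0 \/ _ => destruct (Z.eq_dec (b k v) 0) as [|N]; [auto|pose proof (E _ _ N); right] end; lia.
Qed.

Lemma adj_op k v : inner v -> adj k (mate v) k v.
Proof. intros [->| ->]; simpl; unfold adj; lia. Qed.
Lemma adj_pd k v : inner v -> adj k (pend v) k v.
Proof. intros [->| ->]; simpl; unfold adj; lia. Qed.
Lemma adj_nx k k' v : nx k k' -> adj k v k' v.
Proof. unfold adj; auto. Qed.

Lemma slack_keep b b2 k f v : ext b b2 ->
  b2 (2 * k - f) (mate v) = b (2 * k - f) (mate v) -> b2 (2 * k - f) (pend v) = b (2 * k - f) (pend v) ->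
  b2 (3 * k - 2 * f) v = b (3 * k - 2 * f) v -> slack b k f v -> slack b2 k f v.
Proof.
intros E H1 H2 H3 [S1 S2]; split; rewrite ?H1, ?H2, ?H3; auto.
intros [G1 G2]; apply S2; split; auto; now apply (fr_anti b b2).
Qed.

Lemma marked_keep b b2 k f v : ext b b2 -> marked b k f v -> marked b2 k f v.
Proof.
intros E (H1 & H2 & H3); unfold marked; rewrite (E _ _ H1), !E; auto; congruence.
Qed.

Lemma slack_two0 b k f v : nx k f -> slack b k f v ->
  forall b2, b2 (2 * k - f) (mate v) = b (2 * k - f) (mate v) ->
  b2 (2 * k - f) (pend v) = b (2 * k - f) (pend v) ->
  b2 (3 * k - 2 * f) v = b (3 * k - 2 * f) v ->
  two0 (b2 (2 * k - f) (mate v)) (b2 (2 * k - f) (pend v)) (b2 (2 * k - f - 1) v) (b2 (2 * k - f + 1) v).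
Proof.
intros N [S _] b2 H1 H2 H3; rewrite (nx_two0 b2 (2 * k - f) k v) by (unfold nx in *; lia).
replace (2 * (2 * k - f) - k) with (3 * k - 2 * f) by lia.
rewrite H1, H2, H3; unfold two0; tauto.
Qed.

(** The cell [(k, p)] sees the colour of the ends twice, at its own end and on the far side;
    [(k, mate p)] has only one coloured neighbour, its end. *)
Lemma formA_rp b k f p : nx k f -> freshcol b f -> formA b k f p -> repeats b k p /\ ~ repeats b k (mate p).
Proof.
intros Hn (_ & F0 & F1 & F2 & F3) (i & H0 & H1 & H2 & H3 & H4 & H5 & _).
rewrite !(nx_rp b k f) by auto.
destruct i as [->| ->]; simpl in *; unfold rep4; rewrite ?H0, ?H1, ?H3, ?H4, ?H5, ?F1, ?F2; lia.
Qed.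

(** This is what the last clause of [formA] is for: the far column borders no fresh column, so moves
    that fill columns next to fresh ones leave its open cell alone. *)
Lemma formA_host b k f p s g : formA b k f p -> nx k f -> nx s g -> freshcol b g -> 2 * k - f <> s.
Proof.
intros (i & H0 & H1 & H2 & H3 & H4 & H5 & H6) Hn Hg Fg <-.
assert (g = k \/ g = 3 * k - 2 * f) as [->| ->] by (unfold nx in *; lia).
- apply H2, Fg.
- destruct Fg as (R & _ & F1 & F2 & _); destruct H6 as [H6|H6]; [|lia].
  apply H6; destruct i as [->| ->]; auto.
Qed.

Lemma formA_self b k f p g : formA b k f p -> nx k f -> ~ freshcol b f -> nx k g -> freshcol b g -> False.
Proof.
intros (i & H0 & H1 & H2 & H3 & H4 & H5 & H6) Hn Nf Hg Fg.
assert (g = f \/ g = 2 * k - f) as [->| ->] by (unfold nx in *; lia); auto.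
destruct Fg as (R & _ & F1 & F2 & _); apply H2; rewrite <- H4; destruct i as [->| ->]; auto.
Qed.

Lemma formA_keep b b' k f p : ext b b' -> formA b k f p -> b' k p = 0 -> b' k (mate p) = 0 ->
  b' (2 * k - f) (mate p) = 0 -> formA b' k f p.
Proof.
intros E (i & H0 & H1 & H2 & H3 & H4 & H5 & H6) Z0 Z1 Z2; unfold formA.
rewrite !(E k 0%nat), !(E k 3%nat), (E (2 * k - f) p) by congruence.
repeat split; auto; destruct H6 as [H6|H6]; [left; rewrite E; auto|now right].
Qed.

(* [Inv] without the clauses on crossings, which need not hold between Bob's move
   and the answer to it *)
Definition Core (b : board) := wf b /\ IL b /\ IS b /\ IN b /\ IA b.

(** The two cells are Bob's move and Alice's answer, or coincide for a single move. The completed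
    columns get shape C, shapes A elsewhere are protected by [formA_host], and an unsafe cell
    touched by the fill retains two open neighbours through [slack]. *)
Lemma fill_core b b2 j u s w : Inv b -> wf b2 -> ext b b2 ->
  (forall k v, ~ (k = j /\ v = u) -> ~ (k = s /\ v = w) -> b2 k v = b k v) ->
  ~ freshcol b j -> ~ freshcol b s -> (1 < j < n -> formC b2 j) -> (1 < s < n -> formC b2 s) ->
  (exists g, nx j g /\ freshcol b g) /\ (exists g, nx s g /\ freshcol b g) \/ (forall k v, inner v -> ~ unsafe b k v) ->
  (forall q v, inner v -> unsafe b2 q v -> adj j u q v \/ adj s w q v ->
     exists k f, nx k f /\ 2 * k - f = q /\ (k = j \/ k = s) /\ slack b k f v /\
       b2 q (mate v) = b q (mate v) /\ b2 q (pend v) = b q (pend v) /\ b2 (3 * k - 2 * f) v = b (3 * k - 2 * f) v) ->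
  Core b2.
Proof.
intros (W & L & S & N & Z1 & Z2 & A) W2 E Ch Fj Fs Cj Cs Hf HQ.
assert (HA : forall k f p, 1 < k < n -> ~ freshcol b k -> nx k f -> freshcol b f -> formA b k f p ->
  2 * k - f <> j /\ 2 * k - f <> s).
{ intros k f p Hk Nk Hn Ff Hp; destruct Hf as [[(g & G1 & G2) (g' & G1' & G2')]|NU].
  - split; eapply formA_host; eauto.
  - exfalso; pose proof Hp as (i & _ & H1 & _); apply (NU k (mate p)); auto using op_inn.
    split; [auto|split; [auto|split; [auto|]]]; apply (formA_rp b k f p); auto. }
assert (HT : forall k x p, ~ freshcol b x -> nx k x -> unsafe b k (mate p) -> formA b k x p ->
  (k <> j /\ k <> s) /\ 2 * k - x <> j /\ 2 * k - x <> s).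
{ intros k x p Nx Hn U Hp; destruct Hf as [[(g & G1 & G2) (g' & G1' & G2')]|NU].
  - split; split; [intros ->; apply (formA_self b j x p g)|intros ->; apply (formA_self b s x p g')
      |apply (formA_host b k x p j g)|apply (formA_host b k x p s g')]; auto.
  - exfalso; apply (NU k (mate p)); auto; apply op_inn, Hp. }
assert (F : forall x, freshcol b x -> freshcol b2 x).
{ intros x Fx; assert (x <> j /\ x <> s) by (split; intros ->; contradiction).
  destruct Fx as (H0 & H1 & H2 & H3 & H4); unfold freshcol; rewrite !Ch by lia; tauto. }
assert (V : forall x v, unsafe b2 x v -> unsafe b x v).
{ intros x v U; apply (uns_anti _ _ _ _ E); auto; intros Fx; apply (proj1 (proj2 U)); auto. }
assert (Nb : forall q v x t, ~ (adj j u q v \/ adj s w q v) -> adj x t q v -> b2 x t = b x t).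
{ intros q v x t H a; apply Ch; intros [-> ->]; apply H; auto. }
split; [auto|]; split; [|split; [apply (IS_keep b); auto|split]].
2: { intros x u' iu Nx U1 U2 [T1 T2]; split.
  - destruct (HT (x - 1) x (mate u')) as [D1 D2]; auto; [unfold nx; lia|rewrite op_op; auto|].
    apply (formA_keep b); auto; pose proof T1 as (_ & P0 & P1 & _ & _ & _ & P5 & _); rewrite ?op_op in * by auto.
    + rewrite Ch by tauto; auto.
    + apply U1.
    + rewrite Ch by tauto; auto.
  - destruct (HT (x + 1) x (mate u')) as [D1 D2]; auto; [unfold nx; lia|rewrite op_op; auto|].
    apply (formA_keep b); auto; pose proof T2 as (_ & P0 & P1 & _ & _ & _ & P5 & _); rewrite ?op_op in * by auto.
    + rewrite Ch by tauto; auto.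
    + apply U2.
    + rewrite Ch by tauto; auto. }
- intros q v i U; destruct (classic (adj j u q v \/ adj s w q v)) as [a|a].
  + destruct (HQ q v i U a) as (k & f & Hn & <- & _ & Sl & E1 & E2 & E3).
    now apply (slack_two0 b).
  + rewrite !(Nb q v) by (try exact a; first [now apply adj_op | now apply adj_pd | apply adj_nx; unfold nx; lia]).
    now apply L, V.
- intros k f Hk Nk Hn Ff.
  destruct (classic (k = j \/ k = s)) as [H|H].
  + left; destruct H as [->| ->]; auto.
  + assert (Ck : forall v, b2 k v = b k v) by (intros v; apply Ch; intros [X _]; apply H; auto).
    assert (Ff' : freshcol b f) by (now apply (fr_anti b b2)).
    assert (FF : form b k f) by (apply N; auto).
    apply (form_keep b); auto.
    * intros v (i & _ & _ & _ & H3) _; now rewrite Ck.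
    * intros p Hp; right; destruct (HA k f p Hk (fun G => Nk (F k G)) Hn Ff' Hp) as [D1 D2].
      destruct Hp as (i & H0 & _ & _ & _ & _ & H5 & _).
      rewrite Ck, Ch by tauto; auto.
- intros k f v i Hk Hn Ff H0 H1 U.
  assert (D : k <> j /\ k <> s).
  { split; intros ->; [destruct (Cj Hk)|destruct (Cs Hk)]; destruct i as [->| ->]; simpl in *; congruence. }
  assert (Ck : forall t, b2 k t = b k t) by (intros t; apply Ch; intros [X _]; lia).
  assert (Ff' : freshcol b f) by (now apply (fr_anti b b2)).
  rewrite !Ck in *.
  destruct (classic (adj j u (2 * k - f) v \/ adj s w (2 * k - f) v)) as [a|a].
  (* The touched cell would lie between the filled column [k'] and the column [k], whose cell in the
     same row is open and which borders a fresh column; the second clause of [slack] excludes this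
     sandwich. *)
  + exfalso; destruct (HQ _ v i U a) as (k' & f' & Hn' & Eq & Hk' & [_ T] & E1 & E2 & E3).
    assert (k' <> k) by lia.
    assert (k = 3 * k' - 2 * f') by (unfold nx in *; lia).
    assert (f = 4 * k' - 3 * f') by (unfold nx in *; lia).
    apply T; subst k f; auto.
  + destruct (A k f v i Hk Hn Ff' H0 H1 (V _ _ U)) as [Sl|Mk]; [left|right; now apply (marked_keep b)].
    apply (slack_keep b); auto; apply (Nb _ _ _ _ a);
     first [now apply adj_op | now apply adj_pd | apply adj_nx; unfold nx in *; lia].
Qed.

Lemma fill_keep b b2 j u s w : Inv b -> wf b2 -> ext b b2 ->
  (forall k v, ~ (k = j /\ v = u) -> ~ (k = s /\ v = w) -> b2 k v = b k v) ->
  ~ freshcol b j -> ~ freshcol b s -> (1 < j < n -> formC b2 j) -> (1 < s < n -> formC b2 s) ->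
  IZ1 b2 -> IZ2 b2 ->
  (exists g, nx j g /\ freshcol b g) /\ (exists g, nx s g /\ freshcol b g) \/ (forall k v, inner v -> ~ unsafe b k v) ->
  (forall q v, inner v -> unsafe b2 q v -> adj j u q v \/ adj s w q v ->
     exists k f, nx k f /\ 2 * k - f = q /\ (k = j \/ k = s) /\ slack b k f v /\
       b2 q (mate v) = b q (mate v) /\ b2 q (pend v) = b q (pend v) /\ b2 (3 * k - 2 * f) v = b (3 * k - 2 * f) v) ->
  Inv b2.
Proof.
intros I W2 E Ch Fj Fs Cj Cs Z1 Z2 Hf HQ.
destruct (fill_core b b2 j u s w I W2 E Ch Fj Fs Cj Cs Hf HQ) as (_ & L & S & N & A).
unfold Inv; tauto.
Qed.

Lemma cr_same b b2 s p q : (forall v, b2 s v = b s v) -> crossing b2 s p q -> crossing b s p q.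
Proof. intros H; unfold crossing; now rewrite !H. Qed.

Lemma zeros_same b b2 s : (forall v, b2 s v = b s v) -> zeros b2 s = zeros b s.
Proof. intros H; unfold zeros; now rewrite !H. Qed.

Lemma zz_same b b2 l r : (forall v, b2 l v = b l v) -> (forall v, b2 r v = b r v) ->
  crossing_gap b2 l r -> crossing_gap b l r.
Proof.
intros H H' (x & y & H1 & H2 & H3 & H4 & H5 & H6); exists x, y.
rewrite <- (zeros_same b b2 l), <- (zeros_same b b2 r) by auto.
refine (conj H1 (conj H2 (conj H3 (conj _ (conj _ H6))))); now apply (cr_same b b2).
Qed.

Lemma crossy_same b b2 s : (forall v, b2 s v = b s v) -> crossed b2 s -> crossed b s.
Proof.
intros H (x & y & H1 & H2 & H3 & H4 & H5); exists x, y.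
rewrite <- (zeros_same b b2 s) by auto.
refine (conj H1 (conj H2 (conj H3 (conj _ H5)))); now apply (cr_same b b2).
Qed.

(* [Inv] up to the unsafe cell [(qk, qv)] *)
Definition InvX (b : board) (qk : Z) (qv : nat) := wf b /\
  (forall k v, inner v -> unsafe b k v -> k <> qk \/ v <> qv ->
     two0 (b k (mate v)) (b k (pend v)) (b (k - 1) v) (b (k + 1) v)) /\
  (forall k v k' v', inner v -> inner v' -> unsafe b k v -> unsafe b k' v' -> k <> k' \/ v <> v' ->
     ~ adj k v k' v' /\ (k <> qk \/ v <> qv -> k' <> qk \/ v' <> qv ->
     forall x u, adj x u k v -> adj x u k' v' -> b x u = 0 -> ~ freshcol b x -> v = u /\ v' = u /\ twin b x u)) /\
  (forall k f, 1 < k < n -> ~ freshcol b k -> nx k f -> freshcol b f -> form b k f \/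
     exists p, inner p /\ qk = k /\ qv = mate p /\ b k 0%nat <> 0 /\ b k 3%nat = b k 0%nat /\
       b (2 * k - f) p = b k 0%nat) /\
  IZ1 b /\ IZ2 b /\
  (forall k f v, inner v -> 1 < k < n -> nx k f -> freshcol b f ->
    b k v = 0 -> b k (mate v) <> 0 -> unsafe b (2 * k - f) v -> 2 * k - f <> qk \/ v <> qv ->
    slack b k f v \/ marked b k f v).

(** * Colouring an unsafe cell *)

Lemma formA_rp1 b k f p : nx k f -> formA b k f p -> repeats b k p.
Proof.
intros Hn (i & H0 & H1 & H2 & H3 & H4 & H5 & _); rewrite (nx_rp b k f) by auto.
destruct i as [->| ->]; simpl in *; unfold rep4; rewrite ?H0, ?H1, ?H3, ?H4, ?H5; lia.
Qed.

Lemma twin_keep b b' x u : ext b b' -> inner u ->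
  (forall k, nx k x -> formA b k x (mate u) ->
     b' k (mate u) = 0 /\ b' k u = 0 /\ b' (2 * k - x) u = 0) -> twin b x u -> twin b' x u.
Proof.
intros E i H [T1 T2]; split; [destruct (H (x - 1)) as (H1 & H2 & H3)|destruct (H (x + 1)) as (H1 & H2 & H3)];
  auto; try (unfold nx; lia); apply (formA_keep b); rewrite ?op_op; auto.
Qed.

Lemma formH_rp b k v : formH b k v -> repeats b k v.
Proof. intros (i & H0 & H1 & H2 & _); unfold repeats, rep4; left; split; auto. Qed.

Lemma formU_rp b k f v : nx k f -> formU b k f v -> repeats b k v.
Proof.
intros Hn (i & H0 & H1 & H2 & H3); rewrite (nx_rp b k f) by auto; unfold rep4.
destruct H3 as [H3|H3]; [left|right; left]; split; auto; congruence.
Qed.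

(** C has no open inner cell and those of H and U are safe, so the column has shape A or is the
    exception of [InvX]; the conclusion is what these two have in common. *)
Lemma q_form b qk qv f : InvX b qk qv -> inner qv -> unsafe b qk qv -> nx qk f -> freshcol b f ->
  exists p, inner p /\ qv = mate p /\ b qk 0%nat <> 0 /\ b qk 3%nat = b qk 0%nat /\
    b (2 * qk - f) p = b qk 0%nat.
Proof.
intros (_ & _ & _ & N & _) i U Hn Ff.
destruct U as (Hk & Nf & Q0 & Nr).
destruct (N qk f Hk Nf Hn Ff) as [F|(p & ip & _ & Eq & Z0 & Z3 & Zo)]; [|now exists p].
destruct F as [[C1 C2]|[[v Hv]|[[v Hv]|[p Hp]]]].
- destruct i as [->| ->]; contradiction.
- assert (qv = v) as ->.
  { pose proof Hv as (iv & H0 & H1 & _); destruct i as [->| ->], iv as [->| ->]; simpl in *; congruence. }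
  now elim Nr; apply formH_rp.
- assert (qv = v) as ->.
  { pose proof Hv as (iv & H0 & H1 & _); destruct i as [->| ->], iv as [->| ->]; simpl in *; congruence. }
  now elim Nr; apply (formU_rp b qk f).
- destruct (formA_rp b qk f p Hn Ff Hp) as [Rp _].
  destruct Hp as (ip & H0 & H1 & H2 & H3 & H4 & H5 & _); exists p; repeat split; auto.
  destruct i as [->| ->], ip as [->| ->]; simpl in *; auto; contradiction.
Qed.

(** Any legal colour will do. Unsafe cells are not adjacent, so no other one loses an open
    neighbour; and if the column borders a fresh one, its ends agree by [q_form], so it cannot enter
    a crossing. *)
Lemma color_unsafe b qk qv c : InvX b qk qv -> inner qv -> unsafe b qk qv -> allowed b qk qv c ->
  Inv (upd b qk qv c).
Proof.
intros X i U Lg; pose proof (q_form b qk qv) as QF.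
pose proof X as (W & L & S & N & Z1 & Z2 & A).
set (b2 := upd b qk qv c).
assert (W2 : wf b2) by (now apply wf_upd).
assert (E : ext b b2) by (apply ext_upd; apply U).
assert (c0 : c <> 0) by (destruct Lg; lia).
assert (Ch : forall k v, k <> qk \/ v <> qv -> b2 k v = b k v) by (intros; now apply upd_ne).
assert (Cq : b2 qk qv <> 0) by (unfold b2; rewrite upd_eq; auto).
assert (F : forall x, freshcol b x -> freshcol b2 x).
{ intros x Fx; assert (x <> qk) by (intros ->; apply (proj1 (proj2 U)); auto).
  destruct Fx as (H0 & H1 & H2 & H3 & H4); unfold freshcol; rewrite !Ch by lia; tauto. }
assert (Fa : forall x, freshcol b2 x -> freshcol b x) by (intros x; now apply fr_anti).
assert (V : forall x v, unsafe b2 x v -> unsafe b x v /\ (x <> qk \/ v <> qv)).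
{ intros x v Ux; split.
  - apply (uns_anti _ _ _ _ E); auto; intros Fx; apply (proj1 (proj2 Ux)); auto.
  - destruct (Z.eq_dec x qk) as [->|]; [right; intros ->|now left].
    now apply Cq, (proj1 (proj2 (proj2 Ux))). }
assert (Nb : forall x v y t, inner v -> unsafe b2 x v -> adj y t x v -> b2 y t = b y t).
{ intros x v y t iv Ux a; apply Ch; destruct (V _ _ Ux) as [Ub D].
  destruct (Z.eq_dec y qk) as [->|]; [right; intros ->|now left].
  assert (D' : qk <> x \/ qv <> v) by (destruct D; [left|right]; auto).
  now apply (proj1 (S qk qv x v i iv U Ub D')). }
split; [auto|]; split; [|split; [|split; [|split; [|split]]]].
- intros x v iv Ux; destruct (V _ _ Ux) as [Ub D].
  rewrite !(Nb x v) by (auto; first [now apply adj_op | now apply adj_pd | apply adj_nx; unfold nx; lia]).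
  now apply L.
- intros k v k' v' i1 i2 U1 U2 D; destruct (V _ _ U1) as [B1 D1], (V _ _ U2) as [B2 D2].
  destruct (S k v k' v' i1 i2 B1 B2 D) as [Na C]; split; auto.
  intros x u a a' H Nf.
  destruct (C D1 D2 x u a a' (ext0 _ _ _ _ E H)) as (-> & -> & Tw); [intros G; now apply Nf, F|].
  split; [auto|split; auto].
  assert (Hx : forall y, nx y x -> unsafe b2 y u).
  { intros y Hy; assert (y = k \/ y = k') as [->| ->]; auto.
    destruct a as [[_ ?]|[_ ?]], a' as [[_ ?]|[_ ?]]; unfold nx in *; lia. }
  apply (twin_keep b b2); auto; intros y Hy Hp.
  split; [|split; [now apply Hx|]].
  + rewrite Ch; [now apply Hp|apply NNPP; intros G; assert (y = qk /\ mate u = qv) as [-> <-] by lia].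
    apply (proj2 (proj2 (proj2 U))), (formA_rp1 b qk x); auto.
  + rewrite (Nb y u); auto.
    * destruct Hp as (_ & _ & _ & _ & _ & _ & P5 & _); now rewrite op_op in P5.
    * apply adj_nx; unfold nx in *; lia.
- intros k f Hk Nk Hn Ff; apply Fa in Ff.
  assert (Nk' : ~ freshcol b k) by (intros G; now apply Nk, F).
  destruct (N k f Hk Nk' Hn Ff) as [FF|(p & ip & <- & Eq & P0 & P3 & Po)].
  + apply (form_keep b); auto.
    * intros v (iv & _ & _ & _ & H3) _; rewrite Ch; auto; right.
      destruct i as [->| ->], iv as [->| ->]; discriminate.
    * intros p Hp; destruct (formA_rp b k f p Hn Ff Hp) as [Rp Rq].
      pose proof Hp as (ip & H0 & H1 & H2 & H3 & H4 & H5 & _).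
      destruct (classic (qk = k /\ qv = mate p)) as [[<- <-]|D]; [now left|right].
      assert (Uq : unsafe b k (mate p)) by (repeat split; try tauto; lia).
      split; (rewrite Ch; [auto|]).
      -- apply NNPP; intros D'; assert (k = qk /\ p = qv) as [-> ->] by lia.
         now apply (proj2 (proj2 (proj2 U))).
      -- apply NNPP; intros D'; assert (2 * k - f = qk /\ mate p = qv) as [D1 D2] by lia.
         assert (D3 : k <> qk \/ mate p <> qv) by lia.
         apply (proj1 (S k (mate p) qk qv (op_inn p ip) i Uq U D3)).
         rewrite <- D1, <- D2; apply adj_nx; unfold nx in *; lia.
  (* With [mate p] now coloured, the damaged A column has shape U if [p] is open, since the far cell
     repeats the end, and shape C otherwise. *)
  + destruct (Z.eq_dec (b2 qk p) 0) as [Zp|Zp].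
    * right; right; left; exists p; subst qv; unfold formU.
      assert (Eo : b2 (2 * qk - f) p = b (2 * qk - f) p) by (apply E; congruence).
      rewrite Eo, Po; repeat split; auto; right.
      symmetry; rewrite E; destruct ip as [->| ->]; simpl; congruence.
    * left; subst qv; destruct ip as [->| ->]; simpl in *; split; auto.
- intros k Fk Hz; apply Fa in Fk.
  assert (Cn : forall f, nx k f -> f <> qk).
  { intros f Hf ->; apply (nx_zz b2 k qk Hf) in Hz.
    assert (Hf' : nx qk k) by (unfold nx in *; lia).
    destruct (QF k X i U Hf' Fk) as (p & ip & Eq & P0 & P3 & Po).
    destruct Hz as (x & y & xy & _ & _ & C & _); apply xy, (crA b qk); auto; now apply (cr_ext b b2). }
  apply (Z1 k Fk); apply (zz_same b b2); auto; intros v; apply Ch; left; apply Cn; [now left|now right].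
- intros k Hk Fl Fr Hc; apply Fa in Fl; apply Fa in Fr.
  destruct (Z.eq_dec k qk) as [->|D].
  + assert (Hf' : nx qk (qk - 1)) by (now left).
    destruct (QF _ X i U Hf' Fl) as (p & ip & Eq & P0 & P3 & Po).
    destruct Hc as (x & y & xy & _ & _ & C & _).
    apply xy, (crA b qk); auto; now apply (cr_ext b b2).
  + apply (Z2 k Hk Fl Fr), (crossy_same b b2); auto.
- intros k f v iv Hk Hn Ff H0 H1 Ux; apply Fa in Ff.
  destruct (V _ _ Ux) as [Ub D].
  assert (B0 : b k v = 0) by (now apply (ext0 b b2)).
  destruct (Z.eq_dec (b k (mate v)) 0) as [B1|B1].
  + exfalso; assert (qk = k /\ qv = mate v) as [-> ->].
    { apply NNPP; intros G; apply H1; rewrite Ch; auto; lia. }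
    destruct (QF f X i U Hn Ff) as (p & ip & Eq & P0 & P3 & Po).
    assert (p = v) as -> by (destruct ip as [->| ->], iv as [->| ->]; simpl in *; congruence).
    destruct Ub as (_ & _ & Ub & _); congruence.
  + destruct (A k f v iv Hk Hn Ff B0 B1 Ub D) as [Sl|Mk]; [left|right; now apply (marked_keep b)].
    apply (slack_keep b); auto; apply (Nb _ _ _ _ iv Ux);
     first [now apply adj_op | now apply adj_pd | apply adj_nx; unfold nx in *; lia].
Qed.

(** * Ordinary moves of Bob outside of the fresh columns *)

Lemma pick4 w x y z : w = 0 \/ x = 0 \/ y = 0 \/ z = 0 \/ rep4 w x y z ->
  exists c, 1 <= c <= 4 /\ c <> w /\ c <> x /\ c <> y /\ c <> z.
Proof.
unfold rep4; intros [H|[H|[H|[H|[[_ [H|[H|H]]]|[[_ [H|H]]|[_ H]]]]]]]; rewrite ?H.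
- destruct (pick3 x y z) as (c & ?); exists c; lia.
- destruct (pick3 w y z) as (c & ?); exists c; lia.
- destruct (pick3 w x z) as (c & ?); exists c; lia.
- destruct (pick3 w x y) as (c & ?); exists c; lia.
- destruct (pick3 x y z) as (c & ?); exists c; lia.
- destruct (pick3 x y z) as (c & ?); exists c; lia.
- destruct (pick3 x y z) as (c & ?); exists c; lia.
- destruct (pick3 w y z) as (c & ?); exists c; lia.
- destruct (pick3 w y z) as (c & ?); exists c; lia.
- destruct (pick3 w x z) as (c & ?); exists c; lia.
Qed.

Lemma legal_free b k v : wf b -> inner v -> 1 <= k <= n -> b k v = 0 ->
  b k (mate v) = 0 \/ b k (pend v) = 0 \/ b (k - 1) v = 0 \/ b (k + 1) v = 0 \/ repeats b k v ->
  exists c, allowed b k v c.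
Proof.
intros W i Hk H0 H.
destruct (pick4 _ _ _ _ H) as (c & X); exists c; apply legal_inner; tauto.
Qed.

Lemma uns_stay b j u c k v : allowed b j u c -> ~ freshcol b j -> inner v -> unsafe b k v -> ~ (k = j /\ v = u) ->
  ~ repeats (upd b j u c) k v -> unsafe (upd b j u c) k v.
Proof.
intros Lg Fj i (Hk & Nf & H0 & _) D Nr; split; [auto|split; [|split; auto]].
- intros G; apply Nf; apply (fr_anti b (upd b j u c)); auto; apply ext_upd; apply Lg.
- rewrite upd_ne; auto; lia.
Qed.

(** Both of these moves are next to a cell with the colour of the ends, so Bob must use another
    colour. No repetition arises around [(k, mate p)]: it stays unsafe and is the cell to answer. *)
Lemma formA_touch b j u c k f p : allowed b j u c -> ~ freshcol b j -> 1 < k < n -> ~ freshcol b k -> nx k f -> freshcol b f ->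
  formA b k f p -> j = k /\ u = p \/ j = 2 * k - f /\ u = mate p ->
  unsafe b k (mate p) /\ unsafe (upd b j u c) k (mate p) /\ adj j u k (mate p).
Proof.
intros Lg Fj Hk Nk Hn Ff Hp Hy.
destruct (formA_rp b k f p Hn Ff Hp) as [_ Nr].
pose proof Hp as (i & H0 & H1 & H2 & H3 & H4 & H5 & H6).
assert (Uq : unsafe b k (mate p)) by (split; [auto|split; [auto|split; auto]]).
assert (c0 : c <> 0) by (destruct Lg; lia).
assert (Cz : c <> b k 0%nat).
{ destruct Hy as [[-> ->]|[-> ->]].
  - destruct i as [->| ->].
    + apply (legalN b k 1%nat c k 0%nat Lg); unfold adj; lia.
    + rewrite <- H3; apply (legalN b k 2%nat c k 3%nat Lg); unfold adj; lia.
  - rewrite <- H4; apply (legalN b _ _ c _ _ Lg), adj_op; auto. }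
split; [auto|split].
- apply uns_stay; auto using op_inn.
  + intros [G1 G2]; destruct Hy as [[-> E]|[E1 E2]].
    * apply (op_ne p i); congruence.
    * unfold nx in *; lia.
  + destruct Ff as (_ & F0 & F1 & F2 & F3).
    assert (Kf : k <> f /\ f <> j /\ k <> 2 * k - f) by (unfold nx in *; lia).
    rewrite (nx_rp _ k f) by auto.
    destruct Hy as [[-> ->]|[-> ->]]; destruct i as [->| ->]; simpl in *;
    rewrite ?upd_eq, !upd_ne by lia; rewrite ?upd_eq; unfold rep4;
    rewrite ?H0, ?H1, ?H5, ?F1, ?F2; lia.
- destruct Hy as [[-> ->]|[-> ->]].
  + apply adj_sym, adj_op; auto.
  + apply adj_nx; unfold nx in *; lia.
Qed.

(** By [IS], the cell taken by Bob is an open neighbour of at most one unsafe cell, or of the two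
    cells of a [twin]. All damage to the invariant is therefore located at one unsafe cell, the one
    to colour next. *)
Lemma after_move b j u c : Inv b -> allowed b j u c -> ~ freshcol b j ->
  IZ1 (upd b j u c) -> IZ2 (upd b j u c) ->
  (forall v f, 1 < j < n -> formH b j v -> nx j f -> freshcol b f -> u <> pend (mate v)) ->
  Inv (upd b j u c) \/ exists qk qv c', inner qv /\ unsafe (upd b j u c) qk qv /\
    allowed (upd b j u c) qk qv c' /\ InvX (upd b j u c) qk qv.
Proof.
intros (W & L & S & N & Z1 & Z2 & A) Lg Fj Z1' Z2' NV.
set (b1 := upd b j u c) in *.
assert (W1 : wf b1) by (now apply wf_upd).
assert (B0 : b j u = 0) by apply Lg.
assert (E : ext b b1) by (now apply ext_upd).
assert (c0 : c <> 0) by (destruct Lg; lia).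
assert (Ch : forall k v, k <> j \/ v <> u -> b1 k v = b k v) by (intros; now apply upd_ne).
assert (Cy : b1 j u <> 0) by (unfold b1; now rewrite upd_eq).
assert (F : forall x, freshcol b x -> freshcol b1 x).
{ intros x Fx; assert (x <> j) by (intros ->; contradiction).
  destruct Fx as (H0 & H1 & H2 & H3 & H4); unfold freshcol; rewrite !Ch by lia; tauto. }
assert (Fa : forall x, freshcol b1 x -> freshcol b x) by (intros x; now apply fr_anti).
assert (V : forall x v, unsafe b1 x v -> unsafe b x v).
{ intros x v Ux; apply (uns_anti _ _ _ _ E); auto; intros Fx; apply (proj1 (proj2 Ux)); auto. }
assert (Nb : forall x v y t, ~ adj j u x v -> adj y t x v -> b1 y t = b y t).
{ intros x v y t Na a; apply Ch; apply NNPP; intros D; apply Na.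
  assert (y = j /\ t = u) as [-> ->] by lia; auto. }
assert (IL1 : forall x v, inner v -> unsafe b1 x v -> ~ adj j u x v ->
   two0 (b1 x (mate v)) (b1 x (pend v)) (b1 (x - 1) v) (b1 (x + 1) v)).
{ intros x v i Ux a.
  rewrite !(Nb x v) by (auto; first [now apply adj_op | now apply adj_pd | apply adj_nx; unfold nx; lia]).
  apply L; auto. }
assert (IN1 : forall k f, 1 < k < n -> ~ freshcol b1 k -> nx k f -> freshcol b1 f -> form b1 k f \/
   exists p, inner p /\ unsafe b1 k (mate p) /\ adj j u k (mate p) /\ b1 k 0%nat <> 0 /\ b1 k 3%nat = b1 k 0%nat /\
       b1 (2 * k - f) p = b1 k 0%nat).
{ intros k f Hk Nk Hn Ff; apply Fa in Ff.
  assert (Nk' : ~ freshcol b k) by (intros G; now apply Nk, F).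
  pose proof (N k f Hk Nk' Hn Ff) as FF.
  destruct (classic (exists p, formA b k f p /\ (j = k /\ u = p \/ j = 2 * k - f /\ u = mate p))) as [(p & Hp & Hy)|NA].
  - right; exists p; destruct (formA_touch b j u c k f p) as (_ & Uq & Aq); auto.
    destruct Hp as (i & H0 & H1 & H2 & H3 & H4 & H5 & H6).
    rewrite !E by congruence; repeat split; auto; apply Uq.
  - left; apply (form_keep b); auto.
    + intros v Hv _; destruct (classic (j = k /\ u = pend (mate v))) as [[-> ->]|D].
      * now elim (NV v f Hk Hv Hn Ff).
      * destruct Hv as (_ & _ & _ & _ & H3); rewrite Ch; auto; lia.
    + intros p Hp; right; pose proof Hp as (i & H0 & H1 & H2 & H3 & H4 & H5 & H6).
      split; (rewrite Ch; [auto|]); apply NNPP; intros D; apply NA; exists p; split; auto; lia. }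
assert (IA1 : forall k f v, inner v -> 1 < k < n -> nx k f -> freshcol b1 f ->
    b1 k v = 0 -> b1 k (mate v) <> 0 -> unsafe b1 (2 * k - f) v -> ~ adj j u (2 * k - f) v ->
    slack b1 k f v \/ marked b1 k f v).
{ intros k f v i Hk Hn Ff H0 H1 Ux Na; apply Fa in Ff; pose proof (V _ _ Ux) as Ub.
  assert (K0 : b k v = 0) by (now apply (ext0 b b1)).
  destruct (Z.eq_dec (b k (mate v)) 0) as [K1|K1].
  - exfalso; assert (k = j /\ mate v = u) as [-> Eu].
    { apply NNPP; intros G; apply H1; rewrite Ch; auto; lia. }
    destruct (N j f Hk Fj Hn Ff) as [[C1 C2]|[[v' Hv]|[[v' Hv]|[p Hp]]]].
    + destruct i as [->| ->]; contradiction.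
    + destruct Hv as ([->| ->] & ? & ? & _), i as [->| ->]; simpl in *; contradiction.
    + destruct Hv as ([->| ->] & ? & ? & _), i as [->| ->]; simpl in *; contradiction.
    + destruct (formA_rp b j f p Hn Ff Hp) as [_ Nr].
      pose proof Hp as (ip & P0 & P1 & P2 & P3 & P4 & P5 & P6).
      assert (Uq : unsafe b j (mate p)) by (split; [auto|split; [auto|split; auto]]).
      destruct (classic (p = v)) as [->|D].
      * destruct Ub as (_ & _ & Ub & _); congruence.
      * assert (mate p = v) as E2 by (destruct ip as [->| ->], i as [->| ->]; simpl in *; congruence).
        rewrite E2 in *.
        assert (D3 : j <> 2 * j - f \/ v <> v) by (unfold nx in *; lia).
        apply (proj1 (S j v (2 * j - f) v i i Uq Ub D3)), adj_nx; unfold nx in *; lia.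
  - destruct (A k f v i Hk Hn Ff K0 K1 Ub) as [Sl|Mk]; [left|right; now apply (marked_keep b)].
    apply (slack_keep b); auto; apply (Nb _ _ _ _ Na);
     first [now apply adj_op | now apply adj_pd | apply adj_nx; unfold nx in *; lia]. }
assert (PK : forall k x v, inner v -> unsafe b1 k v -> nx k x -> formA b k x (mate v) ->
   (adj j u k v -> u = v /\ j <> 2 * k - x) ->
   b1 k (mate v) = 0 /\ b1 k v = 0 /\ b1 (2 * k - x) v = 0).
{ intros k x v iv Uk Hk (ip & P0 & P1 & _ & _ & _ & P5 & _) H; rewrite op_op in P5 by auto.
  split; [|split; [apply Uk|]]; (rewrite Ch; [auto|]); apply NNPP; intros D.
  - assert (k = j /\ mate v = u) as [-> <-] by lia.
    apply (op_ne v iv), H, adj_op; auto.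
  - assert (2 * k - x = j /\ v = u) as [<- <-] by lia.
    apply H; auto; apply adj_nx; unfold nx in *; lia. }
assert (TK : forall x v, inner v -> unsafe b1 (x - 1) v -> unsafe b1 (x + 1) v -> twin b x v ->
   (forall k, nx k x -> formA b k x (mate v) -> adj j u k v -> u = v /\ j <> 2 * k - x) -> twin b1 x v).
{ intros x v iv U1 U2 T H; apply (twin_keep b); auto; intros k Hk Hp; apply PK; auto.
  assert (k = x + 1 \/ k = x - 1) as [->| ->] by (clear - Hk; unfold nx in *; lia); auto. }
destruct (classic (exists qk qv, inner qv /\ unsafe b1 qk qv /\ adj j u qk qv)) as [(qk & qv & iq & Uq & Aq)|NQ].
- right.
  (* A second touched cell is the other half of a [twin]. Lying in an A column, it keeps the other
     inner cell of that column and its far neighbour open, so it need not be answered. *)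
  assert (Un : forall x v, inner v -> unsafe b1 x v -> adj j u x v -> x <> qk \/ v <> qv ->
    v = u /\ qv = u /\ twin b j u /\ nx x j /\ x = 2 * j - qk).
  { intros x v iv Ux Ax D.
    destruct (S x v qk qv iv iq (V _ _ Ux) (V _ _ Uq) D) as [_ C].
    destruct (C j u Ax Aq B0 Fj) as (-> & -> & T).
    destruct Ax as [[? ?]|[_ Ax]], Aq as [[? ?]|[_ Aq]]; try (exfalso; clear - H0; lia); try (exfalso; clear - H1; lia).
    split; [auto|split; [auto|split; [auto|]]]; clear - Ax Aq D; unfold nx in *; lia. }
  assert (Ux2 : forall x v, inner v -> unsafe b1 x v -> adj j u x v -> x <> qk \/ v <> qv ->
    formA b x j (mate v) /\ nx x j /\ v = u /\ twin b j u).
  { intros x v iv Ux Ax D; destruct (Un x v iv Ux Ax D) as (-> & _ & T & Hx & _).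
    split; auto; destruct T as [T1 T2].
    assert (x = j + 1 \/ x = j - 1) as [->| ->] by (clear - Hx; unfold nx in *; lia); auto. }
  destruct (legal_free b1 qk qv W1 iq) as [c' Lc].
  + destruct Uq; lia.
  + apply Uq.
  + pose proof (L qk qv iq (V _ _ Uq)) as T; unfold two0 in T.
    assert (forall x t, b x t = 0 -> b1 x t = 0 \/ x = j /\ t = u) as G.
    { intros x t Hx; destruct (classic (x = j /\ t = u)); auto; left; rewrite Ch; auto; lia. }
    pose proof (G qk (mate qv)) as G1; pose proof (G qk (pend qv)) as G2.
    pose proof (G (qk - 1) qv) as G3; pose proof (G (qk + 1) qv) as G4.
    clearbody b1; clear - T G1 G2 G3 G4 iq; destruct iq as [->| ->]; simpl in *; lia.
  + exists qk, qv, c'; split; [auto|split; [auto|split; [auto|]]].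
    split; [auto|split; [|split; [|split; [|split; [auto|split; [auto|]]]]]].
    * intros x v iv Ux D; destruct (classic (adj j u x v)) as [Ax|Ax]; [|now apply IL1].
      destruct (Ux2 x v iv Ux Ax D) as (T & Hx & -> & _).
      rewrite (nx_two0 b1 x j) by auto.
      destruct (PK x j u iv Ux Hx T) as (P1 & _ & P3).
      { intros _; split; auto; clear - Hx; unfold nx in *; lia. }
      clear - P1 P3; unfold two0; lia.
    * intros k v k' v' i1 i2 U1 U2 D.
      destruct (S k v k' v' i1 i2 (V _ _ U1) (V _ _ U2) D) as [Na C]; split; auto.
      intros D1 D2 x t a a' H Nf.
      destruct (C x t a a' (ext0 _ _ _ _ E H)) as (-> & -> & Tw); [intros G; now apply Nf, F|].
      split; [auto|split; auto].
      assert (Hx : forall y, nx y x -> y = k \/ y = k').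
      { intros y Hy; clear - Hy a a' D; destruct a as [[_ ?]|[_ ?]], a' as [[_ ?]|[_ ?]]; unfold nx in *; lia. }
      apply TK; auto.
      -- destruct (Hx (x - 1)) as [->| ->]; auto; right; lia.
      -- destruct (Hx (x + 1)) as [->| ->]; auto; left; lia.
      -- intros y Hy Hp Ay.
         assert (Uy : unsafe b1 y t /\ (y <> qk \/ t <> qv)) by (destruct (Hx y Hy) as [->| ->]; auto).
         destruct Uy as [Uy Dy].
         destruct (Un y t i1 Uy Ay Dy) as (-> & -> & Tj & Hj & Eq).
         split; auto; intros Ej.
         destruct Hp as (_ & _ & _ & _ & _ & _ & _ & P6).
         destruct (V _ _ Uq) as (Rq & _ & Q0 & _).
         (* The last clause of [formA] demands a stone, or a wall, exactly where the open unsafe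
            cell [(qk, qv)] would be. *)
         replace (3 * y - 2 * x) with qk in P6 by (clear - Eq Ej; lia).
         rewrite op_op in P6 by auto; clear - P6 Rq Q0; lia.
    * intros k f Hk Nk Hn Ff; destruct (IN1 k f Hk Nk Hn Ff) as [|(p & ip & Up & Ap & P)]; [now left|right].
      exists p; destruct (classic (k = qk /\ mate p = qv)) as [[<- <-]|D]; [tauto|exfalso].
      destruct (Ux2 k (mate p) (op_inn p ip) Up Ap) as (T & Hx & _); [clear - D; lia|].
      apply (formA_self b k j (mate (mate p)) f); auto.
    * intros k f v iv Hk Hn Ff H0 H1 Ux D; destruct (classic (adj j u (2 * k - f) v)) as [Ax|Ax]; [|now apply IA1].
      exfalso; destruct (Ux2 _ v iv Ux Ax D) as (T & Hx & -> & _).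
      assert (k = j \/ k = 2 * (2 * k - f) - j) as [->|Ek] by (clear - Hx Hn; unfold nx in *; lia); [auto|].
      apply (formA_host b (2 * k - f) j (mate u) k f); auto.
- left; split; [auto|split; [|split; [apply (IS_keep b); auto|split; [|split; [auto|split; [auto|]]]]]].
  + intros x v iv Ux; apply IL1; auto; intros Ax; apply NQ; now exists x, v.
  + intros x v iv Nx U1 U2 T; apply TK; auto.
    intros k Hk _ Ak; exfalso; apply NQ; exists k, v.
    assert (k = x + 1 \/ k = x - 1) as [->| ->] by (clear - Hk; unfold nx in *; lia); auto.
  + intros k f Hk Nk Hn Ff; destruct (IN1 k f Hk Nk Hn Ff) as [|(p & ip & Up & Ap & P)]; [auto|].
    elim NQ; exists k, (mate p); auto using op_inn.
  + intros k f v iv Hk Hn Ff H0 H1 Ux; apply IA1; auto; intros Ax; apply NQ; now exists (2 * k - f), v.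
Qed.

(** * Crossings and how they are broken *)

Definition nocross (b : board) (s : Z) := forall p q, ~ crossing b s p q.

Lemma nocross_zz b l r : nocross b l \/ nocross b r -> ~ crossing_gap b l r.
Proof. intros [H|H] (x & y & _ & _ & _ & C1 & C2 & _); eapply H; eauto. Qed.

Lemma nocross_crossy b s : nocross b s -> ~ crossed b s.
Proof. intros H (x & y & _ & _ & _ & C1 & _); eapply H; eauto. Qed.

Lemma IZ1_keep b b2 s : IZ1 b -> ext b b2 -> (forall k v, k <> s -> b2 k v = b k v) -> nocross b2 s -> IZ1 b2.
Proof.
intros Z E Ch N k Fk Hz; assert (Fk' : freshcol b k) by (now apply (fr_anti b b2)).
destruct (Z.eq_dec (k - 1) s) as [D|D]; [apply (nocross_zz b2 (k - 1) (k + 1)); auto; left; now rewrite D|].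
destruct (Z.eq_dec (k + 1) s) as [D'|D']; [apply (nocross_zz b2 (k - 1) (k + 1)); auto; right; now rewrite D'|].
apply (Z k Fk'), (zz_same b b2); auto.
Qed.

Lemma IZ2_keep b b2 s : IZ2 b -> ext b b2 -> (forall k v, k <> s -> b2 k v = b k v) -> nocross b2 s -> IZ2 b2.
Proof.
intros Z E Ch N k Hk Fl Fr Hc; apply (fr_anti b) in Fl; auto; apply (fr_anti b) in Fr; auto.
destruct (Z.eq_dec k s) as [->|D]; [now apply (nocross_crossy b2 s)|].
apply (Z k Hk Fl Fr), (crossy_same b b2); auto.
Qed.

(** The column shows only [x] and [y] and the neighbour in [k] is open, so the far neighbour alone
    can forbid a further colour; one of the four is left. *)
Lemma fill_color b s k w x y : wf b -> 1 <= s <= n -> (w <= 3)%nat -> b s w = 0 -> nx s k -> b k w = 0 ->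
  (forall v, b s v = 0 \/ b s v = x \/ b s v = y) ->
  exists c, allowed b s w c /\ c <> x /\ c <> y.
Proof.
intros W Hs Hw H0 Hn Hk H; destruct (pick3 x y (b (2 * s - k) w)) as (c & C1 & C2 & C3 & C4).
exists c; split; [|auto]; split; [auto|split; [auto|split; [auto|split; [auto|]]]].
intros k' v' [[<- _]|[<- N]] E.
- specialize (H v'); lia.
- assert (k' = k \/ k' = 2 * s - k) as [->| ->] by (unfold nx in *; lia); [lia|congruence].
Qed.

Lemma upd2_ne b j u c s w c' k v : ~ (k = j /\ v = u) -> ~ (k = s /\ v = w) ->
  upd (upd b j u c) s w c' k v = b k v.
Proof. intros; rewrite !upd_ne; auto; lia. Qed.

(** Bob has taken the open end of an H column. Alice completes the column in [(j, v)] with a colour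
    other than Bob's: in a crossing these two cells would agree. In the case [marked] she uses the
    marked colour. *)
Lemma fill_half b j u c v f : Inv b -> allowed b j u c -> 1 < j < n -> formH b j v -> nx j f -> freshcol b f ->
  u = pend (mate v) -> exists s w c', allowed (upd b j u c) s w c' /\ Inv (upd (upd b j u c) s w c').
Proof.
intros I Lg Hj Hv Hn Ff ->; pose proof I as (W & L & S & N & Z1 & Z2 & A).
set (b1 := upd b j (pend (mate v)) c) in *.
assert (W1 : wf b1) by (now apply wf_upd).
pose proof Hv as (i & H0 & H1 & H2 & H3).
assert (c0 : c <> 0) by (destruct Lg; lia).
assert (Nv : v <> pend (mate v)) by (destruct i as [->| ->]; discriminate).
assert (No : mate v <> pend (mate v)) by (destruct i as [->| ->]; discriminate).
assert (Np : pend v <> pend (mate v)) by (destruct i as [->| ->]; discriminate).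
assert (X : exists c', allowed b1 j v c' /\ c' <> c /\
  (unsafe b (2 * j - f) v -> marked b j f v -> c' = b (2 * f - j) (mate v))).
{ assert (LI : forall c', 1 <= c' <= 4 -> c' <> b j (mate v) -> c' <> b (2 * j - f) v -> allowed b1 j v c').
  { intros c' R D1 D2; apply legal_inner; auto; try lia; unfold b1; rewrite !upd_ne by (auto; lia); auto.
    - congruence.
    - destruct Hn as [->| ->]; [|now replace (2 * j - (j + 1)) with (j - 1) in D2 by lia].
      destruct Ff as (_ & F0 & F1 & F2 & _); destruct i as [->| ->]; lia.
    - destruct Hn as [->| ->]; [now replace (2 * j - (j - 1)) with (j + 1) in D2 by lia|].
      destruct Ff as (_ & F0 & F1 & F2 & _); destruct i as [->| ->]; lia. }
  destruct (classic (unsafe b (2 * j - f) v /\ marked b j f v)) as [[U (M1 & M2 & M3)]|NM].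
  - exists (b (2 * f - j) (mate v)); split; [|split; auto].
    + apply LI.
      * pose proof (proj1 W (2 * f - j) (mate v)); lia.
      * rewrite <- H2, <- M2; apply (proj2 (proj2 W)); [|congruence].
        apply adj_nx; unfold nx in *; lia.
      * destruct U as (_ & _ & U & _); congruence.
    (* The third equation of [marked] puts the marked colour next to Bob's cell, so he did not use
       it. *)
    + rewrite <- M3; intros E; apply (legalN b j (pend (mate v)) c (2 * j - f) (pend (mate v)) Lg); auto.
      apply adj_nx; unfold nx in *; lia.
  - destruct (pick3 (b j (mate v)) c (b (2 * j - f) v)) as (c' & P1 & P2 & P3 & P4).
    exists c'; split; [apply LI; auto|split; auto]; intros; tauto. }
destruct X as (c' & Lc & Dc & HM).
exists j, v, c'; split; auto.
set (b2 := upd b1 j v c').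
assert (c0' : c' <> 0) by (destruct Lc; lia).
assert (E : ext b b2).
{ apply (ext_trans _ b1); apply ext_upd; [apply Lg|apply Lc]. }
assert (Cs : forall k t, k <> j -> b2 k t = b k t).
{ intros k t D; unfold b2, b1; apply upd2_ne; lia. }
assert (Cv : b2 j v = c') by (unfold b2; now rewrite upd_eq).
assert (Co : b2 j (mate v) = b j (mate v)) by (now apply E).
assert (Cu : b2 j (pend (mate v)) = c).
{ unfold b2; rewrite upd_ne by auto; unfold b1; now rewrite upd_eq. }
assert (NC : nocross b2 j).
{ intros p q (C1 & C2 & C3 & C4); destruct i as [->| ->]; simpl in *; lia. }
assert (FC : formC b2 j) by (destruct i as [->| ->]; split; simpl in *; congruence).
assert (Fj : ~ freshcol b j).
{ intros (_ & _ & G1 & G2 & _); destruct i as [->| ->]; auto. }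
apply (fill_keep b b2 j (pend (mate v)) j v); auto.
- now apply wf_upd.
- intros k t D1 D2; unfold b2, b1; now apply upd2_ne.
- now apply (IZ1_keep b b2 j).
- now apply (IZ2_keep b b2 j).
- left; split; exists f; auto.
- intros q t it U Ha.
  assert (Uq : q <> j).
  { intros ->; destruct U as (_ & _ & U & _), FC as [G1 G2]; destruct it as [->| ->]; auto. }
  assert (Ub : unsafe b q t).
  { apply (uns_anti b b2); auto; intros G; apply (proj1 (proj2 U)).
    destruct G as (G & G0 & G1 & G2 & G3); unfold freshcol; now rewrite !Cs by auto. }
  assert (t = v /\ nx j q) as [-> Hq].
  { destruct Ha as [[[-> _]|[<- Hq]]|[[-> _]|[<- Hq]]]; try congruence; auto.
    exfalso; destruct i as [->| ->], it as [E1|E1]; discriminate E1. }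
  assert (q = 2 * j - f) as ->.
  { assert (q <> f) by (intros ->; now apply (proj1 (proj2 Ub))). unfold nx in *; lia. }
  exists j, f; repeat split; auto; try (apply Cs; unfold nx in *; lia).
  destruct (A j f v i Hj Hn Ff H0 H1 Ub) as [Sl|Mk]; [apply Sl|].
  (* The marked colour in [(j, v)] repeats the end above or below the cell behind, which is then no
     longer unsafe. *)
  exfalso; apply (proj2 (proj2 (proj2 U))); rewrite (nx_rp b2 _ j) by (unfold nx in *; lia).
  rewrite Cv, (HM Ub Mk); destruct Mk as (M1 & M2 & M3).
  rewrite (Cs (2 * j - f) (pend v)) by auto; unfold rep4; rewrite M2; tauto.
  destruct (A j f v i Hj Hn Ff H0 H1 Ub) as [Sl|Mk]; [apply Sl|].
  exfalso; apply (proj2 (proj2 (proj2 U))); rewrite (nx_rp b2 _ j) by (unfold nx in *; lia).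
  rewrite Cv, (HM Ub Mk); destruct Mk as (M1 & M2 & M3).
  rewrite (Cs (2 * j - f) (pend v)) by auto; unfold rep4; rewrite M2; tauto.
Qed.

Lemma zeros_one b s : zeros b s = 1 -> exists w, (w <= 3)%nat /\ b s w = 0 /\
  forall v, (v <= 3)%nat -> v <> w -> b s v <> 0.
Proof.
unfold zeros; intros Hz.
pose proof (o_spec (b s 0%nat)) as O0; pose proof (o_spec (b s 1%nat)) as O1.
pose proof (o_spec (b s 2%nat)) as O2; pose proof (o_spec (b s 3%nat)) as O3.
destruct O0 as [[? ?]|[? ?]], O1 as [[? ?]|[? ?]], O2 as [[? ?]|[? ?]], O3 as [[? ?]|[? ?]]; try lia;
  [exists 0%nat|exists 1%nat|exists 2%nat|exists 3%nat]; (split; [lia|split; [auto|]]);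
  intros [|[|[|[|v]]]] V1 V2; auto; lia.
Qed.

Lemma zeros_only b s w : zeros b s = 1 -> (w <= 3)%nat -> b s w = 0 ->
  forall v, (v <= 3)%nat -> v <> w -> b s v <> 0.
Proof.
intros Hz Hw H0; destruct (zeros_one b s Hz) as (w' & Hw' & H0' & H).
destruct (Nat.eq_dec w w') as [->|D]; auto; now elim (H w).
Qed.

(** The cell two rows away is coloured [x] or [y], and a crossing in any pair of colours would
    require it to agree with the new stone. *)
Lemma nocross_fill b s x y w c : crossing b s x y -> zeros b s = 1 -> (w <= 3)%nat -> b s w = 0 ->
  c <> 0 -> c <> x -> c <> y -> nocross (upd b s w c) s.
Proof.
intros (C1 & C2 & C3 & C4) Hz Hw H0 c0 cx cy p q (D1 & D2 & D3 & D4).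
pose proof (zeros_only b s w Hz Hw H0) as H; clear Hz.
pose proof (H 0%nat); pose proof (H 1%nat); pose proof (H 2%nat); pose proof (H 3%nat); clear H.
destruct w as [|[|[|[|w]]]]; [| | | |exfalso; lia].
- rewrite upd_eq in D1; rewrite upd_ne in D2 by lia; lia.
- rewrite upd_eq in D3; rewrite upd_ne in D4 by lia; lia.
- rewrite upd_eq in D2; rewrite upd_ne in D1 by lia; lia.
- rewrite upd_eq in D4; rewrite upd_ne in D3 by lia; lia.
Qed.

Lemma full_fill b s w c : zeros b s = 1 -> (w <= 3)%nat -> b s w = 0 -> c <> 0 ->
  forall v, (v <= 3)%nat -> upd b s w c s v <> 0.
Proof.
intros Hz Hw H0 c0 v Hv; destruct (Nat.eq_dec v w) as [->|]; [now rewrite upd_eq|rewrite upd_ne by auto].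
now apply (zeros_only b s w).
Qed.

Lemma zeros_move b j u c : (u <= 3)%nat -> b j u = 0 -> c <> 0 -> zeros b j = zeros (upd b j u c) j + 1.
Proof.
intros Hu H0 Hc; unfold zeros.
destruct u as [|[|[|[|u]]]]; try lia; rewrite upd_eq, !upd_ne by lia; rewrite H0;
  pose proof (o_spec c); pose proof (o_spec 0); lia.
Qed.

Lemma cr_cells b s x y : wf b -> crossing b s x y -> forall v, b s v = 0 \/ b s v = x \/ b s v = y.
Proof.
intros (_ & O & _) (C1 & C2 & C3 & C4) [|[|[|[|v]]]]; try tauto.
left; apply O; lia.
Qed.

(** Two cells of the column were open before Bob's move, by [IZ2]. U and A need a stone in a
    neighbouring column, so the shape was C or H, and the cell left over is an end. A third colour
    there touches no unsafe cell, both neighbours being fresh. *)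
Lemma fill_both b j u c : Inv b -> allowed b j u c -> ~ freshcol b j -> 1 < j < n ->
  (forall v f, formH b j v -> nx j f -> freshcol b f -> u <> pend (mate v)) ->
  freshcol b (j - 1) -> freshcol b (j + 1) -> crossed (upd b j u c) j ->
  exists s w c', allowed (upd b j u c) s w c' /\ Inv (upd (upd b j u c) s w c').
Proof.
intros I Lg Fj Hj NV Fl Fr Hc; pose proof I as (W & L & S & N & Z1 & Z2 & A).
pose proof (Z2 j Hj Fl Fr) as NC.
destruct Hc as (x & y & xy & x0 & y0 & C & Hz).
pose proof (fun G => NC (ex_intro _ x (ex_intro _ y (conj xy (conj x0 (conj y0 (conj (cr_ext _ _ _ _ _
  (ext_upd b j u c (proj1 (proj2 (proj2 (proj2 Lg))))) C) G))))))) as NZ.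
set (b1 := upd b j u c) in *.
assert (W1 : wf b1) by (now apply wf_upd).
assert (c0 : c <> 0) by (destruct Lg; lia).
assert (Hu : (u <= 3)%nat) by apply Lg.
assert (Zm : zeros b j = zeros b1 j + 1) by (apply zeros_move; auto; apply Lg).
assert (Z1j : zeros b1 j = 1) by (destruct (Z_le_gt_dec (zeros b j) 1); [tauto|lia]).
destruct (zeros_one b1 j Z1j) as (w & Hw & Hw0 & Hwv).
assert (E1 : ext b b1) by (apply ext_upd, Lg).
assert (FC : formC b1 j).
{ assert (Hn : nx j (j - 1)) by (now left).
  destruct (N j (j - 1) Hj Fj Hn Fl) as [[C1 C2]|[[v Hv]|[[v Hv]|[p Hp]]]].
  - split; rewrite E1; auto.
  - pose proof (NV v (j - 1) Hv Hn Fl) as Du; destruct Hv as (i & H0 & H1 & H2 & H3).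
    assert (w = pend (mate v)).
    { destruct (Nat.eq_dec w (pend (mate v))) as [|D]; auto; elim (Hwv (pend (mate v))); auto.
      - destruct i as [->| ->]; simpl; lia.
      - unfold b1; rewrite upd_ne by auto; auto. }
    destruct i as [->| ->]; simpl in *; subst w; split; apply Hwv; lia.
  - destruct Hv as (i & _ & _ & G & _); elim G; replace (2 * j - (j - 1)) with (j + 1) by lia.
    destruct Fr as (_ & ? & ? & ? & ?), i as [->| ->]; auto.
  - destruct Hp as (i & _ & _ & G0 & _ & G & _); elim G0; rewrite <- G; replace (2 * j - (j - 1)) with (j + 1) by lia.
    destruct Fr as (_ & ? & ? & ? & ?), i as [->| ->]; auto. }
assert (Wp : w = 0%nat \/ w = 3%nat).
{ destruct FC; destruct w as [|[|[|[|w]]]]; auto; try contradiction; lia. }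
assert (Fl1 : b1 (j - 1) w = 0).
{ unfold b1; rewrite upd_ne by lia; destruct Fl as (_ & ? & ? & ? & ?), Wp as [->| ->]; auto. }
destruct (fill_color b1 j (j - 1) w x y W1) as (c' & Lc & cx & cy); auto; try lia.
{ now left. } { now apply cr_cells. }
exists j, w, c'; split; auto.
set (b2 := upd b1 j w c').
assert (c0' : c' <> 0) by (destruct Lc; lia).
assert (E : ext b b2).
{ apply (ext_trans _ b1); apply ext_upd; [apply Lg|apply Lc]. }
assert (Cs : forall k t, k <> j -> b2 k t = b k t).
{ intros k t D; unfold b2, b1; apply upd2_ne; lia. }
assert (NC2 : nocross b2 j) by (now apply (nocross_fill b1 j x y)).
assert (FF : forall v, (v <= 3)%nat -> b2 j v <> 0) by (now apply full_fill).
assert (FC2 : formC b2 j) by (split; apply FF; lia).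
apply (fill_keep b b2 j u j w); auto.
- now apply wf_upd.
- intros k t D1 D2; unfold b2, b1; now apply upd2_ne.
- now apply (IZ1_keep b b2 j).
- now apply (IZ2_keep b b2 j).
- left; split; exists (j - 1); (split; [now left|auto]).
- intros q t it U Ha; exfalso.
  assert (Uq : q <> j).
  { intros ->; destruct U as (_ & _ & U & _), FC2 as [G1 G2]; destruct it as [->| ->]; auto. }
  assert (Hq : nx j q).
  { destruct Ha as [[[-> _]|[_ Hq]]|[[-> _]|[_ Hq]]]; try congruence; auto. }
  apply (proj1 (proj2 U)).
  assert (freshcol b q) as G by (destruct Hq as [->| ->]; auto).
  destruct G as (G & G0 & G1 & G2 & G3); unfold freshcol; now rewrite !Cs by auto.
Qed.

Lemma zeros_ge b s : 0 <= zeros b s.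
Proof.
unfold zeros; pose proof (o_spec (b s 0%nat)); pose proof (o_spec (b s 1%nat)).
pose proof (o_spec (b s 2%nat)); pose proof (o_spec (b s 3%nat)); lia.
Qed.

Lemma zeros_none b s : zeros b s = 0 -> forall v, (v <= 3)%nat -> b s v <> 0.
Proof.
unfold zeros; intros G v Hv E.
pose proof (o_spec (b s 0%nat)); pose proof (o_spec (b s 1%nat)).
pose proof (o_spec (b s 2%nat)); pose proof (o_spec (b s 3%nat)).
destruct v as [|[|[|[|v]]]]; lia.
Qed.

(** Counting open cells leaves only the shape U: C has no open inner cell, H has an open end as
    well, and A has two open inner cells. *)
Lemma half_full b s w g : zeros b s = 1 -> inner w -> b s w = 0 -> form b s g -> b (2 * s - g) w <> 0.
Proof.
intros Hz i H0 F.
assert (Z : forall v, (v <= 3)%nat -> v <> w -> b s v <> 0).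
{ apply zeros_only; auto; destruct i as [->| ->]; lia. }
assert (Zi : forall v, inner v -> b s v = 0 -> v = w).
{ intros v iv Hv; destruct (Nat.eq_dec v w); auto; elim (Z v); auto; destruct iv as [->| ->]; lia. }
destruct F as [[C1 C2]|[[v (iv & V0 & V1 & V2 & V3)]|[[v (iv & V0 & V1 & V2 & V3)]|[p (ip & P0 & P1 & _)]]]].
- destruct i as [->| ->]; contradiction.
- elim (Z (pend (mate v))); auto; destruct iv as [->| ->]; simpl; try lia; destruct i as [->| ->]; lia.
- now rewrite <- (Zi v iv V0).
- elim (op_ne p ip); rewrite (Zi p ip P0); rewrite <- (Zi (mate p) (op_inn p ip) P1) at 2.
  now rewrite (Zi p ip P0).
Qed.

Lemma nx_sym k f : nx k f -> nx f k.
Proof. unfold nx; lia. Qed.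
Lemma nx_case k f g : nx k f -> nx k g -> g = f \/ g = 2 * k - f.
Proof. unfold nx; lia. Qed.
Lemma nx_mid k j : nx j k -> 1 < k < n -> 1 < 2 * j - k < n -> 1 < j < n.
Proof. unfold nx; lia. Qed.

(** Since [IZ1] held before, exactly one cell of the two columns is still open. Alice gives it a
    third colour, in whichever column it lies; the work is to check the unsafe cells and fresh
    columns behind both. *)
Lemma fill_zz b j u c k : Inv b -> allowed b j u c -> ~ freshcol b j ->
  (forall v f, 1 < j < n -> formH b j v -> nx j f -> freshcol b f -> u <> pend (mate v)) ->
  freshcol b k -> nx j k -> crossing_gap (upd b j u c) j (2 * k - j) ->
  exists s w c', allowed (upd b j u c) s w c' /\ Inv (upd (upd b j u c) s w c').
Proof.
intros I Lg Fj NV Fk Hn Hz; pose proof I as (W & L & S & N & Z1 & Z2 & A).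
assert (NZ : ~ crossing_gap b j (2 * k - j)).
{ intros G; apply (Z1 k Fk); apply (nx_zz b k j); auto; unfold nx in *; lia. }
assert (E1 : ext b (upd b j u c)) by (apply ext_upd, Lg).
set (b1 := upd b j u c) in *.
remember (2 * k - j) as r eqn:Er.
assert (W1 : wf b1) by (now apply wf_upd).
assert (c0 : c <> 0) by (destruct Lg; lia).
assert (Hu : (u <= 3)%nat) by apply Lg.
assert (Zm : zeros b j = zeros b1 j + 1) by (apply zeros_move; auto; apply Lg).
assert (rj : r <> j /\ r <> k /\ j <> k) by (unfold nx in *; lia).
assert (Cr : forall v, b1 r v = b r v) by (intros v; unfold b1; rewrite upd_ne; auto; lia).
assert (Zr : zeros b1 r = zeros b r) by (now apply zeros_same).
destruct Hz as (x & y & xy & x0 & y0 & Cj & Crr & Hs).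
assert (Zs : zeros b1 j + zeros b1 r = 1).
{ destruct (Z_le_gt_dec (zeros b j + zeros b r) 1) as [G|G]; [|lia].
  elim NZ; exists x, y; refine (conj xy (conj x0 (conj y0 (conj _ (conj _ G))))); now apply (cr_ext b b1). }
assert (Kr : 1 < k < n) by apply Fk.
assert (Hr : 1 <= r <= n /\ 1 <= j <= n) by (unfold nx in *; lia).
assert (nr : nx r k) by (unfold nx in *; lia).
assert (Fk1 : forall v, (v <= 3)%nat -> b1 k v = 0).
{ intros v Hv; unfold b1; rewrite upd_ne by lia; destruct Fk as (_ & ? & ? & ? & ?).
  destruct v as [|[|[|[|v]]]]; auto; lia. }
pose proof (zeros_ge b1 j) as Zpj; pose proof (zeros_ge b1 r) as Zpr.
assert (Cs0 : exists s w c', (s = j \/ s = r) /\ zeros b1 s = 1 /\ (w <= 3)%nat /\ b1 s w = 0 /\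
  allowed b1 s w c' /\ c' <> x /\ c' <> y).
{ destruct (Z.eq_dec (zeros b1 j) 1) as [G|G].
  - destruct (zeros_one b1 j G) as (w & Hw & Hw0 & _).
    destruct (fill_color b1 j k w x y W1) as (c' & Lc & cx & cy); auto; try lia.
    { now apply cr_cells. }
    exists j, w, c'; tauto.
  - assert (G' : zeros b1 r = 1) by lia.
    destruct (zeros_one b1 r G') as (w & Hw & Hw0 & _).
    destruct (fill_color b1 r k w y x W1) as (c' & Lc & cx & cy); auto; try lia.
    { now apply cr_cells. }
    exists r, w, c'; tauto. }
destruct Cs0 as (s & w & c' & Hsjr & Zs1 & Hw & Hw0 & Lc & cx & cy).
exists s, w, c'; split; auto.
set (b2 := upd b1 s w c').
assert (c0' : c' <> 0) by (destruct Lc; lia).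
assert (E2 : ext b1 b2) by (apply ext_upd, Lc).
assert (E : ext b b2) by (now apply (ext_trans _ b1)).
assert (Cs : forall k t, k <> j -> k <> r -> b2 k t = b k t).
{ intros g t D D'; unfold b2, b1; apply upd2_ne; intros [G _]; [auto|destruct Hsjr; congruence]. }
assert (NC2 : nocross b2 s).
{ destruct Hsjr as [->| ->]; [now apply (nocross_fill b1 j x y)|now apply (nocross_fill b1 r y x)]. }
assert (Full : forall g v, g = j \/ g = r -> (v <= 3)%nat -> b2 g v <> 0).
{ intros g v Hg Hv; destruct (Z.eq_dec g s) as [->|D].
  - now apply full_fill.
  - assert (G : zeros b1 g = 0) by (destruct Hg as [->| ->], Hsjr as [->| ->]; try lia; contradiction).
    unfold b2; rewrite upd_ne by auto; now apply zeros_none. }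
(* If Alice answers in [r], Bob has completed column [j], which had one open cell before; a second
   fresh neighbour of [j] would contradict [IZ2]. *)
assert (Dj : s <> j -> freshcol b (2 * j - k) -> False).
{ intros D Fo; assert (s = r) as -> by tauto.
  assert (Hj : 1 < j < n) by (apply (nx_mid k); auto; apply Fo).
  assert (freshcol b (j - 1) /\ freshcol b (j + 1)) as [Fl Fr].
  { destruct Hn as [->| ->].
    - replace (2 * j - (j - 1)) with (j + 1) in Fo by lia; auto.
    - replace (2 * j - (j + 1)) with (j - 1) in Fo by lia; auto. }
  apply (Z2 j Hj Fl Fr); exists x, y; refine (conj xy (conj x0 (conj y0 (conj _ _)))); [now apply (cr_ext b b1)|lia]. }
assert (Fr1 : ~ freshcol b r).
{ intros (_ & G0 & G1 & G2 & G3); assert (zeros b1 r = 4); [|lia].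
  unfold zeros; rewrite !Cr, G0, G1, G2, G3; reflexivity. }
assert (Fs : ~ freshcol b s) by (destruct Hsjr as [->| ->]; auto).
apply (fill_keep b b2 j u s w); auto.
- now apply wf_upd.
- intros g t D1 D2; unfold b2, b1; now apply upd2_ne.
- intros _; split; apply Full; auto; lia.
- intros _; split; apply Full; auto; lia.
- intros g Fg Hg; apply (fr_anti b) in Fg; auto.
  assert (forall e, nx g e -> e <> s) as X1.
  { intros e He ->; apply (nx_zz b2 g s He) in Hg; revert Hg; apply nocross_zz; auto. }
  assert (forall e, nx g e -> e <> j) as X2.
  { intros e He ->; assert (D : s <> j) by (intros G; apply (X1 j He); auto).
    destruct (nx_case j k g Hn (nx_sym _ _ He)) as [->| ->].
    - apply (X1 r); [now apply nx_sym|destruct Hsjr; [contradiction|auto]].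
    - now apply Dj. }
  assert (forall e, nx g e -> e <> r) as X3.
  { intros e He ->; destruct Hsjr as [->| ->]; [|now apply (X1 r)].
    destruct (nx_case r k g nr (nx_sym _ _ He)) as [->| ->].
    - apply (X2 j); auto; now apply nx_sym.
    - assert (Hr' : 1 < r < n) by (apply (nx_mid k); auto; apply Fg).
      assert (freshcol b (r - 1) /\ freshcol b (r + 1)) as [Fl Fr].
      { destruct nr as [->| ->].
        - replace (2 * r - (r - 1)) with (r + 1) in Fg by lia; auto.
        - replace (2 * r - (r + 1)) with (r - 1) in Fg by lia; auto. }
      apply (Z2 r Hr' Fl Fr); exists y, x; refine (conj _ (conj y0 (conj x0 (conj _ _)))); auto; [|lia].
      now apply (cr_same b b1). }
  apply (Z1 g Fg), (zz_same b b2); auto; intros v; apply Cs;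
    first [apply X2 | apply X3]; unfold nx; lia.
- intros g Hg Fl Fr Hc; apply (fr_anti b) in Fl; auto; apply (fr_anti b) in Fr; auto.
  destruct (Z.eq_dec g s) as [->|Ds]; [now apply (nocross_crossy b2 s)|].
  destruct (Z.eq_dec g j) as [->|Dg].
  { apply Dj; auto; destruct Hn as [->| ->].
    - now replace (2 * j - (j - 1)) with (j + 1) by lia.
    - now replace (2 * j - (j + 1)) with (j - 1) by lia. }
  destruct (Z.eq_dec g r) as [->|Dg'].
  { apply (Z2 r Hg Fl Fr); exists y, x; refine (conj _ (conj y0 (conj x0 (conj _ _)))); auto; [|lia].
    now apply (cr_same b b1). }
  apply (Z2 g Hg Fl Fr), (crossy_same b b2); auto.
- left; split; exists k; [auto|destruct Hsjr as [->| ->]; auto].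
- intros q t it U Ha.
  assert (Uq : q <> j /\ q <> r).
  { assert (G : forall g, g = j \/ g = r -> q <> g).
    { intros g Hg ->; destruct U as (_ & _ & U & _); apply (Full g t); auto; destruct it as [->| ->]; lia. }
    auto. }
  assert (Ub : unsafe b q t).
  { apply (uns_anti b b2); auto; intros G; apply (proj1 (proj2 U)).
    destruct G as (G & G0 & G1 & G2 & G3); unfold freshcol; now rewrite !Cs by tauto. }
  assert (Qk : q <> k) by (intros ->; now apply (proj1 (proj2 Ub))).
  pose proof Ub as (Qn & _ & Q0 & _).
  destruct (Z.eq_dec s j) as [->|Ds].
  + assert (Hq : nx j q) by (destruct Ha as [[[-> _]|[_ Hq]]|[[-> _]|[_ Hq]]]; tauto).
    assert (Ht : t = u \/ t = w) by (destruct Ha as [[[-> _]|[-> _]]|[[-> _]|[-> _]]]; tauto).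
    destruct (nx_case j k q Hn Hq) as [->| ->]; [contradiction|].
    assert (Hj : 1 < j < n) by (now apply (nx_mid k)).
    assert (B0 : b j t = 0) by (destruct Ht as [->| ->]; [apply Lg|now apply (ext0 b b1)]).
    destruct (N j k Hj Fj Hn Fk) as [[C1 C2]|[[v Hv]|[[v Hv]|[p Hp]]]].
    * destruct it as [->| ->]; contradiction.
    * pose proof (NV v k Hj Hv Hn Fk) as Du; pose proof Hv as (iv & V0 & V1 & V2 & V3).
      assert (v = t) as -> by (destruct iv as [->| ->], it as [->| ->]; simpl in *; congruence).
      destruct (A j k t it Hj Hn Fk V0 V1 Ub) as [Sl|Mk].
      -- exists j, k; split; [auto|split; [auto|split; [auto|split; [auto|]]]].
         rewrite !Cs; auto; clear - Hn Er; unfold nx in *; lia.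
      (* As the end of the H column is the last open cell, Bob played [(j, t)] itself. The crossing
         forces his colour to be the marked one, so the cell behind already sees a repetition. *)
      -- exfalso; assert (w = pend (mate t)).
         { destruct (Nat.eq_dec w (pend (mate t))) as [|D]; auto.
           elim (zeros_only b1 j w Zs1 Hw Hw0 (pend (mate t))); auto.
           - destruct it as [->| ->]; simpl; lia.
           - unfold b1; rewrite upd_ne by auto; auto. }
         assert (t = u) as ->.
         { destruct Ht; auto; subst; destruct it as [G|G]; rewrite G in *; discriminate. }
         destruct Mk as (M1 & M2 & _); rewrite <- Er in M1, M2.
         assert (Ec : b r (mate u) = c).
         { rewrite <- Cr in M1 |- *; assert (G : b1 j u = c) by (unfold b1; now rewrite upd_eq).
           destruct Cj as (C1 & C2 & C3 & C4), Crr as (D1 & D2 & D3 & D4).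
           clearbody b1; clear - G M1 C1 C2 C3 C4 D1 D2 D3 D4 c0 it.
           destruct it as [->| ->]; simpl in *; lia. }
         apply (proj2 (proj2 (proj2 U))); rewrite (nx_rp b2 _ j) by now apply nx_sym.
         rewrite (Cs (2 * j - k) (pend u)) by tauto; unfold rep4; right; left.
         rewrite M2; split; auto; left; rewrite Ec; unfold b2.
         rewrite upd_ne; [unfold b1; now rewrite upd_eq|right].
         intros G; subst w; destruct it as [G'|G']; rewrite G' in *; discriminate.
    * destruct Hv as (iv & V0 & V1 & V2 & V3).
      assert (v = t) as -> by (destruct iv as [->| ->], it as [->| ->]; simpl in *; congruence).
      contradiction.
    * destruct Hp as (_ & _ & _ & P2 & P3 & _); elim xy; apply (crA b j); auto; now apply (cr_ext b b1).
  + exfalso; assert (s = r) as -> by tauto.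
    assert (Zj : zeros b j = 1) by (clear - Zm Zs Zs1; lia).
    destruct Ha as [[[-> _]|[-> Hq]]|[[-> _]|[-> Hq]]]; try tauto.
    * destruct (nx_case j k q Hn Hq) as [->| ->]; [contradiction|].
      assert (Hj : 1 < j < n) by (now apply (nx_mid k)).
      apply (half_full b j t k); auto; apply Lg.
    * destruct (nx_case r k q nr Hq) as [->| ->]; [contradiction|].
      assert (Hr' : 1 < r < n) by (now apply (nx_mid k)).
      apply (half_full b r t k); auto; [now rewrite <- Zr|now apply (ext0 b b1)].
Qed.

Definition reply (b : board) := exists k v c, allowed b k v c /\ Inv (upd b k v c).

Lemma bob_nonfresh b j u c : Inv b -> allowed b j u c -> ~ freshcol b j ->
  Inv (upd b j u c) \/ reply (upd b j u c).
Proof.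
intros I Lg Fj.
destruct (classic (exists v f, 1 < j < n /\ formH b j v /\ nx j f /\ freshcol b f /\ u = pend (mate v)))
  as [(v & f & Hj & Hv & Hn & Ff & Hu)|NV].
{ right; now apply (fill_half b j u c v f). }
assert (NV' : forall v f, 1 < j < n -> formH b j v -> nx j f -> freshcol b f -> u <> pend (mate v)).
{ intros v f Hj Hv Hn Ff Hu; apply NV; now exists v, f. }
pose proof I as (W & L & S & N & Z1 & Z2 & A).
assert (E : ext b (upd b j u c)) by (apply ext_upd, Lg).
assert (Cs : forall k t, k <> j -> upd b j u c k t = b k t) by (intros; apply upd_ne; auto).
destruct (classic (exists k, freshcol b k /\ nx j k /\ crossing_gap (upd b j u c) j (2 * k - j))) as [(k & Fk & Hn & Hz)|NZ].
{ right; now apply (fill_zz b j u c k). }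
destruct (classic (1 < j < n /\ freshcol b (j - 1) /\ freshcol b (j + 1) /\ crossed (upd b j u c) j)) as [(Hj & Fl & Fr & Hc)|NC].
{ right; apply fill_both; auto; intros v f Hv Hn Ff; now apply (NV' v f). }
destruct (after_move b j u c) as [|(qk & qv & c' & iq & U & Lc & X)]; auto.
- intros k Fk Hz; apply (fr_anti b) in Fk; auto.
  destruct (classic (nx k j)) as [D|D].
  + exfalso; apply NZ; exists k; split; [auto|split; [now apply nx_sym|]]; now apply (nx_zz _ k j).
  + apply (Z1 k Fk), (zz_same b (upd b j u c)); auto; intros v; apply Cs; intros G; apply D; unfold nx; lia.
- intros k Hk Fl Fr Hc; apply (fr_anti b) in Fl; auto; apply (fr_anti b) in Fr; auto.
  destruct (Z.eq_dec k j) as [->|D]; [now apply NC|].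
  apply (Z2 k Hk Fl Fr), (crossy_same b (upd b j u c)); auto.
- right; exists qk, qv, c'; split; auto; now apply color_unsafe.
Qed.

(** * Bob in a fresh column *)

Lemma fresh_uns b j k v : IN b -> freshcol b j -> nx k j -> inner v -> unsafe b k v -> formA b k j (mate v).
Proof.
intros N Fj Hn i (Hk & Nf & H0 & Nr).
destruct (N k j Hk Nf Hn Fj) as [[C1 C2]|[[t Ht]|[[t Ht]|[p Hp]]]].
- destruct i as [->| ->]; contradiction.
- assert (v = t) as ->; [|now elim Nr; apply formH_rp].
  pose proof Ht as (it & V0 & V1 & _); destruct i as [->| ->], it as [->| ->]; simpl in *; congruence.
- assert (v = t) as ->; [|now elim Nr; apply (formU_rp b k j)].
  pose proof Ht as (it & V0 & V1 & _); destruct i as [->| ->], it as [->| ->]; simpl in *; congruence.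
- assert (p = mate v) as <-; auto; destruct (formA_rp b k j p Hn Fj Hp) as [Rp _].
  pose proof Hp as (ip & _); destruct i as [->| ->], ip as [->| ->]; simpl in *; auto; contradiction.
Qed.

(* what the neighbour column [k] owes to an unsafe cell [(j, v)] *)
Definition okn (b b2 : board) (j : Z) (v : nat) (k : Z) :=
  (forall w, inner w -> ~ unsafe b k w) /\
  (b2 k v = 0 -> ~ freshcol b k -> ~ unsafe b (2 * k - j) v) /\
  (freshcol b (2 * k - j) -> b k v = 0 -> b k (mate v) <> 0 ->
     slack b2 k (2 * k - j) v \/ marked b2 k (2 * k - j) v).

(** The weakened hypotheses on [b] allow a board on which an answer in a neighbouring column is
    placed before Bob's move in [j]. Two open cells left in [j] keep it out of crossings, which
    tolerate only one. *)
Lemma fresh_keep b b2 j : Core b -> (forall k, k <> j -> freshcol b k -> ~ crossing_gap b (k - 1) (k + 1)) ->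
  (forall k, ~ nx k j -> 1 < k < n -> freshcol b (k - 1) -> freshcol b (k + 1) -> ~ crossed b k) ->
  wf b2 -> ext b b2 -> (forall k v, k <> j -> b2 k v = b k v) -> freshcol b j -> ~ freshcol b2 j -> 2 <= zeros b2 j ->
  (forall f, nx j f -> freshcol b f -> form b2 j f) ->
  (forall v, inner v -> unsafe b2 j v -> two0 (b2 j (mate v)) (b2 j (pend v)) (b2 (j - 1) v) (b2 (j + 1) v) /\
     ~ unsafe b2 j (mate v) /\ forall k, nx k j -> okn b b2 j v k) ->
  Inv b2.
Proof.
intros (W & L & S & N & A) Z1 Z2 W2 E Cs Fj Fj2 Zj HF HU.
assert (F : forall x, x <> j -> freshcol b x -> freshcol b2 x).
{ intros x D (H0 & H1 & H2 & H3 & H4); unfold freshcol; rewrite !Cs by auto; tauto. }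
assert (Fa : forall x, freshcol b2 x -> freshcol b x /\ x <> j).
{ intros x Fx; split; [now apply (fr_anti b b2)|intros ->; auto]. }
assert (V : forall x v, x <> j -> unsafe b2 x v -> unsafe b x v).
{ intros x v D U; apply (uns_anti b b2); auto; intros G; apply (proj1 (proj2 U)); auto. }
assert (FA : forall k v, inner v -> k <> j -> nx k j -> unsafe b2 k v -> formA b k j (mate v)).
{ intros k v i D Hn U; apply fresh_uns; auto. }
assert (Ac : forall k f p, formA b k f p -> k <> j /\ 2 * k - f <> j).
{ intros k f p (i & _ & _ & P2 & _ & P4 & _); destruct Fj as (_ & G0 & G1 & G2 & G3).
  split; intros G; rewrite G in *; [contradiction|].
  apply P2; rewrite <- P4; destruct i as [->| ->]; auto. }
assert (AK : forall k f p, formA b k f p -> formA b2 k f p).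
{ intros k f p Hp; destruct (Ac k f p Hp); pose proof Hp as (_ & P0 & P1 & _ & _ & _ & P5 & _).
  apply (formA_keep b); auto; rewrite Cs; auto. }
split; [auto|split; [|split; [|split; [|split; [|split]]]]].
- intros k v i U; destruct (Z.eq_dec k j) as [->|D]; [now apply HU|].
  destruct (classic (nx k j)) as [Hn|Hn].
  + pose proof (FA k v i D Hn U) as Hp; destruct (Ac _ _ _ Hp) as [_ D'].
    pose proof Hp as (_ & P0 & _ & _ & _ & _ & P5 & _); rewrite op_op in P5 by auto.
    rewrite (nx_two0 b2 k j) by auto; rewrite (Cs k), (Cs (2 * k - j)) by auto.
    unfold two0; rewrite P0, P5; clear; lia.
  + rewrite !Cs by (auto; intros G; apply Hn; clear - G; unfold nx; lia); apply L; auto.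
- assert (Sj : forall v k' v', inner v -> inner v' -> unsafe b2 j v -> unsafe b2 k' v' -> j <> k' \/ v <> v' ->
    ~ adj j v k' v' /\ forall x u, adj x u j v -> adj x u k' v' -> b2 x u = 0 -> ~ freshcol b2 x -> False).
  { intros v k' v' i i' U U' D.
    assert (D' : j <> k').
    { intros <-; apply (proj1 (proj2 (HU v i U))).
      assert (v' = mate v) as <-; auto; clear - i i' D; destruct i as [->| ->], i' as [->| ->]; simpl; auto; lia. }
    assert (B : unsafe b k' v') by auto.
    assert (K : forall k, nx k j -> okn b b2 j v k) by (now apply HU).
    assert (K1 : forall w, nx j k' -> inner w -> ~ unsafe b k' w).
    { intros w Hk iw; apply (K k'); auto; now apply nx_sym. }
    split.
    - intros [[G _]|[_ G]]; [auto|]; now apply (K1 v').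
    - intros x u [[-> _]|[<- G]] a' H0 Nf.
      + destruct a' as [[G _]|[_ G]]; [auto|]; now apply (K1 v').
      + assert (Gn : nx x j) by (clear - G; unfold nx in *; lia).
        assert (Xj : x <> j) by (clear - G; unfold nx in *; lia).
        destruct a' as [[<- _]|[<- G']].
        * now apply (proj1 (K x Gn) v').
        * destruct (nx_case x j k' Gn G') as [->| ->]; [auto|].
          revert B; apply (proj1 (proj2 (K x Gn))); auto. }
  intros k v k' v' i i' U U' D.
  destruct (Z.eq_dec k j) as [->|Dk].
  { destruct (Sj v k' v' i i' U U' D) as [H1 H2]; split; auto; intros x u a a' H Nf; exfalso; eauto. }
  destruct (Z.eq_dec k' j) as [->|Dk'].
  { assert (D1 : j <> k \/ v' <> v) by auto.
    destruct (Sj v' k v i' i U' U D1) as [H1 H2]; split.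
    - intros G; now apply H1, adj_sym.
    - intros x u a a' H Nf; exfalso; eauto. }
  destruct (S k v k' v' i i' (V _ _ Dk U) (V _ _ Dk' U') D) as [Na C]; split; auto.
  intros x u a a' H Nf; destruct (classic (freshcol b x)) as [Fx|Nx].
  + assert (x = j) as -> by (apply NNPP; intros G; apply Nf; auto).
    destruct a as [[G _]|[<- G]]; [congruence|]; destruct a' as [[G' _]|[<- G']]; [congruence|].
    split; [auto|split; auto].
    assert (X : forall y, nx j y -> unsafe b2 y u).
    { intros y Hy; assert (y = k \/ y = k') as [->| ->]; auto; clear - G G' D Hy; unfold nx in *; lia. }
    split; apply AK, FA; auto; try apply X; unfold nx; clear; lia.
  + destruct (C x u a a' (ext0 _ _ _ _ E H) Nx) as (-> & -> & [T1 T2]).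
    split; [auto|split; auto]; split; now apply AK.
- intros k f Hk Nk Hn Ff; destruct (Fa f Ff) as [Ff' Df].
  destruct (Z.eq_dec k j) as [->|Dk]; [auto|].
  apply (form_keep b); auto.
  + intros v (_ & _ & _ & _ & H3) _; rewrite Cs; auto.
  + intros p Hp; right; destruct (Ac _ _ _ Hp); pose proof Hp as (_ & P0 & P1 & _ & _ & _ & P5 & _).
    rewrite !Cs; auto.
- intros k Fk Hz; destruct (Fa k Fk) as [Fk' Dk].
  assert (forall s, zeros b2 s <= 1 -> s <> j) as X by (intros s H ->; lia).
  pose proof Hz as (_ & _ & _ & _ & _ & _ & _ & Hs).
  pose proof (zeros_ge b2 (k - 1)); pose proof (zeros_ge b2 (k + 1)).
  apply (Z1 k Dk Fk'), (zz_same b b2); auto; intros v; apply Cs; apply X; lia.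
- intros k Hk Fl Fr Hc; destruct (Fa _ Fl), (Fa _ Fr).
  apply (Z2 k); auto; [unfold nx; clear - H0 H2; lia|].
  apply (crossy_same b b2); auto; intros v; apply Cs; intros ->.
  destruct Hc as (_ & _ & _ & _ & _ & _ & Hs); lia.
- intros k f v i Hk Hn Ff H0 H1 U; destruct (Fa f Ff) as [Ff' Df].
  assert (D0 : k <> 2 * k - f) by (clear - Hn; unfold nx in *; lia).
  destruct (Z.eq_dec k j) as [->|Dk].
  (* The cell behind is the unsafe cell of an A column facing [j]. That shape yields [slack]: two
     open neighbours away from [j], and by its last clause no fresh column beyond them. *)
  + assert (D1 : 2 * j - f <> j) by auto.
    assert (Hp : formA b (2 * j - f) j (mate v)).
    { apply FA; auto; clear - Hn; unfold nx in *; lia. }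
    left; destruct (Ac _ _ _ Hp) as [_ D2]; pose proof Hp as (_ & P0 & _ & _ & _ & _ & P5 & P6).
    rewrite op_op in * by auto.
    replace (2 * (2 * j - f) - j) with (3 * j - 2 * f) in * by (clear; lia).
    replace (3 * (2 * j - f) - 2 * j) with (4 * j - 3 * f) in P6 by (clear; lia).
    split; [right; left; rewrite !Cs; auto|].
    intros [_ (R & G0 & G1 & G2 & G3)]; destruct P6 as [P6|P6]; auto.
    apply P6, (ext0 b b2); auto; destruct i as [->| ->]; auto.
  + rewrite !Cs in H0, H1 by auto.
    destruct (Z.eq_dec (2 * k - f) j) as [Dj|Dj].
    * assert (f = 2 * k - j) as -> by (clear - Dj; lia).
      rewrite Dj in U; destruct (HU v i U) as (_ & _ & K).
      apply (K k); auto; clear - Hn; unfold nx in *; lia.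
    * destruct (A k f v i Hk Hn Ff' H0 H1 (V _ _ Dj U)) as [Sl|Mk]; [left|right; now apply (marked_keep b)].
      apply (slack_keep b); auto; apply Cs; auto.
      intros D3; pose proof (FA (2 * k - f) v i Dj) as Hp; rewrite <- D3 in Hp.
      assert (Hp' : nx (2 * k - f) (3 * k - 2 * f)) by (clear - Hn; unfold nx in *; lia).
      apply (formA_host b (2 * k - f) (3 * k - 2 * f) (mate v) k f); auto; clear; lia.
Qed.

Lemma okn_col b b2 j v k : IN b -> ext b b2 -> freshcol b j -> nx k j -> inner v -> b k v <> 0 -> okn b b2 j v k.
Proof.
intros N E Fj Hn i H; split; [|split].
- intros w iw U; destruct (fresh_uns b j k w N Fj Hn iw U) as (_ & P0 & P1 & _).
  apply H; destruct i as [->| ->], iw as [->| ->]; auto.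
- intros G; elim H; now apply (ext0 b b2).
- contradiction.
Qed.

Lemma okn_fresh b b2 j v k : inner v -> freshcol b k -> okn b b2 j v k.
Proof.
intros i F; split; [intros w _ U; now apply (proj1 (proj2 U))|split; [tauto|]].
intros _ _ G; elim G; destruct F as (_ & _ & F1 & F2 & _), i as [->| ->]; auto.
Qed.

Lemma okn_wall b b2 j v k : 1 < j < n -> nx k j -> ~ 1 < k < n -> okn b b2 j v k.
Proof.
intros Hj Hn D; assert (~ 1 < 2 * k - j < n) by (unfold nx in *; lia).
split; [intros w _ U; now apply D, U|split; [intros _ _ U; now apply H, U|intros U; now elim H; apply U]].
Qed.

Lemma open_nb b j v k : IN b -> freshcol b j -> nx k j -> inner v -> 1 < k < n -> b k v = 0 ->
  b k (mate v) <> 0 -> formH b k v \/ formU b k j v.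
Proof.
intros N Fj Hn i Hk H0 H1.
assert (Nf : ~ freshcol b k) by (intros (_ & _ & F1 & F2 & _); apply H1; destruct i as [->| ->]; auto).
destruct (N k j Hk Nf Hn Fj) as [[C1 C2]|[[t Ht]|[[t Ht]|[p Hp]]]].
- destruct i as [->| ->]; contradiction.
- left; assert (t = v) as <-; auto.
  destruct Ht as (it & V0 & V1 & _); destruct i as [->| ->], it as [->| ->]; simpl in *; congruence.
- right; assert (t = v) as <-; auto.
  destruct Ht as (it & V0 & V1 & _); destruct i as [->| ->], it as [->| ->]; simpl in *; congruence.
- destruct Hp as (ip & P0 & P1 & _); elim H1; destruct i as [->| ->], ip as [->| ->]; simpl in *; auto.
Qed.

(** If [(k, v)] is open, the inequality rules out H, and the stone that U has on the far side makes
    the cell behind neither open nor part of a fresh column. *)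
Lemma okn_U b b2 j v k : IN b -> ext b b2 -> freshcol b j -> nx k j -> inner v ->
  b k (mate v) <> 0 -> b k (pend v) <> b k (mate v) -> okn b b2 j v k.
Proof.
intros N E Fj Hn i H1 H2.
destruct (classic (1 < k < n)) as [Hk|Hk]; [|apply okn_wall; auto; apply Fj].
destruct (Z.eq_dec (b k v) 0) as [H0|H0]; [|now apply okn_col].
destruct (open_nb b j v k N Fj Hn i Hk H0 H1) as [(_ & _ & _ & G & _)|(_ & _ & _ & G & _)]; [contradiction|].
split; [|split].
- intros w iw U; destruct (fresh_uns b j k w N Fj Hn iw U) as (_ & P0 & P1 & _).
  apply H1; destruct i as [->| ->], iw as [->| ->]; auto.
- intros _ _ U; now apply G, U.
- intros (_ & _ & F1 & F2 & _); elim G; destruct i as [->| ->]; auto.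
Qed.

Lemma zeros_upd b k v c s : zeros b s - 1 <= zeros (upd b k v c) s.
Proof.
assert (O : forall x y, o x - 1 <= o y) by (intros x y; pose proof (o_spec x); pose proof (o_spec y); lia).
destruct (Z.eq_dec s k) as [->|D]; [|unfold zeros; rewrite !upd_ne by auto; lia].
pose proof (O (b k v) c); unfold zeros.
destruct v as [|[|[|[|v]]]]; rewrite ?upd_eq, !upd_ne by lia; lia.
Qed.

Lemma zeros_fr b s : freshcol b s -> zeros b s = 4.
Proof. intros (_ & H0 & H1 & H2 & H3); unfold zeros; rewrite H0, H1, H2, H3; reflexivity. Qed.

Lemma fr_cell b s : wf b -> freshcol b s -> forall v, b s v = 0.
Proof. intros (_ & O & _) (_ & H0 & H1 & H2 & H3) [|[|[|[|v]]]]; auto; apply O; lia. Qed.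

Lemma not_fr b s v : wf b -> b s v <> 0 -> ~ freshcol b s.
Proof. intros W H F; apply H; now apply fr_cell. Qed.

Lemma unsafe_one b b2 j t r : inner t -> nx j r -> ~ unsafe b2 j (mate t) ->
  two0 (b2 j (mate t)) (b2 j (pend t)) (b2 r t) (b2 (2 * j - r) t) ->
  okn b b2 j t r -> okn b b2 j t (2 * j - r) ->
  forall v, inner v -> unsafe b2 j v -> two0 (b2 j (mate v)) (b2 j (pend v)) (b2 (j - 1) v) (b2 (j + 1) v) /\
     ~ unsafe b2 j (mate v) /\ forall k, nx k j -> okn b b2 j v k.
Proof.
intros i Hn S T K1 K2 v iv U.
assert (v = t) as ->.
{ destruct (Nat.eq_dec v t) as [|D]; auto; elim S; replace (mate t) with v; auto.
  destruct i as [->| ->], iv as [->| ->]; simpl; congruence. }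
rewrite (nx_two0 b2 j r) by auto; split; [auto|split; [auto|]].
intros k Hk; destruct (nx_case j r k Hn (nx_sym _ _ Hk)) as [->| ->]; auto.
Qed.

Lemma safe_both b b2 j t : inner t -> ~ unsafe b2 j t -> ~ unsafe b2 j (mate t) ->
  forall v, inner v -> unsafe b2 j v -> two0 (b2 j (mate v)) (b2 j (pend v)) (b2 (j - 1) v) (b2 (j + 1) v) /\
     ~ unsafe b2 j (mate v) /\ forall k, nx k j -> okn b b2 j v k.
Proof.
intros i S1 S2 v iv U; exfalso.
destruct i as [->| ->], iv as [->| ->]; auto.
Qed.

Lemma pair_reply b j u c w c' : Inv b -> freshcol b j -> allowed b j u c -> allowed (upd b j u c) j w c' ->
  (forall f, nx j f -> freshcol b f -> form (upd (upd b j u c) j w c') j f) ->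
  (forall v, let b2 := upd (upd b j u c) j w c' in
     inner v -> unsafe b2 j v -> two0 (b2 j (mate v)) (b2 j (pend v)) (b2 (j - 1) v) (b2 (j + 1) v) /\
     ~ unsafe b2 j (mate v) /\ forall k, nx k j -> okn b b2 j v k) ->
  reply (upd b j u c).
Proof.
intros (W & L & S & N & Z1 & Z2 & A) Fj L1 L2 HF HU; exists j, w, c'; split; auto.
assert (W1 : wf (upd b j u c)) by (now apply wf_upd).
assert (W2 : wf (upd (upd b j u c) j w c')) by (now apply wf_upd).
assert (c0 : c' <> 0) by (destruct L2; lia).
apply (fresh_keep b _ j); auto.
- unfold Core; tauto.
- apply (ext_trans _ (upd b j u c)); apply ext_upd; [apply L1|apply L2].
- intros k v D; rewrite !upd_ne; auto.
- apply (not_fr _ _ w); auto; now rewrite upd_eq.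
- pose proof (zeros_fr b j Fj); pose proof (zeros_upd b j u c j); pose proof (zeros_upd (upd b j u c) j w c' j); lia.
Qed.

(** The two moves commute: Alice's answer is placed first, while column [j] is still fresh, and
    Bob's stone is then handled by [fresh_keep]. *)
Lemma side_reply b j u c s w c' : wf b -> freshcol b j -> s <> j -> allowed b j u c -> allowed (upd b j u c) s w c' ->
  Core (upd b s w c') ->
  (forall k, k <> j -> freshcol (upd b s w c') k -> ~ crossing_gap (upd b s w c') (k - 1) (k + 1)) ->
  (forall k, ~ nx k j -> 1 < k < n -> freshcol (upd b s w c') (k - 1) -> freshcol (upd b s w c') (k + 1) ->
     ~ crossed (upd b s w c') k) ->
  (forall f, nx j f -> ~ freshcol (upd b s w c') f) ->
  (forall v, let b2 := upd (upd b j u c) s w c' in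
     inner v -> unsafe b2 j v -> two0 (b2 j (mate v)) (b2 j (pend v)) (b2 (j - 1) v) (b2 (j + 1) v) /\
     ~ unsafe b2 j (mate v) /\ forall k, nx k j -> okn (upd b s w c') b2 j v k) ->
  reply (upd b j u c).
Proof.
intros W Fj Ds L1 L2 C Z1 Z2 NF HU; exists s, w, c'; split; auto.
assert (W1 : wf (upd b j u c)) by (now apply wf_upd).
assert (W2 : wf (upd (upd b j u c) s w c')) by (now apply wf_upd).
assert (c0 : c <> 0) by (destruct L1; lia).
assert (Fj' : freshcol (upd b s w c') j) by (destruct Fj as (F & F0 & F1 & F2 & F3); unfold freshcol; rewrite !upd_ne by auto; auto).
assert (Cs : forall k v, k <> j -> upd (upd b j u c) s w c' k v = upd b s w c' k v).
{ intros k v D; unfold upd; destruct (Z.eq_dec k s), (Nat.eq_dec v w), (Z.eq_dec k j); auto; contradiction. }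
apply (fresh_keep (upd b s w c') _ j); auto.
- intros k v H; destruct (Z.eq_dec k j) as [->|D]; auto.
  elim H; apply fr_cell; auto; apply C.
- apply (not_fr _ _ u); auto; rewrite upd_ne by auto; now rewrite upd_eq.
- pose proof (zeros_fr b j Fj); pose proof (zeros_upd b j u c j); pose proof (zeros_upd (upd b j u c) s w c' j); lia.
- intros f Hn Ff; now elim (NF f).
Qed.

Lemma bob_inner b j v z : Inv b -> freshcol b j -> inner v -> allowed b j v z -> reply (upd b j v z).
Proof.
intros I Fj i Lg; pose proof I as (W & _).
assert (W1 : wf (upd b j v z)) by (now apply wf_upd).
assert (z0 : z <> 0) by (destruct Lg; lia).
assert (Do : mate v <> v) by (now apply op_ne).
assert (Ho : upd b j v z j (mate v) = 0) by (rewrite upd_ne by auto; now apply fr_cell).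
destruct (legal_free (upd b j v z) j (mate v) W1 (op_inn v i)) as [c Lc]; auto; [destruct Fj; lia| |].
{ right; left; rewrite upd_ne; [now apply fr_cell|destruct i as [->| ->]; simpl; lia]. }
assert (c0 : c <> 0) by (destruct Lc; lia).
assert (C1 : upd (upd b j v z) j (mate v) c j v <> 0) by (rewrite upd_ne, upd_eq by auto; auto).
assert (C2 : upd (upd b j v z) j (mate v) c j (mate v) <> 0) by (rewrite upd_eq; auto).
apply (pair_reply b j v z (mate v) c); auto.
- intros f _ _; left; destruct i as [->| ->]; split; auto.
- apply (safe_both b _ j v); auto; intros (_ & _ & G & _); auto.
Qed.

(** * Bob in an outer cell of a fresh column *)

Lemma pend_legal b j v z r c : wf b -> freshcol b j -> inner v -> nx j r -> allowed b j (pend v) z -> 1 <= c <= 4 ->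
  (c <> b r (mate v) -> c <> b (2 * j - r) (mate v) -> allowed (upd b j (pend v) z) j (mate v) c) /\
  (c <> z -> c <> b r v -> c <> b (2 * j - r) v -> allowed (upd b j (pend v) z) j v c) /\
  (c <> b r (pend (mate v)) -> c <> b (2 * j - r) (pend (mate v)) -> allowed (upd b j (pend v) z) j (pend (mate v)) c).
Proof.
intros W Fj i Hn Lg Hc.
assert (W1 : wf (upd b j (pend v) z)) by (now apply wf_upd).
assert (Fc : forall t, b j t = 0) by (now apply fr_cell).
assert (Hj : 1 <= j <= n) by (destruct Fj; lia).
assert (X : forall y, c <> b r y -> c <> b (2 * j - r) y -> c <> b (j - 1) y /\ c <> b (j + 1) y).
{ intros y; destruct Hn as [->| ->];
  [replace (2 * j - (j - 1)) with (j + 1) by lia | replace (2 * j - (j + 1)) with (j - 1) by lia]; auto. }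
clear Hn; split; [|split].
- intros H1 H2; destruct (X _ H1 H2) as [H3 H4].
  apply legal_inner; auto using op_inn; rewrite ?upd_ne by (try lia; destruct i as [->| ->]; simpl; lia); rewrite ?Fc; auto; lia.
- intros H0 H1 H2; destruct (X _ H1 H2) as [H3 H4].
  apply legal_inner; auto; rewrite ?upd_eq; rewrite ?upd_ne by (try lia; destruct i as [->| ->]; simpl; lia); rewrite ?Fc; auto; lia.
- intros H1 H2; destruct (X _ H1 H2) as [H3 H4].
  apply legal_pend; auto using op_inn; rewrite ?upd_ne by (try lia; destruct i as [->| ->]; simpl; lia); rewrite ?Fc; auto; lia.
Qed.

Lemma pend_op b j v z c r : freshcol b j -> inner v -> nx j r ->
  let b2 := upd (upd b j (pend v) z) j (mate v) c in
  b2 j v = 0 /\ b2 j (mate v) = c /\ b2 j (pend v) = z /\ b2 j (pend (mate v)) = 0 /\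
  (forall t, b2 r t = b r t) /\ (forall t, b2 (2 * j - r) t = b (2 * j - r) t).
Proof.
intros (_ & F0 & F1 & F2 & F3) i Hn b2; unfold b2.
split; [|split; [|split; [|split; [|split; intros t; rewrite !upd_ne by (unfold nx in *; lia); auto]]]];
destruct i as [->| ->]; simpl; repeat first [rewrite upd_eq | rewrite upd_ne by lia]; auto.
Qed.

Lemma pend_in b j v z c r : freshcol b j -> inner v -> nx j r ->
  let b2 := upd (upd b j (pend v) z) j v c in
  b2 j v = c /\ b2 j (mate v) = 0 /\ b2 j (pend v) = z /\ b2 j (pend (mate v)) = 0 /\
  (forall t, b2 r t = b r t) /\ (forall t, b2 (2 * j - r) t = b (2 * j - r) t).
Proof.
intros (_ & F0 & F1 & F2 & F3) i Hn b2; unfold b2.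
split; [|split; [|split; [|split; [|split; intros t; rewrite !upd_ne by (unfold nx in *; lia); auto]]]];
destruct i as [->| ->]; simpl; repeat first [rewrite upd_eq | rewrite upd_ne by lia]; auto.
Qed.

Lemma pend_pd b j v z c r : freshcol b j -> inner v -> nx j r ->
  let b2 := upd (upd b j (pend v) z) j (pend (mate v)) c in
  b2 j v = 0 /\ b2 j (mate v) = 0 /\ b2 j (pend v) = z /\ b2 j (pend (mate v)) = c /\
  (forall t, b2 r t = b r t) /\ (forall t, b2 (2 * j - r) t = b (2 * j - r) t).
Proof.
intros (_ & F0 & F1 & F2 & F3) i Hn b2; unfold b2.
split; [|split; [|split; [|split; [|split; intros t; rewrite !upd_ne by (unfold nx in *; lia); auto]]]];
destruct i as [->| ->]; simpl; repeat first [rewrite upd_eq | rewrite upd_ne by lia]; auto.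
Qed.

Lemma pend_side b j v z s w c r : freshcol b j -> inner v -> nx j r -> nx j s ->
  let b2 := upd (upd b j (pend v) z) s w c in
  b2 j v = 0 /\ b2 j (mate v) = 0 /\ b2 j (pend v) = z /\ b2 j (pend (mate v)) = 0 /\
  (forall t, b2 r t = upd b s w c r t) /\ (forall t, b2 (2 * j - r) t = upd b s w c (2 * j - r) t).
Proof.
intros (_ & F0 & F1 & F2 & F3) i Hn Hs b2; unfold b2; assert (s <> j) by (unfold nx in *; lia).
assert (Cs : forall k v, k <> j -> upd (upd b j (pend v) z) s w c k v = upd b s w c k v).
{ intros k t D; unfold upd; destruct (Z.eq_dec k s), (Nat.eq_dec t w), (Z.eq_dec k j); auto; contradiction. }
split; [|split; [|split; [|split; [|split; intros t]]]].
5,6: unfold upd; destruct (Z.eq_dec r s), (Z.eq_dec r j), (Z.eq_dec (2 * j - r) s), (Z.eq_dec (2 * j - r) j); auto; unfold nx in *; lia.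
all: destruct i as [->| ->]; simpl; repeat first [rewrite upd_eq | rewrite upd_ne by lia]; auto.
Qed.

Lemma rep_safe b2 j r t : nx j r ->
  rep4 (b2 j (mate t)) (b2 j (pend t)) (b2 r t) (b2 (2 * j - r) t) -> ~ unsafe b2 j t.
Proof. intros Hn H (_ & _ & _ & U); now apply U, (nx_rp b2 j r). Qed.

Lemma col_safe b2 j t : b2 j t <> 0 -> ~ unsafe b2 j t.
Proof. intros H (_ & _ & U & _); auto. Qed.

(** The default answer is Bob's own colour in [(j, mate v)], so that [(j, v)] lies between two equal
    stones. The other answers serve when a neighbouring column forbids this one. *)
Lemma pend_H b j v z r : Inv b -> freshcol b j -> inner v -> nx j r -> allowed b j (pend v) z ->
  b r (mate v) <> z -> b (2 * j - r) (mate v) <> z -> reply (upd b j (pend v) z).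
Proof.
intros I Fj i Hn Lg H1 H2; pose proof I as (W & _).
assert (Hz : 1 <= z <= 4) by apply Lg.
destruct (pend_legal b j v z r z W Fj i Hn Lg Hz) as (L1 & _).
destruct (pend_op b j v z z r Fj i Hn) as (V0 & V1 & V2 & V3 & Vr & Vl).
apply (pair_reply b j (pend v) z (mate v) z); auto.
- intros f _ _; right; left; exists v; unfold formH; rewrite V1, V2; repeat split; auto; lia.
- apply (safe_both b _ j v i).
  + apply (rep_safe _ j r); auto; rewrite V1, V2; unfold rep4; left; split; auto; lia.
  + apply col_safe; rewrite V1; lia.
Qed.

Lemma pend_two b j v z r c : Inv b -> freshcol b j -> inner v -> nx j r -> allowed b j (pend v) z ->
  ~ freshcol b r -> ~ freshcol b (2 * j - r) -> 1 <= c <= 4 -> c <> b r (mate v) -> c <> b (2 * j - r) (mate v) ->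
  rep4 c z (b r v) (b (2 * j - r) v) -> reply (upd b j (pend v) z).
Proof.
intros I Fj i Hn Lg Nr Nl Hc H1 H2 R; pose proof I as (W & _).
assert (Hz : 1 <= z <= 4) by apply Lg.
destruct (pend_legal b j v z r c W Fj i Hn Lg Hc) as (L1 & _).
destruct (pend_op b j v z c r Fj i Hn) as (V0 & V1 & V2 & V3 & Vr & Vl).
apply (pair_reply b j (pend v) z (mate v) c); auto.
- intros f Hf Ff; destruct (nx_case j r f Hn Hf) as [->| ->]; contradiction.
- apply (safe_both b _ j v i).
  + apply (rep_safe _ j r); auto; now rewrite V1, V2, Vr, Vl.
  + apply col_safe; rewrite V1; lia.
Qed.

Lemma pend_three b j v z r c : Inv b -> freshcol b j -> inner v -> nx j r -> allowed b j (pend v) z ->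
  ~ freshcol b r -> ~ freshcol b (2 * j - r) -> 1 <= c <= 4 -> c <> z -> c <> b r v -> c <> b (2 * j - r) v ->
  rep4 c 0 (b r (mate v)) (b (2 * j - r) (mate v)) -> reply (upd b j (pend v) z).
Proof.
intros I Fj i Hn Lg Nr Nl Hc H0 H1 H2 R; pose proof I as (W & _).
destruct (pend_legal b j v z r c W Fj i Hn Lg Hc) as (_ & L1 & _).
destruct (pend_in b j v z c r Fj i Hn) as (V0 & V1 & V2 & V3 & Vr & Vl).
apply (pair_reply b j (pend v) z v c); auto.
- intros f Hf Ff; destruct (nx_case j r f Hn Hf) as [->| ->]; contradiction.
- apply (safe_both b _ j v i).
  + apply col_safe; rewrite V0; lia.
  + apply (rep_safe _ j r); auto; rewrite op_op by auto; now rewrite V0, V3, Vr, Vl.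
Qed.

Lemma legal_cols b j v z r : allowed b j (pend v) z -> nx j r -> b r (pend v) <> z /\ b (2 * j - r) (pend v) <> z.
Proof.
intros Lg Hn; split; apply not_eq_sym, (legalN b j (pend v) z _ (pend v) Lg), adj_nx; unfold nx in *; lia.
Qed.

(** Facing a fresh column, [j] must acquire a shape. A colour in [(r, v)] is copied to [(j, mate v)]
    and gives U; if that cell is open, [z] goes to the other end and gives A. *)
Lemma pend_freshside b j v z r : Inv b -> freshcol b j -> inner v -> nx j r -> allowed b j (pend v) z ->
  b r (mate v) = z -> freshcol b (2 * j - r) -> reply (upd b j (pend v) z).
Proof.
intros I Fj i Hn Lg Hr Fl; pose proof I as (W & L & S & N & _).
assert (Hz : 1 <= z <= 4) by apply Lg.
assert (Fc : forall t, b (2 * j - r) t = 0) by (now apply fr_cell).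
assert (Nr : ~ freshcol b r) by (apply (not_fr b r (mate v)); auto; lia).
destruct (legal_cols b j v z r Lg Hn) as [T1 T2].
destruct (Z.eq_dec (b r v) 0) as [H0|H0].
- destruct (pend_legal b j v z r z W Fj i Hn Lg Hz) as (_ & _ & L3).
  destruct (pend_pd b j v z z r Fj i Hn) as (V0 & V1 & V2 & V3 & Vr & Vl).
  assert (Lz : allowed (upd b j (pend v) z) j (pend (mate v)) z).
  { apply L3; [|rewrite Fc; lia]; rewrite <- Hr; apply (proj2 (proj2 W)); [|lia].
    apply adj_sym, adj_pd, op_inn; auto. }
  assert (OK : okn b (upd (upd b j (pend v) z) j (pend (mate v)) z) j v r).
  { apply okn_U; auto; try lia; [|now apply nx_sym].
    apply (ext_trans _ (upd b j (pend v) z)); apply ext_upd; [apply Lg|apply Lz]. }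
  apply (pair_reply b j (pend v) z (pend (mate v)) z); auto.
  + intros f Hf Ff; destruct (nx_case j r f Hn Hf) as [->| ->]; [contradiction|].
    right; right; right; exists (mate v); unfold formA; rewrite op_op by auto.
    replace (2 * j - (2 * j - r)) with r by lia; replace (3 * j - 2 * (2 * j - r)) with (2 * r - j) by lia.
    (* Column [r] is half filled, and not of shape H because its end next to Bob's stone differs
       from [z]; shape U supplies the stone that [formA] asks for. *)
    assert (Lst : upd (upd b j (pend v) z) j (pend (mate v)) z (2 * r - j) v <> 0 \/ ~ 1 < 2 * r - j < n).
    { rewrite !upd_ne by (left; clear - Hn; unfold nx in *; lia).
      destruct (classic (1 < r < n)) as [Rn|Rn]; [left|right; destruct Fj; clear - Hn Rn H; unfold nx in *; lia].
      destruct (open_nb b j v r N Fj (nx_sym _ _ Hn) i Rn H0) as [(_ & _ & _ & G & _)|(_ & _ & _ & G & _)]; auto; [lia|congruence]. }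
    assert (P03 : upd (upd b j (pend v) z) j (pend (mate v)) z j 0%nat = z /\ upd (upd b j (pend v) z) j (pend (mate v)) z j 3%nat = z).
    { clear - V2 V3 i; destruct i as [->| ->]; auto. }
    destruct P03 as [P0 P3]; rewrite V0, V1, P0, P3, !Vr; repeat split; auto using op_inn; lia.
  + apply (unsafe_one b _ j v r i Hn).
    * apply (rep_safe _ j r); auto; rewrite op_op by auto; rewrite V0, V3, Vr; unfold rep4; lia.
    * rewrite V1, Vl, Fc; unfold two0; lia.
    * auto.
    * now apply okn_fresh.
- assert (Hy : 1 <= b r v <= 4 /\ b r v <> z).
  { pose proof (proj1 W r v); split; [lia|]; rewrite <- Hr; apply (proj2 (proj2 W)); auto.
    apply adj_sym, adj_op; auto. }
  destruct (pend_legal b j v z r (b r v) W Fj i Hn Lg) as (L1 & _); [lia|].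
  destruct (pend_op b j v z (b r v) r Fj i Hn) as (V0 & V1 & V2 & V3 & Vr & Vl).
  apply (pair_reply b j (pend v) z (mate v) (b r v)); auto.
  { apply L1; [lia|rewrite Fc; lia]. }
  + intros f Hf Ff; destruct (nx_case j r f Hn Hf) as [->| ->]; [contradiction|].
    right; right; left; exists v; unfold formU; replace (2 * j - (2 * j - r)) with r by lia.
    rewrite V0, V1, Vr; repeat split; auto.
  + apply (safe_both b _ j v i).
    * apply (rep_safe _ j r); auto; rewrite V1, Vr; unfold rep4; lia.
    * apply col_safe; rewrite V1; lia.
Qed.

Lemma pend_pair b j v z r : Inv b -> freshcol b j -> inner v -> nx j r -> allowed b j (pend v) z ->
  b r (mate v) = z -> ~ freshcol b (2 * j - r) -> b (2 * j - r) v = 0 -> b (2 * j - r) (pend (mate v)) <> z ->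
  (let b2 := upd (upd b j (pend v) z) j (pend (mate v)) z in
   okn b b2 j v r /\ (b2 j (pend v) = z -> b2 j (pend (mate v)) = z -> okn b b2 j v (2 * j - r))) ->
  reply (upd b j (pend v) z).
Proof.
intros I Fj i Hn Lg Hr Nl Hl0 Hl OK; pose proof I as (W & _).
assert (Hz : 1 <= z <= 4) by apply Lg.
assert (Nr : ~ freshcol b r) by (apply (not_fr b r (mate v)); auto; lia).
destruct (pend_legal b j v z r z W Fj i Hn Lg Hz) as (_ & _ & L3).
destruct (pend_pd b j v z z r Fj i Hn) as (V0 & V1 & V2 & V3 & Vr & Vl).
destruct OK as [OKr OKl].
apply (pair_reply b j (pend v) z (pend (mate v)) z); auto.
- apply L3; auto; rewrite <- Hr; apply (proj2 (proj2 W)); [|lia].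
  apply adj_sym, adj_pd, op_inn; auto.
- intros f Hf Ff; destruct (nx_case j r f Hn Hf) as [->| ->]; contradiction.
- apply (unsafe_one b _ j v r i Hn); auto.
  + apply (rep_safe _ j r); auto; rewrite op_op by auto; rewrite V0, V3, Vr; unfold rep4; lia.
  + rewrite V1, Vl, Hl0; unfold two0; lia.
Qed.

Lemma side_legal b j v z l w : wf b -> freshcol b j -> inner w -> nx j l -> allowed b j (pend v) z -> inner v ->
  b l w = 0 -> b l (pend w) <> z -> b l (mate w) <> z -> b (2 * l - j) w <> z ->
  allowed b l w z /\ allowed (upd b j (pend v) z) l w z.
Proof.
intros W Fj iw Hn Lg i H0 H1 H2 H3.
assert (Hz : 1 <= z <= 4) by apply Lg.
assert (Hl : 1 <= l <= n) by (destruct Fj; unfold nx in *; lia).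
assert (Fc : forall t, b j t = 0) by (now apply fr_cell).
assert (X : forall b', b' j w <> z -> b' (2 * l - j) w <> z -> z <> b' (l - 1) w /\ z <> b' (l + 1) w).
{ intros b'; destruct Hn as [->| ->];
  [replace (2 * (j - 1) - j) with (j - 1 - 1) by lia; replace (j - 1 + 1) with j by lia
  |replace (2 * (j + 1) - j) with (j + 1 + 1) by lia; replace (j + 1 - 1) with j by lia]; auto. }
assert (Y : upd b j (pend v) z j w = 0).
{ rewrite upd_ne; auto; right; destruct i as [->| ->], iw as [->| ->]; simpl; lia. }
assert (Dl : l <> j /\ 2 * l - j <> j) by (unfold nx in *; lia).
split.
- destruct (X b) as [X1 X2]; auto; [rewrite Fc; lia|]; apply legal_inner; auto.
- destruct (X (upd b j (pend v) z)) as [X1 X2]; [lia|rewrite upd_ne by tauto; auto|].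
  apply legal_inner; auto; rewrite ?(upd_ne _ _ _ _ l) by tauto; auto.
Qed.

Lemma wall_cell b k f t : wf b -> nx k f -> 1 < f < n -> ~ 1 < k < n -> b (2 * k - f) t = 0.
Proof. intros (_ & O & _) H1 H2 H3; apply O; unfold nx in *; lia. Qed.

(** Alice answers next door: [z] in [(l, v)] and Bob's [z] in [(j, pend v)] are both neighbours of
    [(j, v)], which becomes safe. *)
Lemma pend_fill b j v z r : Inv b -> freshcol b j -> inner v -> nx j r -> allowed b j (pend v) z ->
  let l := 2 * j - r in
  b r (mate v) = z -> b l v = 0 -> b l (mate v) <> z -> (1 < l < n -> b l (mate v) <> 0) ->
  b (2 * l - j) v <> z -> (freshcol b (2 * l - j) -> ~ crossing_gap (upd b l v z) l (2 * (2 * l - j) - l)) ->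
  reply (upd b j (pend v) z).
Proof.
intros I Fj i Hn Lg l Hr H0 Ho Hc Hll HZ; pose proof I as (W & L & S & N & Z1 & Z2 & A).
assert (Hz : 1 <= z <= 4) by apply Lg.
assert (Hl : nx j l) by (unfold l, nx in *; lia).
destruct (legal_cols b j v z r Lg Hn) as [T1 T2]; fold l in T2.
destruct (side_legal b j v z l v W Fj i Hl Lg i H0 T2 Ho Hll) as [L0 L1].
destruct (pend_side b j v z l v z r Fj i Hn Hl) as (V0 & V1 & V2 & V3 & Vr & Vl); fold l in Vl.
assert (Dl : l <> j /\ r <> l /\ 2 * l - j <> l) by (unfold l, nx in *; lia).
assert (Nl : ~ freshcol b l).
{ intros F; apply (Hc (proj1 F)); now apply fr_cell. }
assert (W' : wf (upd b l v z)) by (now apply wf_upd).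
assert (E : ext b (upd b l v z)) by (now apply ext_upd).
assert (Cv : upd b l v z l v = z) by apply upd_eq.
assert (Co : upd b l v z l (mate v) = b l (mate v)) by (apply upd_ne; right; now apply op_ne).
assert (Cs : forall k t, k <> l -> upd b l v z k t = b k t) by (intros; apply upd_ne; auto).
assert (FC : 1 < l < n -> formC (upd b l v z) l).
{ intros Rl; apply Hc in Rl; rewrite <- Co in Rl; destruct i as [->| ->]; split; simpl in *; lia. }
assert (Fj' : freshcol (upd b l v z) j).
{ destruct Fj as (F & F0 & F1 & F2 & F3); unfold freshcol; rewrite !Cs by lia; auto. }
assert (CC : Core (upd b l v z)).
{ apply (fill_core b _ l v l v); auto.
  - intros k t G _; apply upd_ne; lia.
  - left; split; exists j; (split; [now apply nx_sym|auto]).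
  - intros q t it U Ha.
    assert (Ha' : adj l v q t) by tauto; clear Ha.
    destruct Ha' as [[<- Ht]|[<- Hq]].
    + exfalso; destruct U as (Rl & _ & U & _); apply FC in Rl; destruct Rl as [C1 C2].
      destruct it as [->| ->]; auto.
    + destruct (nx_case l j q (nx_sym _ _ Hl) Hq) as [->| ->]; [exfalso; now apply (proj1 (proj2 U))|].
      assert (Rl : 1 < l < n).
      { apply (nx_mid j l); [now apply nx_sym|apply Fj|apply U]. }
      assert (Ub : unsafe b (2 * l - j) v).
      { apply (uns_anti b (upd b l v z)); auto; intros G; apply (proj1 (proj2 U)).
        destruct G as (G & G0 & G1 & G2 & G3); unfold freshcol; rewrite !Cs by tauto; auto. }
      destruct (A l j v i Rl (nx_sym _ _ Hl) Fj H0 (Hc Rl) Ub) as [Sl|(M1 & M2 & M3)].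
      * exists l, j; split; [now apply nx_sym|]; repeat split; auto; try apply Sl; apply Cs; unfold l, nx in *; lia.
      (* Seen from [l], the column across [j] is [r], so the marked colour is [z], the one just
         played, and the cell behind becomes safe. *)
      * exfalso; apply (proj2 (proj2 (proj2 U))); rewrite (nx_rp _ _ l) by (now apply nx_sym).
        rewrite Cv, (Cs (2 * l - j) (pend v)), M2 by tauto.
        replace (2 * j - l) with r by (unfold l; lia); rewrite Hr; unfold rep4; lia. }
apply (side_reply b j (pend v) z l v z); auto.
- tauto.
- intros k Dk Fk Hz1; apply (fr_anti b) in Fk; auto.
  destruct (classic (nx l k)) as [Hk|Hk].
  + destruct (nx_case l j k (nx_sym _ _ Hl) Hk) as [->| ->]; [tauto|].
    apply (HZ Fk); apply (nx_zz _ _ l (nx_sym _ _ Hk)); auto.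
  + apply (Z1 k Fk), (zz_same b (upd b l v z)); auto; intros t; apply Cs; intros G; apply Hk; clear - G; unfold nx; lia.
- intros k Dk Hk Fl Fr Hc'; apply (fr_anti b) in Fl; auto; apply (fr_anti b) in Fr; auto.
  apply (Z2 k Hk Fl Fr), (crossy_same b (upd b l v z)); auto; intros t; apply Cs; intros ->.
  now apply Dk, nx_sym.
- intros f Hf Ff; apply (fr_anti b) in Ff; auto.
  destruct (nx_case j r f Hn Hf) as [->| ->]; [|now apply Nl].
  apply (not_fr b r (mate v)) in Ff; auto; lia.
- assert (E2 : ext (upd b l v z) (upd (upd b j (pend v) z) l v z)).
  { intros k t H; destruct (Z.eq_dec k j) as [->|D]; [elim H; now apply fr_cell|].
    unfold upd; destruct (Z.eq_dec k l), (Nat.eq_dec t v), (Z.eq_dec k j); auto; contradiction. }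
  apply (unsafe_one _ _ j (mate v) r); auto using op_inn; rewrite ?op_op by auto.
  + apply (rep_safe _ j r); auto; fold l; rewrite V1, V2, Vl, Cv; unfold rep4; lia.
  + rewrite V0, V3; unfold two0; lia.
  + apply okn_col; auto using op_inn; [apply CC|now apply nx_sym|]; rewrite Cs by tauto; lia.
  + destruct (classic (1 < l < n)) as [Rl|Rl].
    * apply okn_col; auto using op_inn; [apply CC|now apply nx_sym|]; fold l; rewrite Co; auto.
    * apply okn_wall; auto; [apply Fj|now apply nx_sym].
Qed.

Lemma okn_A b b' b2 j l p : formA b l j p -> nx l j -> ext b b' -> b' l (mate p) <> 0 -> okn b' b2 j p l.
Proof.
intros Hp Hn E Hq; pose proof (formA_rp1 b l j p Hn Hp) as R.
destruct Hp as (i & P0 & P1 & P2 & P3 & P4 & _).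
assert (X : b' (2 * l - j) p <> 0) by (rewrite E; congruence).
split; [|split].
- intros w iw (_ & _ & U & Nr).
  assert (w = p \/ w = mate p) as [->| ->] by (destruct i as [->| ->], iw as [->| ->]; simpl; auto); [|contradiction].
  now apply Nr, (rp_mono b).
- intros _ _ (_ & _ & U & _); contradiction.
- intros (_ & _ & F1 & F2 & _); elim X; destruct i as [->| ->]; auto.
Qed.

(** Colouring the unsafe cell of the A column [l] with [z] serves twice: next to it, [(j, mate p)]
    sees [z] again, at Bob's stone or at [(r, mate v)], and is safe too. *)
Lemma pend_A b j v z r p : Inv b -> freshcol b j -> inner v -> nx j r -> allowed b j (pend v) z ->
  let l := 2 * j - r in b r (mate v) = z -> 1 < l < n -> ~ freshcol b l -> formA b l j p ->
  reply (upd b j (pend v) z).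
Proof.
intros I Fj i Hn Lg l Hr Rl Nl Hp; pose proof I as (W & L & S & N & Z1 & Z2 & A).
assert (Hz : 1 <= z <= 4) by apply Lg.
assert (Hl : nx j l) by (unfold l, nx in *; lia).
destruct (legal_cols b j v z r Lg Hn) as [T1 T2]; fold l in T2.
pose proof Hp as (ip & P0 & P1 & P2 & P3 & P4 & P5 & P6).
destruct (formA_rp b l j p (nx_sym _ _ Hl) Fj Hp) as [Rp Rq].
assert (T3 : b l (pend (mate p)) <> z).
{ destruct i as [->| ->], ip as [->| ->]; simpl in *; congruence. }
assert (U : unsafe b l (mate p)) by (split; [auto|split; [auto|split; auto]]).
destruct (side_legal b j v z l (mate p) W Fj (op_inn p ip) Hl Lg i P1 T3) as [L0 L1]; rewrite ?op_op; auto; try lia.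
set (b' := upd b l (mate p) z).
assert (I' : Inv b').
{ apply color_unsafe; auto using op_inn; split; [auto|split; [|split; [|split; [|split; [auto|split; [auto|]]]]]].
  - intros k t it Ut _; now apply L.
  - intros k t k' t' it it' Ut Ut' D; destruct (S k t k' t' it it' Ut Ut' D); auto.
  - intros k f Hk Nk Hf Ff; left; auto.
  - intros k f t it Hk Hf Ff H0 H1 Ut _; now apply A. }
assert (E : ext b b') by (now apply ext_upd).
destruct (pend_side b j v z l (mate p) z r Fj i Hn Hl) as (V0 & V1 & V2 & V3 & Vr & Vl); fold l b' in Vl, Vr.
assert (Dl : l <> j /\ r <> l /\ 2 * l - j <> l) by (unfold l, nx in *; lia).
assert (Cs : forall k t, k <> l -> b' k t = b k t) by (intros; apply upd_ne; auto).
assert (Cq : b' l (mate p) = z) by apply upd_eq.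
assert (Cp : b' l p = 0) by (unfold b'; rewrite upd_ne; auto; right; apply not_eq_sym, op_ne; auto).
assert (Fj' : freshcol b' j).
{ destruct Fj as (F & F0 & F1 & F2 & F3); unfold freshcol; rewrite !Cs by lia; auto. }
assert (E2 : ext b' (upd (upd b j (pend v) z) l (mate p) z)).
{ intros k t H; destruct (Z.eq_dec k j) as [->|D]; [elim H; apply fr_cell; auto; apply I'|].
  unfold b', upd; destruct (Z.eq_dec k l), (Nat.eq_dec t (mate p)), (Z.eq_dec k j); auto; contradiction. }
destruct I' as (W' & L' & S' & N' & Z1' & Z2' & A').
apply (side_reply b j (pend v) z l (mate p) z); auto; fold b'.
- tauto.
- unfold Core; tauto.
- intros f Hf Ff; apply (fr_anti b) in Ff; auto.
  destruct (nx_case j r f Hn Hf) as [->| ->]; [|now apply Nl].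
  apply (not_fr b r (mate v)) in Ff; auto; lia.
- assert (Or : b' r (mate v) = z /\ b' r (pend v) <> z) by (rewrite !Cs by tauto; auto).
  destruct Or as [Or1 Or2].
  assert (OA : okn b' (upd (upd b j (pend v) z) l (mate p) z) j p l) by (apply (okn_A b); auto; [now apply nx_sym|lia]).
  apply (unsafe_one _ _ j p r ip Hn).
  + assert (p = mate v \/ p = v) as [->| ->] by (destruct i as [->| ->], ip as [->| ->]; simpl; auto).
    * rewrite op_op in * by auto; apply (rep_safe _ j r); auto; fold l; rewrite V1, V2, Vl, Cq; unfold rep4; lia.
    * apply (rep_safe _ j r); auto; fold l; rewrite op_op by auto; rewrite V0, V3, Vl, Vr, Cq, Or1; unfold rep4; lia.
  + assert (X : upd (upd b j (pend v) z) l (mate p) z j (mate p) = 0).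
    { destruct i as [->| ->], ip as [->| ->]; auto. }
    fold l; rewrite X, Vl, Cp; unfold two0; lia.
  + assert (p = mate v \/ p = v) as [->| ->] by (destruct i as [->| ->], ip as [->| ->]; simpl; auto).
    * apply okn_col; auto using op_inn; [now apply nx_sym|lia].
    * apply okn_U; auto; try lia; now apply nx_sym.
  + exact OA.
Qed.

Lemma Inv_X b qk qv : Inv b -> InvX b qk qv.
Proof.
intros (W & L & S & N & Z1 & Z2 & A); split; [auto|split; [|split; [|split; [|split; [auto|split; [auto|]]]]]].
- intros k t it Ut _; now apply L.
- intros k t k' t' it it' Ut Ut' D; destruct (S k t k' t' it it' Ut Ut' D); auto.
- intros k f Hk Nk Hf Ff; left; auto.
- intros k f t it Hk Hf Ff H0 H1 Ut _; now apply A.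
Qed.

(** The neighbours forbid both [z] and the colour of [(r, v)] in [(j, mate v)]. Filling [(l, v)]
    with [z] works unless [z] lies just behind it or a crossing would result. Then [z] goes to the
    other end of [j] and [(j, v)] stays unsafe; the crossing case is the origin of [marked]. *)
Lemma pend_F2 b j v z r : Inv b -> freshcol b j -> inner v -> nx j r -> allowed b j (pend v) z ->
  let l := 2 * j - r in b r (mate v) = z -> b r v <> 0 -> b l (mate v) = b r v -> b l v = 0 ->
  reply (upd b j (pend v) z).
Proof.
intros I Fj i Hn Lg l Hr Hy Ho H0; pose proof I as (W & L & S & N & Z1 & Z2 & A).
assert (Hz : 1 <= z <= 4) by apply Lg.
assert (Hl : nx j l) by (unfold l, nx in *; lia).
assert (Hyz : b r v <> z).
{ rewrite <- Hr; apply (proj2 (proj2 W)); auto; apply adj_sym, adj_op; auto. }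
destruct (legal_cols b j v z r Lg Hn) as [T1 T2]; fold l in T2.
destruct (classic (b (2 * l - j) v = z \/ freshcol b (2 * l - j) /\ crossing_gap (upd b l v z) l (2 * (2 * l - j) - l))) as [D|D].
2: { apply (pend_fill b j v z r); auto; fold l; try lia. }
assert (Rl : 1 < l < n).
{ apply NNPP; intros Rl; destruct D as [D|[(D & _) _]].
  - rewrite (wall_cell b l j v W (nx_sym _ _ Hl)) in D; auto; [lia|apply Fj].
  - destruct Fj as [Rj _]; clear - D Rj Rl Hl; unfold nx in *; lia. }
assert (Ho0 : b l (mate v) <> 0) by (rewrite Ho; auto).
assert (HH : formH b l v).
{ destruct (open_nb b j v l N Fj (nx_sym _ _ Hl) i Rl H0 Ho0) as [|(_ & _ & _ & G0 & G)]; auto; exfalso.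
  destruct D as [D|[D _]]; [rewrite D in G; destruct G as [G|G]; congruence|now apply G0, fr_cell]. }
pose proof HH as (_ & _ & _ & Ht & Hd).
assert (Nl : ~ freshcol b l) by (now apply (not_fr b l (mate v))).
apply (pend_pair b j v z r); auto; fold l; [lia|].
set (b2 := upd (upd b j (pend v) z) j (pend (mate v)) z).
assert (E : ext b b2).
{ apply (ext_trans _ (upd b j (pend v) z)); apply ext_upd; [apply Lg|].
  rewrite upd_ne; [now apply fr_cell|right; destruct i as [->| ->]; discriminate]. }
split.
- apply okn_col; auto; now apply nx_sym.
- intros Ev Eo; split; [|split].
  + intros w iw U; destruct (fresh_uns b j l w N Fj (nx_sym _ _ Hl) iw U) as (_ & G0 & G1 & _).
    apply Ho0; destruct i as [->| ->], iw as [->| ->]; auto.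
  + intros _ _ (_ & Nf & U & _); destruct D as [D|[D _]]; [lia|auto].
  + intros Fll _ _; right.
    destruct D as [D|[_ D]]; [exfalso; rewrite fr_cell in D; auto; lia|].
    assert (Dl : 2 * (2 * l - j) - l <> l /\ 2 * (2 * l - j) - l <> j) by (unfold nx in *; lia).
    unfold marked; replace (2 * l - (2 * l - j)) with j by lia.
    (* Even with [z] in [(l, v)], the H column [l] keeps its open end, so the column opposite is
       full, and the crossing pattern puts [z] in its row [mate v]. *)
    assert (X : b (2 * (2 * l - j) - l) (mate v) = z).
    { destruct D as (x & y & xy & x0 & y0 & (C1 & C2 & C3 & C4) & C' & Hs).
      assert (Zl : 1 <= zeros (upd b l v z) l).
      { assert (upd b l v z l (pend (mate v)) = 0) as G by (rewrite upd_ne; auto; right; destruct i as [->| ->]; discriminate).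
        unfold zeros; pose proof (o_spec (upd b l v z l 0%nat)) as O0; pose proof (o_spec (upd b l v z l 1%nat)) as O1.
        pose proof (o_spec (upd b l v z l 2%nat)) as O2; pose proof (o_spec (upd b l v z l 3%nat)) as O3.
        clear - i G O0 O1 O2 O3; destruct i as [->| ->]; simpl in G; lia. }
      assert (Zf : zeros (upd b l v z) (2 * (2 * l - j) - l) = 0).
      { pose proof (zeros_ge (upd b l v z) (2 * (2 * l - j) - l)) as G; clear - Zl Hs G; lia. }
      pose proof (zeros_none _ _ Zf) as G; destruct C' as (D1 & D2 & D3 & D4).
      assert (Q1 : upd b l v z l v = z) by apply upd_eq.
      assert (Q2 : upd b l v z (2 * (2 * l - j) - l) (mate v) = b (2 * (2 * l - j) - l) (mate v)) by (clear - Dl; apply upd_ne; tauto).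
      assert (G1 := G 1%nat ltac:(clear; lia)); assert (G2 := G 2%nat ltac:(clear; lia)).
      rewrite <- Q2; clear - i Q1 G1 G2 C1 C2 C3 C4 D1 D2 D3 D4 Hz.
      generalize dependent (upd b l v z); intros b0; intros; destruct i as [->| ->]; simpl in *; lia. }
    rewrite E by lia; rewrite X, Ev, Eo; lia.
Qed.

(** The main device is to copy the colour of a side neighbour into the other inner row of [j], where
    it repeats around the remaining inner cell. The special answers cover the cases where [l] is
    fresh, no such colour exists, or the copy is forbidden. *)
Lemma pend_one b j v z r : Inv b -> freshcol b j -> inner v -> nx j r -> allowed b j (pend v) z ->
  b r (mate v) = z -> b (2 * j - r) (mate v) <> z -> reply (upd b j (pend v) z).
Proof.
intros I Fj i Hn Lg Hr Ho; pose proof I as (W & L & S & N & Z1 & Z2 & A).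
assert (Hz : 1 <= z <= 4) by apply Lg.
destruct (classic (freshcol b (2 * j - r))) as [Fl|Nl]; [now apply (pend_freshside b j v z r)|].
assert (Nr : ~ freshcol b r) by (apply (not_fr b r (mate v)); auto; lia).
assert (Cl : 0 <= b (2 * j - r) v <= 4 /\ 0 <= b r v <= 4 /\ 0 <= b (2 * j - r) (mate v) <= 4) by (repeat split; apply W).
assert (Ac : forall k, b k v <> 0 -> b k v <> b k (mate v)).
{ intros k; apply (proj2 (proj2 W)), adj_sym, adj_op; auto. }
pose proof (Ac r) as Ar; pose proof (Ac (2 * j - r)) as Al.
destruct (Z.eq_dec (b (2 * j - r) v) 0) as [L0|L0].
2: { destruct (Z.eq_dec (b (2 * j - r) v) z) as [Lz|Lz].
  - destruct (pick3 z (b (2 * j - r) (mate v)) z) as (c & C1 & C2 & C3 & _).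
    apply (pend_two b j v z r c); auto; try congruence; rewrite Lz; unfold rep4; lia.
  - apply (pend_two b j v z r (b (2 * j - r) v)); auto; try lia; unfold rep4; lia. }
destruct (Z.eq_dec (b r v) 0) as [R0|R0].
- destruct (Z.eq_dec (b (2 * j - r) (mate v)) 0) as [O0|O0].
  + assert (Hl : nx (2 * j - r) j) by (unfold nx in *; lia).
    destruct (classic (1 < 2 * j - r < n)) as [Rl|Rl].
    * destruct (N (2 * j - r) j Rl Nl Hl Fj) as [[C1 C2]|[[t Ht]|[[t Ht]|[p Hp]]]].
      -- exfalso; destruct i as [->| ->]; auto.
      -- exfalso; destruct Ht as ([->| ->] & ? & ? & _), i as [->| ->]; simpl in *; auto.
      -- exfalso; destruct Ht as ([->| ->] & ? & ? & _), i as [->| ->]; simpl in *; auto.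
      -- now apply (pend_A b j v z r p).
    * assert (Wc : b (2 * (2 * j - r) - j) v = 0) by (apply wall_cell; auto; apply Fj).
      destruct (Z.eq_dec (b (2 * j - r) (pend (mate v))) z) as [Dz|Dz].
      -- apply (pend_fill b j v z r); auto; try lia; intros (? & _); destruct Fj; unfold nx in *; lia.
      -- apply (pend_pair b j v z r); auto; split.
         ++ apply okn_U; auto; try lia; [|now apply nx_sym|rewrite Hr; apply (legal_cols b j v z r Lg Hn)].
            apply (ext_trans _ (upd b j (pend v) z)); apply ext_upd; [apply Lg|].
            rewrite upd_ne; [now apply fr_cell|right; destruct i as [->| ->]; discriminate].
         ++ intros _ _; apply okn_wall; auto; apply Fj.
  + apply (pend_three b j v z r (b (2 * j - r) (mate v))); auto; try lia; unfold rep4; lia.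
- destruct (Z.eq_dec (b (2 * j - r) (mate v)) (b r v)) as [E|E].
  + now apply (pend_F2 b j v z r).
  + apply (pend_two b j v z r (b r v)); auto; try lia; unfold rep4; lia.
Qed.

Lemma bob_fresh b j u c : Inv b -> allowed b j u c -> freshcol b j -> reply (upd b j u c).
Proof.
intros I Lg Fj.
assert (X : inner u \/ exists v, inner v /\ u = pend v).
{ destruct Lg as (_ & Hu & _); unfold inner; destruct u as [|[|[|[|u]]]]; auto; try lia; right; [exists 1%nat|exists 2%nat]; auto. }
destruct X as [i|(v & i & ->)]; [now apply bob_inner|].
assert (H1 : nx j (j + 1)) by now right.
assert (H2 : nx j (j - 1)) by now left.
assert (E1 : 2 * j - (j + 1) = j - 1) by lia; assert (E2 : 2 * j - (j - 1) = j + 1) by lia.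
pose proof (pend_H b j v c (j + 1) I Fj i H1 Lg) as P0.
pose proof (pend_one b j v c (j + 1) I Fj i H1 Lg) as P1.
pose proof (pend_one b j v c (j - 1) I Fj i H2 Lg) as P2.
rewrite E1 in *; rewrite E2 in *.
destruct (Z.eq_dec (b (j + 1) (mate v)) c) as [D1|D1], (Z.eq_dec (b (j - 1) (mate v)) c) as [D2|D2]; auto.
pose proof I as (W & _); assert (Hc : 1 <= c <= 4) by apply Lg.
(* Both side neighbours of [(j, mate v)] carry [c], so that cell is safe and any legal colour in
   [(j, v)] will do. *)
destruct (pick3 c (b (j + 1) v) (b (j - 1) v)) as (c' & C1 & C2 & C3 & C4).
apply (pend_three b j v c (j + 1) c'); auto; rewrite ?E1; auto.
- apply (not_fr b _ (mate v)); auto; lia.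
- apply (not_fr b _ (mate v)); auto; lia.
- rewrite D1, D2; unfold rep4; lia.
Qed.

Lemma bob_reply b j u c : Inv b -> allowed b j u c -> Inv (upd b j u c) \/ reply (upd b j u c).
Proof.
intros I Lg; destruct (classic (freshcol b j)); [right; now apply bob_fresh|now apply bob_nonfresh].
Qed.

(** * Alice's free moves *)

Lemma legal_side b l h u : wf b -> 1 <= l <= n -> (u <= 3)%nat -> b l u = 0 -> nx l h -> b h u = 0 ->
  exists c, allowed b l u c.
Proof.
intros W Hl Hu H0 Hn Hh.
destruct (pick3 (b l (S u)) (b l (pred u)) (b (2 * l - h) u)) as (c & C1 & C2 & C3 & C4).
exists c; split; [auto|split; [auto|split; [auto|split; [auto|]]]].
intros k' v' [[<- [->| ->]]|[<- H]]; auto.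
destruct (nx_case l h k' Hn H) as [->| ->]; [lia|auto].
Qed.

(* The two colours of a crossing can be read off the untouched column, so that a
   third colour in [(l, u)] avoids every crossing. *)
Lemma noncross_color b l u g : wf b -> 1 <= l <= n -> (u <= 3)%nat -> b l u = 0 -> nx l g -> freshcol b g ->
  exists c, allowed b l u c /\ ~ crossing_gap (upd b l u c) l (2 * g - l).
Proof.
intros W Hl Hu H0 Hn Fg.
destruct (legal_side b l g u W Hl Hu H0 Hn (fr_cell b g W Fg u)) as (c & Lc).
destruct (classic (crossing_gap (upd b l u c) l (2 * g - l))) as [Hz|Hz]; [|now exists c].
destruct Hz as (x & y & xy & x0 & y0 & C & C' & Hs).
assert (E : ext b (upd b l u c)) by (now apply ext_upd).
apply (cr_ext b _ _ _ _ E) in C.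
destruct (fill_color b l g u x y W Hl Hu H0 Hn (fr_cell b g W Fg u) (cr_cells b l x y W C)) as (c' & Lc' & cx & cy).
exists c'; split; auto; intros (x' & y' & xy' & x0' & y0' & D & D' & _).
assert (Dr : 2 * g - l <> l) by (unfold nx in *; lia).
assert (Zr : zeros (upd b l u c) (2 * g - l) <= 1).
{ pose proof (zeros_ge (upd b l u c) l); lia. }
rewrite (zeros_same b) in Zr by (intros; apply upd_ne; auto).
apply (cr_same b) in C'; [|intros; apply upd_ne; auto]; apply (cr_same b) in D'; [|intros; apply upd_ne; auto].
assert (Cc : c' = x' \/ c' = y').
{ assert (G : upd b l u c' l u = c') by apply upd_eq; assert (c' <> 0) by (destruct Lc'; lia).
  destruct D as (D1 & D2 & D3 & D4); clear - G D1 D2 D3 D4 H Hu; destruct u as [|[|[|[|u]]]]; lia. }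
clear - C' D' Zr Cc cx cy.
unfold zeros in Zr; pose proof (o_spec (b (2 * g - l) 0%nat)) as O0; pose proof (o_spec (b (2 * g - l) 1%nat)) as O1.
pose proof (o_spec (b (2 * g - l) 2%nat)) as O2; pose proof (o_spec (b (2 * g - l) 3%nat)) as O3.
assert (N : (b (2 * g - l) 0%nat <> 0 \/ b (2 * g - l) 2%nat <> 0) /\ (b (2 * g - l) 1%nat <> 0 \/ b (2 * g - l) 3%nat <> 0)).
{ clear - Zr O0 O1 O2 O3; lia. }
destruct C' as (A1 & A2 & A3 & A4), D' as (B1 & B2 & B3 & B4), N as [N1 N2].
assert (y = y') by (clear - N1 A1 A2 B1 B2; lia).
assert (x = x') by (clear - N2 A3 A4 B3 B4; lia).
clear - H H0 Cc cx cy; lia.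
Qed.

(** Only [g] can be a fresh neighbour, so there is a single gap to watch, and [noncross_color]
    protects it. *)
Lemma fill_one b l g u : Inv b -> (forall k v, inner v -> ~ unsafe b k v) -> 1 <= l <= n -> (u <= 3)%nat -> b l u = 0 ->
  ~ freshcol b l -> (1 < l < n -> forall c, c <> 0 -> formC (upd b l u c) l) ->
  nx l g -> (forall f, nx l f -> freshcol b f -> f = g) -> (~ freshcol b g -> exists h, nx l h /\ b h u = 0) -> reply b.
Proof.
intros I NU Hl Hu H0 Nl HC Hn HF Hh; pose proof I as (W & L & S & N & Z1 & Z2 & A).
assert (X : exists c, allowed b l u c /\ (freshcol b g -> ~ crossing_gap (upd b l u c) l (2 * g - l))).
{ destruct (classic (freshcol b g)) as [Fg|Ng].
  - destruct (noncross_color b l u g W Hl Hu H0 Hn Fg) as (c & ? & ?); exists c; auto.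
  - destruct (Hh Ng) as (h & Hnh & Hh0).
    destruct (legal_side b l h u W Hl Hu H0 Hnh Hh0) as (c & Lc); exists c; split; tauto. }
destruct X as (c & Lc & NZ); exists l, u, c; split; auto.
assert (E : ext b (upd b l u c)) by (now apply ext_upd).
assert (c0 : c <> 0) by (destruct Lc; lia).
assert (Cs : forall k v, k <> l -> upd b l u c k v = b k v) by (intros; apply upd_ne; auto).
apply (fill_keep b _ l u l u); auto.
- now apply wf_upd.
- intros k v D _; apply upd_ne; lia.
- intros k Fk Hz; apply (fr_anti b) in Fk; auto.
  destruct (classic (nx l k)) as [Hk|Hk].
  + assert (k = g) as -> by auto; apply (NZ Fk); apply (nx_zz _ g l); auto; now apply nx_sym.
  + apply (Z1 k Fk), (zz_same b (upd b l u c)); auto; intros t; apply Cs; intros G; apply Hk; clear - G; unfold nx; lia.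
- intros k Hk Fl Fr Hc; apply (fr_anti b) in Fl; auto; apply (fr_anti b) in Fr; auto.
  destruct (Z.eq_dec k l) as [->|D].
  + assert (l - 1 = g) by (apply HF; auto; now left); assert (l + 1 = g) by (apply HF; auto; now right); lia.
  + apply (Z2 k Hk Fl Fr), (crossy_same b (upd b l u c)); auto.
- intros q v i U _; exfalso; apply (NU q v i), (uns_anti b (upd b l u c)); auto.
  intros G; destruct (Z.eq_dec q l) as [->|D]; [auto|].
  apply (proj1 (proj2 U)); destruct G as (G & G0 & G1 & G2 & G3); unfold freshcol; rewrite !Cs by auto; auto.
Qed.

Lemma leftmost b k : freshcol b k -> exists m, freshcol b m /\ forall x, x < m -> ~ freshcol b x.
Proof.
intros Fk; assert (H : exists i : nat, k <= Z.of_nat i) by (exists (Z.to_nat k); destruct Fk; lia).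
destruct H as [i Hi]; revert k Fk Hi; induction i as [|i IH]; intros k Fk Hi; [destruct Fk; lia|].
destruct (classic (exists x, x < k /\ freshcol b x)) as [(x & Hx & Fx)|F]; [apply (IH x Fx); lia|].
exists k; split; auto; intros x Hx Fx; apply F; now exists x.
Qed.

Lemma gap_move b k v c : Inv b -> freshcol b k -> (v <= 3)%nat -> allowed b k v c ->
  (forall f, nx k f -> freshcol b f -> form (upd b k v c) k f) ->
  (forall t, let b2 := upd b k v c in
     inner t -> unsafe b2 k t -> two0 (b2 k (mate t)) (b2 k (pend t)) (b2 (k - 1) t) (b2 (k + 1) t) /\
     ~ unsafe b2 k (mate t) /\ forall x, nx x k -> okn b b2 k t x) -> reply b.
Proof.
intros (W & L & S & N & Z1 & Z2 & A) Fk Hv Lc HF HU; exists k, v, c; split; auto.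
assert (c0 : c <> 0) by (destruct Lc; lia).
assert (W2 : wf (upd b k v c)) by (now apply wf_upd).
apply (fresh_keep b _ k); auto.
- unfold Core; tauto.
- apply ext_upd, Lc.
- intros x t D; apply upd_ne; auto.
- apply (not_fr _ _ v); auto; now rewrite upd_eq.
- pose proof (zeros_fr b k Fk); pose proof (zeros_upd b k v c k); lia.
Qed.

(** Copying a left inner colour into the other inner row makes the remaining inner cell safe. If the
    right column forbids this in both rows, its inner colours are those of the left, swapped; an
    inner colour played on an end then makes the adjacent inner cell safe. *)
Lemma gap_reply b k : Inv b -> freshcol b k -> (forall v, (v <= 3)%nat -> b (k - 1) v <> 0) -> reply b.
Proof.
intros I Fk Hl; pose proof I as (W & L & S & N & Z1 & Z2 & A).
assert (Fc : forall t, b k t = 0) by (now apply fr_cell).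
assert (Rk : 1 <= k <= n) by (destruct Fk; lia).
assert (Nl : ~ freshcol b (k - 1)) by (apply (not_fr b _ 1%nat); auto).
assert (Cl : forall t, 0 <= b (k - 1) t <= 4 /\ 0 <= b (k + 1) t <= 4) by (split; apply W).
assert (Ad : forall x t, b x t <> 0 -> b x t <> b x (Datatypes.S t)).
{ intros x t; apply (proj2 (proj2 W)); left; auto. }
assert (IN1 : forall v, inner v -> b (k + 1) v <> b (k - 1) (mate v) ->
   (forall f, nx k f -> freshcol b f -> f = k + 1 /\ v = 1%nat) -> reply b).
{ intros v i D HF; set (y := b (k - 1) (mate v)) in *.
  assert (y0 : 1 <= y <= 4).
  { pose proof (Hl (mate v)); pose proof (proj1 (Cl (mate v))); unfold y; destruct i as [->| ->]; simpl in *; lia. }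
  assert (V0 : upd b k v y k v = y) by apply upd_eq.
  assert (Vo : upd b k v y k (mate v) = 0) by (rewrite upd_ne; auto; right; now apply op_ne).
  assert (Vl : forall t, upd b k v y (k - 1) t = b (k - 1) t) by (intros; apply upd_ne; lia).
  apply (gap_move b k v y); auto.
  - destruct i as [->| ->]; lia.
  - apply legal_inner; auto; rewrite ?Fc; try lia.
    pose proof (Ad (k - 1) 1%nat (Hl 1%nat ltac:(lia))); unfold y; destruct i as [->| ->]; simpl; lia.
  - intros f Hf Ff; destruct (HF f Hf Ff) as [-> ->]; right; right; left; exists 2%nat; unfold formU.
    replace (2 * k - (k + 1)) with (k - 1) by lia; rewrite Vl; change (mate 2) with 1%nat; change (mate 1) with 2%nat in *.
    rewrite V0, Vo; unfold y in *; repeat split; auto; unfold inner; auto; lia.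
  - apply (safe_both b _ k v i).
    + apply col_safe; lia.
    + apply (rep_safe _ k (k - 1)); [now left|]; rewrite op_op by auto; rewrite V0, Vl; unfold rep4; lia. }
destruct (classic (freshcol b (k + 1))) as [Fr|Nr].
{ apply (IN1 1%nat); [now left| |].
  - rewrite (fr_cell b _ W Fr); apply not_eq_sym, Hl; simpl; lia.
  - intros f [->| ->] Ff; [contradiction|auto]. }
assert (NF : forall f, nx k f -> freshcol b f -> False) by (intros f [->| ->]; auto).
destruct (classic (exists v, inner v /\ b (k + 1) v <> b (k - 1) (mate v))) as [(v & i & D)|ND].
{ apply (IN1 v); auto; intros f Hf Ff; destruct (NF f Hf Ff). }
assert (E : forall v, inner v -> b (k + 1) v = b (k - 1) (mate v)).
{ intros v i; apply NNPP; intros D; apply ND; now exists v. }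
assert (E1 := E 1%nat (or_introl eq_refl)); assert (E2 := E 2%nat (or_intror eq_refl)); cbn [mate] in E1, E2.
assert (R1 : b (k + 1) 1%nat <> 0) by (rewrite E1; apply Hl; lia).
assert (R2 : b (k + 1) 2%nat <> 0) by (rewrite E2; apply Hl; lia).
assert (X : forall v c, inner v -> c = b (k - 1) 1%nat \/ c = b (k - 1) 2%nat ->
   c <> b (k - 1) (pend v) -> c <> b (k + 1) (pend v) -> reply b).
{ intros v c i Hc C1 C2.
  assert (Hc4 : 1 <= c <= 4).
  { pose proof (Hl 1%nat ltac:(lia)); pose proof (Hl 2%nat ltac:(lia)).
    pose proof (proj1 (Cl 1%nat)); pose proof (proj1 (Cl 2%nat)); lia. }
  assert (Vp : upd b k (pend v) c k (pend v) = c) by apply upd_eq.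
  assert (Vq : forall t, t <> pend v -> upd b k (pend v) c k t = 0) by (intros; rewrite upd_ne; auto).
  assert (Vs : forall s t, s <> k -> upd b k (pend v) c s t = b s t) by (intros; apply upd_ne; auto).
  assert (Lc : allowed b k (pend v) c) by (apply legal_pend; auto; rewrite ?Fc; lia).
  assert (Ex : ext b (upd b k (pend v) c)) by (apply ext_upd, Lc).
  apply (gap_move b k (pend v) c); auto.
  - destruct i as [->| ->]; simpl; lia.
  - intros f Hf Ff; destruct (NF f Hf Ff).
  - apply (unsafe_one b _ k (mate v) (k - 1)); auto using op_inn; [now left| | | |].
    + rewrite op_op by auto; apply (rep_safe _ k (k - 1)); [now left|].
      replace (2 * k - (k - 1)) with (k + 1) by lia; rewrite Vp, (Vs (k - 1)), (Vs (k + 1)), E by (auto; lia).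
      assert (Hop : c = b (k - 1) v \/ c = b (k - 1) (mate v)) by (destruct i as [->| ->]; [exact Hc|destruct Hc; auto]).
      clear - Hop Hc4; unfold rep4; lia.
    + rewrite op_op by auto; rewrite !Vq by (destruct i as [->| ->]; discriminate); unfold two0; lia.
    + apply okn_col; auto using op_inn; [right; lia|apply Hl; destruct i as [->| ->]; simpl; lia].
    + replace (2 * k - (k - 1)) with (k + 1) by lia.
      apply okn_col; auto using op_inn; [left; lia|destruct i as [->| ->]; simpl; auto]. }
pose proof (X 1%nat (b (k - 1) 1%nat) (or_introl eq_refl) (or_introl eq_refl)) as X1.
pose proof (X 1%nat (b (k - 1) 2%nat) (or_introl eq_refl) (or_intror eq_refl)) as X2.
pose proof (X 2%nat (b (k - 1) 1%nat) (or_intror eq_refl) (or_introl eq_refl)) as X3.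
pose proof (X 2%nat (b (k - 1) 2%nat) (or_intror eq_refl) (or_intror eq_refl)) as X4.
cbn [pend] in X1, X2, X3, X4.
(* If each of the two inner colours is forbidden on both ends, the outer cells of the neighbours are
   determined and the two columns form a full crossing, against [IZ1]. *)
apply NNPP; intros NR.
assert (P1 := fun p q => NR (X1 p q)); assert (P2 := fun p q => NR (X2 p q)).
assert (P3 := fun p q => NR (X3 p q)); assert (P4 := fun p q => NR (X4 p q)).
pose proof (Ad (k - 1) 0%nat (Hl 0%nat ltac:(lia))) as A0; pose proof (Ad (k - 1) 1%nat (Hl 1%nat ltac:(lia))) as A1.
pose proof (Ad (k - 1) 2%nat (Hl 2%nat ltac:(lia))) as A2.
pose proof (Hl 1%nat ltac:(lia)) as H1; pose proof (Hl 2%nat ltac:(lia)) as H2.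
apply (Z1 k Fk); exists (b (k - 1) 2%nat), (b (k - 1) 1%nat).
assert (Q0 : b (k - 1) 0%nat = b (k - 1) 2%nat /\ b (k + 1) 0%nat = b (k - 1) 1%nat) by (clear - P1 P2 A0 A1; lia).
assert (Q3 : b (k - 1) 3%nat = b (k - 1) 1%nat /\ b (k + 1) 3%nat = b (k - 1) 2%nat) by (clear - P3 P4 A1 A2; lia).
destruct Q0 as [Q0 Q0'], Q3 as [Q3 Q3'].
unfold crossing, zeros; rewrite Q0, Q3, Q0', Q3', E1, E2.
pose proof (o_spec (b (k - 1) 1%nat)); pose proof (o_spec (b (k - 1) 2%nat)).
repeat split; auto; lia.
Qed.

Lemma form_nouns b k f : (forall k v, inner v -> ~ unsafe b k v) -> 1 < k < n -> ~ freshcol b k -> nx k f -> freshcol b f ->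
  form b k f -> formC b k \/ exists v, inner v /\ b k v = 0 /\ b k (mate v) <> 0.
Proof.
intros NU Hk Nk Hn Ff [C|[[v Hv]|[[v Hv]|[p Hp]]]]; auto.
- right; exists v; split; apply Hv || (split; apply Hv).
- right; exists v; split; apply Hv || (split; apply Hv).
- exfalso; apply (NU k (mate p)); [apply op_inn, Hp|].
  split; [auto|split; [auto|split; [apply Hp|apply (formA_rp b k f p); auto]]].
Qed.

(** An open inner cell is filled in preference to [u], so that the move always leaves shape C. *)
Lemma column_reply b l g u : Inv b -> (forall k v, inner v -> ~ unsafe b k v) -> 1 < l < n -> (u <= 3)%nat -> b l u = 0 ->
  ~ freshcol b l -> nx l g -> freshcol b g -> ~ freshcol b (2 * l - g) -> reply b.
Proof.
intros I NU Hl Hu H0 Nl Hn Fg Ng; pose proof I as (W & L & S & N & _).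
assert (HF : forall f, nx l f -> freshcol b f -> f = g).
{ intros f Hf Ff; destruct (nx_case l g f Hn Hf) as [->| ->]; tauto. }
destruct (form_nouns b l g NU Hl Nl Hn Fg (N l g Hl Nl Hn Fg)) as [[C1 C2]|(v & i & V0 & V1)].
- apply (fill_one b l g u); auto; try tauto; try lia.
  intros _ c c0; split; rewrite upd_ne; auto; right; intros <-; auto.
- apply (fill_one b l g v); auto; try tauto; try lia.
  + destruct i as [->| ->]; lia.
  + intros _ c c0; assert (G : upd b l v c l v = c) by apply upd_eq.
    assert (G' : upd b l v c l (mate v) = b l (mate v)) by (apply upd_ne; right; now apply op_ne).
    destruct i as [->| ->]; split; simpl in *; congruence.
Qed.

Lemma free_reply b k v : Inv b -> (forall k v, inner v -> ~ unsafe b k v) -> (forall k, ~ freshcol b k) -> 1 < k < n ->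
  (v <= 3)%nat -> b k v = 0 -> reply b.
Proof.
intros I NU NF Hk Hv H0; pose proof I as (W & _).
assert (X : exists c, allowed b k v c).
{ assert (Y : inner v \/ exists t, inner t /\ v = pend t).
  { unfold inner; destruct v as [|[|[|[|v]]]]; auto; try lia; right; [exists 1%nat|exists 2%nat]; auto. }
  destruct Y as [i|(t & i & ->)].
  - apply legal_free; auto; [lia|]; right; right; right; right; apply NNPP; intros R.
    apply (NU k v i); split; auto.
  - destruct (pick3 (b k t) (b (k - 1) (pend t)) (b (k + 1) (pend t))) as (c & C1 & C2 & C3 & C4).
    exists c; apply legal_pend; auto; lia. }
destruct X as (c & Lc); exists k, v, c; split; auto.
assert (E : ext b (upd b k v c)) by (now apply ext_upd).
assert (NF' : forall x, ~ freshcol (upd b k v c) x) by (intros x F; apply (NF x); now apply (fr_anti b (upd b k v c))).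
assert (NU' : forall x t, inner t -> ~ unsafe (upd b k v c) x t).
{ intros x t i U; apply (NU x t i); now apply (uns_anti b (upd b k v c)). }
split; [now apply wf_upd|split; [|split; [|split; [|split; [|split]]]]].
- intros x t i U; now elim (NU' x t).
- intros x t x' t' i _ U; now elim (NU' x t).
- intros x f _ _ _ F; now elim (NF' f).
- intros x F; now elim (NF' x).
- intros x _ F; now elim (NF' (x - 1)).
- intros x f t i _ _ F; now elim (NF' f).
Qed.

Lemma alice_reply b k v : Inv b -> 1 <= k <= n -> (v <= 3)%nat -> b k v = 0 -> reply b.
Proof.
intros I Hk Hv H0; pose proof I as (W & L & S & N & Z1 & Z2 & A).
destruct (classic (exists x t, inner t /\ unsafe b x t)) as [(x & t & i & U)|NU'].
{ destruct (legal_free b x t W i) as [c Lc]; [destruct U; lia|apply U| |].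
  - pose proof (L x t i U) as T; clear - T; unfold two0 in T; tauto.
  - exists x, t, c; split; auto; apply color_unsafe; auto; now apply Inv_X. }
assert (NU : forall x t, inner t -> ~ unsafe b x t) by (intros x t i U; apply NU'; now exists x, t).
destruct (classic (exists l u, 1 <= l <= n /\ ~ 1 < l < n /\ (u <= 3)%nat /\ b l u = 0)) as [(l & u & Hl & Hw & Hu & Hu0)|NW].
(* In a border column the neighbour outside of the grid counts as open, which guarantees a legal
   colour. *)
{ assert (G : exists g, nx l g /\ ~ 1 <= 2 * l - g <= n).
  { destruct (Z.eq_dec l 1); [exists (l + 1)|exists (l - 1)]; unfold nx; lia. }
  destruct G as (g & Hg & Og).
  apply (fill_one b l g u); auto.
  - intros (R & _); auto.
  - tauto.
  - intros f Hf (Rf & _); destruct (nx_case l g f Hg Hf) as [->| ->]; auto; lia.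
  - intros _; exists (2 * l - g); split; [now apply ot_nx|apply W; lia]. }
destruct (classic (exists x, freshcol b x)) as [[x Fx]|NF].
2: { apply (free_reply b k v); auto; [intros x F; apply NF; now exists x|].
  apply NNPP; intros Rk; apply NW; now exists k, v. }
(* Being left of the first fresh column, column [m - 1] borders no fresh column other than [m]. *)
destruct (leftmost b x Fx) as (m & Fm & Nm).
destruct (classic (exists u, (u <= 3)%nat /\ b (m - 1) u = 0)) as [(u & Hu & Hu0)|Full].
- assert (Rm : 1 < m - 1 < n).
  { apply NNPP; intros Rm; apply NW; exists (m - 1), u; destruct Fm; lia. }
  apply (column_reply b (m - 1) m u); auto; [apply Nm; lia|right; lia|apply Nm; lia].
- apply (gap_reply b m); auto; intros u Hu Hu0; apply Full; now exists u.
Qed.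

Lemma Inv_empty : Inv (fun _ _ => 0).
Proof.
assert (F : forall k, 1 < k < n -> freshcol (fun _ _ => 0) k) by (intros k Hk; repeat split; tauto || reflexivity).
assert (Z4 : forall s, zeros (fun _ _ => 0) s = 4) by reflexivity.
split; [split; [intros; lia|split; [auto|intros; contradiction]]|].
split; [intros k v _ (Hk & Nk & _); now elim Nk; apply F|].
split; [intros k v k' v' _ _ (Hk & Nk & _); now elim Nk; apply F|].
split; [intros k f Hk Nk; now elim Nk; apply F|].
split; [intros k _ (x & y & _ & _ & _ & _ & _ & H); rewrite !Z4 in H; lia|].
split; [intros k _ _ _ (x & y & _ & _ & _ & _ & H); rewrite Z4 in H; lia|].
intros k f v _ Hk _ _ _ _ (Hk' & Nk & _); now elim Nk; apply F.
Qed.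
End Alice.
End Grid.

Require Import Defs.
From mathcomp Require Import all_boot zify.
From mathcomp Require boolp.

Set Implicit Arguments.
Unset Strict Implicit.
Unset Printing Implicit Defensive.

(** * The strategy of Alice *)

Section AliceWins.
Variable n : nat.
Notation grid := (box_graph (path_graph 4) (path_graph n)).
Notation zn := (Z.of_nat n).

Definition colz (k : nat) (c : option 'I_k) : Z := if c is Some i then Z.of_nat i.+1 else 0%Z.
Definition colx (x : nat) : Z := Z.of_nat x.+1.
(** Only the cells of the grid are compared; the zeros around them come from [wf]. Columns and
    colours are shifted by one, since 0 means uncoloured. *)
Definition reads (c : coloring grid 4) (b : board) :=
  forall (a : 'I_4) (x : 'I_n), b (colx x) a = colz (c (a, x)).

Lemma colz_inj k : injective (@colz k).
Proof.
move=> [i|] [j|] //=; rewrite /colz => H; try lia.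
by congr Some; apply: val_inj => /=; lia.
Qed.

Lemma edge_adj (a a' : 'I_4) (x x' : 'I_n) :
  @edge grid (a, x) (a', x') -> adj (colx x) a (colx x') a'.
Proof.
rewrite /= /box_edge /= /path_edge /adj /nx /colx.
case/orP=> /andP[/eqP -> /orP[/eqP E|/eqP E]]; [right|right|left|left]; lia.
Qed.

Lemma adj_edge (a : 'I_4) (x : 'I_n) k v : (1 <= k <= zn)%Z -> (v < 4)%nat -> adj (colx x) a k v ->
  exists2 u : 'I_4 * 'I_n, @edge grid (a, x) u & k = colx u.2 /\ v = u.1.
Proof.
move=> Hk Hv Ha; have Hx : (Z.to_nat (k - 1) < n)%nat by apply/ltP; lia.
exists (Ordinal Hv, Ordinal Hx); last by rewrite /colx /=; lia.
have E : k = colx (Z.to_nat (k - 1)) by rewrite /colx; lia.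
rewrite /= /box_edge /= /path_edge /=.
case: Ha => [[H1 H2]|[H1 H2]]; rewrite E in H1 H2; rewrite /nx /colx in H1 H2; apply/orP; [right|left].
  apply/andP; split; first by apply/eqP/val_inj => /=; lia.
  by case: H2 => ->; rewrite eqxx ?orbT.
apply/andP; split; first by apply/eqP/val_inj.
by apply/orP; case: H2 => H2; [right|left]; apply/eqP; lia.
Qed.

Lemma reads_proper c b : reads c b -> wf zn b -> Defs.proper c.
Proof.
move=> R [_ [_ P]]; apply/forallP=> -[a x]; apply/forallP=> -[a' x'].
apply/implyP=> /edge_adj Ha; apply/implyP=> cn; apply/eqP=> E.
have := P _ _ _ _ Ha; rewrite !R E; apply=> //.
by rewrite -E; case: (c (a, x)) cn => [i|] //= _; rewrite /colz; lia.
Qed.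

Lemma reads_paint c b (m : move grid 4) : reads c b ->
  reads (paint c m) (upd b (colx m.1.2) m.1.1 (Z.of_nat m.2.+1)).
Proof.
case: m => [[a x] i] R a' x'; rewrite ffunE [(_, _).1]/= [(_, _).2]/=.
case: eqP => [[-> ->]|D]; first by rewrite upd_eq.
rewrite upd_ne ?R // /colx.
have [Ea|Na] := eqVneq (a' : nat) a; last by right; apply/eqP.
left=> /Nat2Z.inj[Ex]; case: D; congr pair; exact: val_inj.
Qed.

Lemma legal_board c b (m : move grid 4) : reads c b -> wf zn b -> legal c m ->
  allowed zn b (colx m.1.2) m.1.1 (Z.of_nat m.2.+1).
Proof.
case: m => [[a x] i] R W /andP[/= /eqP c0 /forallP /(_ (a, x)) /forallP P].
have [/ltP Ha /ltP Hx /ltP Hi] := And3 (ltn_ord a) (ltn_ord x) (ltn_ord i).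
split; first by rewrite /colx; lia.
split; first by lia.
split; first by lia.
split; first by rewrite R c0.
move=> k v Hkv E.
have Hk : (1 <= k <= zn)%Z /\ (v <= 3)%coq_nat.
  case: W => _ [O _]; suff: ~ (k < 1 \/ zn < k \/ (3 < v)%coq_nat)%Z by lia.
  by move=> H; rewrite O // in E; lia.
have Hv : (v < 4)%nat by apply/ltP; lia.
have [[a' x'] Hu [Ek Ev]] := adj_edge (proj1 Hk) Hv Hkv.
move: (P (a', x')); rewrite Hu /= !ffunE /= eqxx /=.
have -> : ((a', x') == (a, x)) = false.
  by apply/eqP=> D; move: Hu; rewrite D edge_irr.
move/eqP; apply; apply: colz_inj; rewrite -R -/(colx _); move: E; rewrite Ek Ev /= => ->.
by [].
Qed.

Definition safe_position (c : coloring grid 4) := exists2 b, reads c b & Inv zn b.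

Lemma reply_move c b : reads c b -> wf zn b -> reply zn b ->
  exists2 m, legal c m & safe_position (paint c m).
Proof.
move=> R W [k [v [col [L I]]]].
have [Hk [Hv [Hc [b0 _]]]] := L.
have Hv' : (v < 4)%nat by apply/ltP; lia.
have Hx : (Z.to_nat (k - 1) < n)%nat by apply/ltP; lia.
have Hi : (Z.to_nat (col - 1) < 4)%nat by apply/ltP; lia.
pose m : move grid 4 := ((Ordinal Hv', Ordinal Hx), Ordinal Hi).
have Ek : colx (Z.to_nat (k - 1)) = k by rewrite /colx; lia.
have Ec : Z.of_nat (Z.to_nat (col - 1)).+1 = col by lia.
have R' : reads (paint c m) (upd b k v col).
  have -> : upd b k v col = upd b (colx m.1.2) m.1.1 (Z.of_nat m.2.+1).
    by congr (upd b _ _ _); apply: esym; [exact: Ek | exact: Ec].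
  exact: reads_paint.
exists m; last by exists (upd b k v col).
apply/andP; split; last by apply: reads_proper R' (proj1 I).
apply/eqP/colz_inj; apply: etrans (esym (R (Ordinal Hv') (Ordinal Hx))) _.
by apply: etrans b0; congr (b _ _); exact: Ek.
Qed.

Lemma safe_reply c v : safe_position c -> c v = None ->
  exists2 m, legal c m & safe_position (paint c m).
Proof.
case: v => a x [b R I] cv; apply: (reply_move R (proj1 I)).
have [/ltP Ha /ltP Hx] := conj (ltn_ord a) (ltn_ord x).
apply: (alice_reply zn b (colx x) a I); rewrite ?R ?cv //; rewrite /colx; lia.
Qed.

Lemma safe_empty : safe_position [ffun=> None].
Proof. by exists (fun _ _ => 0%Z); [move=> a x; rewrite ffunE | apply: Inv_empty]. Qed.

(** Made boolean by [asbool], so that the strategy can search through the finitely many moves. *)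
Definition to_safe (c : coloring grid 4) (m : move grid 4) :=
  legal c m && boolp.asbool (safe_position (paint c m)).

Definition alice : strategy grid 4 := fun h => [pick m | to_safe (position h) m].

(** The invariant may fail after Bob's move, so on Alice's turn the statement claims only that,
    while some cell is open, a move restoring it exists. *)
Lemma play_alice_safe h : play alice h ->
  if alice_turn h then forall v, position h v = None -> exists m, to_safe (position h) m
  else safe_position (position h).
Proof.
have T m h' : alice_turn (rcons h' m) = ~~ alice_turn h' by rewrite /alice_turn size_rcons.
have X c v : safe_position c -> c v = None -> exists m, to_safe c m.
  move=> S cv; have [m L S'] := safe_reply S cv; exists m.
  by rewrite /to_safe L; apply/boolp.asboolP.
elim=> [|h' m _ _ turn|h' m _ IH turn L].
- by move=> v; apply: X safe_empty.
- rewrite T turn /= /alice; case: pickP => // m' /andP[_ /boolp.asboolP S] [<-] _.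
  by rewrite /position foldl_rcons.
- rewrite T turn; rewrite (negbTE turn) in IH; case: IH => b R I v.
  rewrite /position foldl_rcons -/(position h') => cv.
  have R' := reads_paint m R.
  have Lb := legal_board R (proj1 I) L.
  case: (bob_reply zn b _ _ _ I Lb) => [I'|Rp].
    by apply: (X _ v) => //; exists (upd b (colx m.1.2) m.1.1 (Z.of_nat m.2.+1)).
  have [m' L' S'] := reply_move R' (wf_upd zn _ _ _ _ (proj1 I) Lb) Rp.
  by exists m'; rewrite /to_safe L'; apply/boolp.asboolP.
Qed.

Lemma alice_wins_four : alice_wins grid 4.
Proof.
exists alice => h /play_alice_safe.
have op m : legal (position h) m -> position h m.1 = None by case/andP=> /eqP.
case: ifP => turn H; split=> //.
- move=> _ /forallPn[m]; rewrite negbK => /op cm.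
  have [m' S] := H _ cm; rewrite /alice; case: pickP => [m2 /andP[L _]|/(_ m')]; last by rewrite S.
  by exists m2.
- move=> /forallP fin; apply/forallP=> v; apply/negP=> /eqP cv.
  by have [m /andP[L _]] := H v cv; have := fin m; rewrite L.
- move=> /forallP fin; apply/forallP=> v; apply/negP=> /eqP cv.
  by have [m L _] := safe_reply H cv; have := fin m; rewrite L.
Qed.
End AliceWins.

(** * The strategy of Bob *)

Section Window.

(** The index is 4 times the column plus the row; the quotients stop vertical steps from running
    into the next column. *)
Definition adjw (i j : nat) : bool :=
  (i %/ 4 == j %/ 4) && ((i.+1 == j) || (j.+1 == i)) || (i + 4 == j) || (j + 4 == i).
Definition nbw_table := Eval compute in [seq [seq j <- iota 0 20 | adjw i j] | i <- iota 0 20].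
Definition nbw i := nth [::] nbw_table i.

(** Written with [if] so that call-by-value evaluation stops at the first success; a boolean
    connective would evaluate both arguments. *)
Fixpoint any (T : Type) (p : T -> bool) (l : seq T) : bool :=
  if l is x :: l' then if p x then true else any p l' else false.
Fixpoint every (T : Type) (p : T -> bool) (l : seq T) : bool :=
  if l is x :: l' then if p x then every p l' else false else true.

Variable k : nat.
Implicit Type w : seq nat.
Definition freew w i c : bool :=
  if eqn (nth 0 w i) 0 then every (fun j => ~~ eqn (nth 0 w j) c) (nbw i) else false.
Definition deadw w i : bool :=
  if eqn (nth 0 w i) 0 then every (fun c => any (fun j => eqn (nth 0 w j) c) (nbw i)) (iota 1 k) else false.
(* [i] is the cell Bob has just coloured *)
Definition alicew (bob : seq nat -> bool) w i : bool :=
  if any (deadw w) (nbw i) then true else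
  if any (fun j => eqn (nth 0 w j) 0) (iota 0 20) then
    if bob w then every (fun j => every (fun c =>
       if freew w j c then bob (set_nth 0 w j c) else true) (iota 1 k)) (iota 0 20) else false
  else false.
(** Here [f] counts the moves left after this one. Cell 9 is the inner cell of the middle column
    where Bob opens; the second list contains the other cells of the three middle columns, in an
    order chosen for the search. *)
Definition candw f : seq nat :=
  match f with 2 => [:: 9] | 1 => [:: 4; 6; 12; 14; 5; 7; 13; 15; 8; 10; 11] | _ => iota 4 12 end.
Fixpoint bobw f w : bool :=
  if f is f'.+1 then any (fun i => any (fun c =>
     if freew w i c then alicew (bobw f') (set_nth 0 w i c) i else false) (iota 1 k)) (candw f')
  else false.
End Window.

(** * From the window to the grid *)

Section BobWins.
Variables n k : nat.
Notation grid := (box_graph (path_graph 4) (path_graph n)).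
Implicit Types (c : coloring grid k) (u v : 'I_4 * 'I_n).

(* A finished play is complete, so it cannot pass through a position with a cell
   that sees all the colours. *)
Lemma dead_not_winning (s : strategy grid k) h v : winning s -> play s h -> position h v = None ->
  (forall i : 'I_k, exists2 u, @edge grid v u & position h u = Some i) -> False.
Proof.
move=> ws; have [r] := ubnP #|[set u | position h u == None]|.
elim: r h => // r IH h Hr ph hv dead.
have step m : legal (position h) m -> play s (rcons h m) -> False.
  move=> L pm; have /andP[/eqP m0 /forallP /(_ m.1) /forallP P] := L.
  have E w : position (rcons h m) w = if w == m.1 then Some m.2 else position h w.
    by rewrite /position foldl_rcons ffunE.
  apply: (IH (rcons h m)) => //.
  - apply: leq_trans (_ : #|[set u | position h u == None]| <= _); last by rewrite -ltnS.
    apply: proper_card; apply/properP; split.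
      by apply/subsetP=> w; rewrite !inE E; case: (w =P m.1).
    by exists m.1; rewrite !inE ?m0 ?E ?eqxx.
  - rewrite E; case: eqP => // vm; have [u eu hu] := dead m.2.
    have := P u; rewrite -vm eu !ffunE vm eqxx /= -vm.
    have -> : (u == v) = false by apply/eqP=> D; move: eu; rewrite D edge_irr.
    by rewrite -/(position h) hu eqxx.
  - move=> i; have [u eu hu] := dead i; exists u => //; rewrite E.
    by case: eqP => // um; rewrite -um hu in m0.
have [H1 H2] := ws h ph; have Nf : ~~ finished h.
  by apply/negP=> /H2 /forallP /(_ v); rewrite hv.
have [turn|turn] := boolP (alice_turn h).
  by have [m sm L] := H1 turn Nf; apply: (step m L); apply: play_alice ph turn sm L.
by have /forallPn[m] := Nf; rewrite negbK => L; apply: (step m L); apply: play_bob ph turn L.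
Qed.

Lemma legal_cell c (m : move grid k) : Defs.proper c -> c m.1 = None ->
  (forall u, @edge grid m.1 u -> c u <> Some m.2) -> legal c m.
Proof.
move=> pc c0 H; rewrite /legal c0 eqxx /=.
apply/forallP=> u; apply/forallP=> w; apply/implyP=> uw.
rewrite !ffunE; case: (eqVneq u m.1) => [Eu|Nu]; case: (eqVneq w m.1) => [Ew|Nw] //=.
- by rewrite Eu Ew edge_irr in uw.
- by apply/eqP=> E; apply: (H w); rewrite -?Eu.
- by apply/implyP=> _; apply/eqP; apply: H; rewrite edge_sym -Ew.
- by move/forallP: pc => /(_ u)/forallP/(_ w)/implyP/(_ uw).
Qed.

Variable s0 : nat.
Hypothesis Hs0 : s0 + 5 <= n.

Definition ix (u : 'I_4 * 'I_n) : nat := 4 * (u.2 - s0) + u.1.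
Definition inw (u : 'I_4 * 'I_n) := (s0 <= u.2 < s0 + 5).
Definition cn (o : option 'I_k) : nat := if o is Some i then i.+1 else 0.
Definition views (w : seq nat) c := size w = 20 /\ forall u, inw u -> nth 0 w (ix u) = cn (c u).

Lemma ix_lt u : inw u -> ix u < 20.
Proof. by rewrite /inw /ix; have := ltn_ord u.1; lia. Qed.

Lemma ix_inj u v : inw u -> inw v -> ix u = ix v -> u = v.
Proof.
case: u v => [a x] [b y]; rewrite /inw /ix /= => Hx Hy E.
have [Ha Hb] := (ltn_ord a, ltn_ord b).
by congr pair; apply: val_inj => /=; lia.
Qed.

Lemma ix_surj j : j < 20 -> exists2 u, inw u & ix u = j.
Proof.
move=> Hj; have Ha : j %% 4 < 4 by rewrite ltn_mod.
have Hx : s0 + j %/ 4 < n by lia.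
by exists (Ordinal Ha, Ordinal Hx); rewrite /inw /ix /=; lia.
Qed.

Lemma nbwP i j : i < 20 -> (j \in nbw i) = (j < 20) && adjw i j.
Proof.
move=> Hi; have T : all (fun i => nbw i == [seq j <- iota 0 20 | adjw i j]) (iota 0 20) by vm_compute.
move/allP: T => /(_ i); rewrite mem_iota Hi => /(_ isT) /eqP ->.
by rewrite mem_filter mem_iota andbC.
Qed.

Lemma edge_ix u v : inw u -> inw v -> @edge grid u v = adjw (ix u) (ix v).
Proof.
case: u v => [a x] [b y]; rewrite /inw /ix /adjw /= /box_edge /= /path_edge => Hx Hy.
have [Ha Hb] := (ltn_ord a, ltn_ord b).
have Ed i (c : 'I_4) : (4 * i + c) %/ 4 = i by have := ltn_ord c; lia.
rewrite !Ed -!val_eqE /=; lia.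
Qed.

(** The indices 4 to 15 are the three middle columns, where the window shows all neighbours and
    legality can be read off it. *)
Lemma edge_inner u v : inw u -> 4 <= ix u < 16 -> @edge grid u v -> inw v.
Proof.
case: u v => [a x] [b y]; rewrite /inw /ix /= /box_edge /= /path_edge -!val_eqE /=.
have [Ha Hb] := (ltn_ord a, ltn_ord b); lia.
Qed.

Lemma anyP (T : eqType) (p : T -> bool) l : any p l = has p l.
Proof. by elim: l => //= x l ->; case: (p x). Qed.

Lemma everyP (T : eqType) (p : T -> bool) l : every p l = all p l.
Proof. by elim: l => //= x l ->; case: (p x). Qed.

Lemma col_iota (i : 'I_k) : i.+1 \in iota 1 k.
Proof. by rewrite mem_iota; have := ltn_ord i; lia. Qed.

Lemma views_paint w c (m : move grid k) : views w c -> inw m.1 ->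
  views (set_nth 0 w (ix m.1) m.2.+1) (paint c m).
Proof.
move=> [Hw H] Hm; split; first by rewrite size_set_nth Hw; have := ix_lt Hm; lia.
move=> u Hu; rewrite nth_set_nth /= ffunE; case: (eqVneq u m.1) => [->|D]; first by rewrite eqxx.
by case: eqP => [/(ix_inj Hu Hm) E|_]; [rewrite E eqxx in D | apply: H].
Qed.

Lemma views_out w c (m : move grid k) : views w c -> ~~ inw m.1 -> views w (paint c m).
Proof.
move=> [Hw H] Hm; split=> // u Hu; rewrite ffunE.
by case: eqP => [E|_]; [rewrite E (negbTE Hm) in Hu | apply: H].
Qed.

Lemma freew_legal w c i col : views w c -> Defs.proper c -> i \in iota 4 12 -> col \in iota 1 k ->
  freew w i col -> exists m : move grid k, [/\ legal c m, inw m.1, ix m.1 = i & m.2.+1 = col :> nat].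
Proof.
move=> [Hw H] pc; rewrite !mem_iota => Hi Hc.
have [v Hv Ev] : exists2 u, inw u & ix u = i by apply: ix_surj; lia.
have Hcol : col.-1 < k by lia.
rewrite /freew; case: eqnP => // w0; rewrite everyP => /allP Hn.
exists (v, Ordinal Hcol); split=> //=; last by lia.
apply: legal_cell => //=; first by move: (H v Hv); rewrite Ev w0; case: (c v).
move=> u eu E; have Hu : inw u by apply: edge_inner eu; rewrite // Ev; lia.
have := Hn (ix u); rewrite nbwP ?(ix_lt Hu) -?Ev -?(edge_ix Hv Hu) ?(ix_lt Hv) // => /(_ eu).
by rewrite H // E /=; case: eqnP => //; lia.
Qed.

(** In the border columns of the window only this direction holds: outside neighbours are ignored
    there, which can only give Alice additional moves. *)
Lemma legal_freew w c (m : move grid k) : views w c -> legal c m -> inw m.1 ->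
  freew w (ix m.1) m.2.+1.
Proof.
move=> [Hw H] /andP[/eqP c0 /forallP /(_ m.1) /forallP P] Hm.
rewrite /freew H // c0 /= everyP; apply/allP=> j; rewrite nbwP ?(ix_lt Hm) // => /andP[Hj].
have [u Hu <-] := ix_surj Hj; rewrite -(edge_ix Hm Hu) => eu; rewrite H //.
have := P u; rewrite eu !ffunE eqxx /=.
case: (u =P m.1) => [D|_]; first by rewrite D edge_irr in eu.
by case: (c u) => [i|] //= /eqP D; apply/eqnP => E; apply: D; congr Some; apply: val_inj.
Qed.

Lemma deadw_dead w c j : views w c -> j < 20 -> deadw k w j ->
  exists v, c v = None /\ forall i : 'I_k, exists2 u, @edge grid v u & c u = Some i.
Proof.
move=> [Hw H] Hj; have [v Hv Ev] := ix_surj Hj.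
rewrite /deadw; case: eqnP => // w0; rewrite everyP => /allP Hd.
exists v; split; first by move: (H v Hv); rewrite Ev w0; case: (c v).
move=> i; have := Hd _ (col_iota i); rewrite anyP => /hasP[l].
rewrite nbwP // => /andP[Hl]; have [u Hu <-] := ix_surj Hl.
rewrite -Ev -(edge_ix Hv Hu) => eu /eqnP; rewrite H //.
case E: (c u) => [i'|] //= [Ei]; exists u => //; rewrite E; congr Some; exact: val_inj.
Qed.

Lemma bobw_sound (s : strategy grid k) : winning s -> forall f w h, play s h -> ~~ alice_turn h ->
  views w (position h) -> ~~ bobw k f w.
Proof.
move=> ws; elim=> [//|f IH] w h ph turn vw; apply/negP => /=.
rewrite anyP => /hasP[i Hi]; rewrite anyP => /hasP[col Hc].
have Hi' : i \in iota 4 12 by case: f {IH} Hi => [|[|[|f]]] // Hi; move: Hi; rewrite !inE; repeat case/orP; move/eqP->.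
case Fr: (freew w i col) => //.
have [m [L Hm Em Ec]] := freew_legal vw (play_proper ph) Hi' Hc Fr.
have ph' : play s (rcons h m) by apply: play_bob.
have turn' : alice_turn (rcons h m) by rewrite /alice_turn size_rcons /= -/(alice_turn h).
have vw' : views (set_nth 0 w i col) (position (rcons h m)).
  by rewrite /position foldl_rcons -Em -Ec; apply: views_paint.
move: (set_nth 0 w i col) (rcons h m) vw' ph' turn' => {vw Fr ph turn L}w' h' vw ph turn.
have Hi20 : i < 20 by rewrite -Em ix_lt.
rewrite /alicew !anyP; case: hasP => [[j]|_].
  rewrite nbwP // => /andP[Hj _] /(deadw_dead vw Hj) [v [v0 dead]] _.
  exact: dead_not_winning ws ph v0 dead.
(* An open cell shows that the play is not finished, since a winning strategy only finishes with a
   complete colouring; so Alice has to move. *)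
case: hasP => // -[j]; rewrite mem_iota => Hj /eqnP j0.
case Bw: (bobw k f w') => //; rewrite everyP => /allP Ha.
have [v Hv Ev] := ix_surj Hj.
have v0 : position h' v = None by move: (proj2 vw v Hv); rewrite Ev j0; case: (position h' v).
have [H1 H2] := ws h' ph; have Nf : ~~ finished h'.
  by apply/negP=> /H2 /forallP /(_ v); rewrite v0.
have [m' sm L] := H1 turn Nf.
have ph' := play_alice ph turn sm L.
have turn' : ~~ alice_turn (rcons h' m') by move: turn; rewrite /alice_turn size_rcons /= negbK.
(* A move outside of the window leaves the view unchanged and corresponds to the pass tested by
   [bob w] in [alicew]. *)
have [Im|Om] := boolP (inw m'.1).
  have := Ha (ix m'.1); rewrite mem_iota ix_lt // everyP => /(_ isT) /allP /(_ _ (col_iota m'.2)).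
  rewrite (legal_freew vw L Im).
  rewrite (negbTE (IH _ _ ph' turn' _)) //.
  by rewrite /position foldl_rcons; apply: views_paint.
move: Bw; rewrite (negbTE (IH _ _ ph' turn' _)) //.
by rewrite /position foldl_rcons; apply: views_out.
Qed.
End BobWins.

Lemma bobw_small k : 0 < k < 4 -> bobw k 3 (nseq 20 0).
Proof.
have H : [&& bobw 1 3 (nseq 20 0), bobw 2 3 (nseq 20 0) & bobw 3 3 (nseq 20 0)] by vm_compute.
case/and3P: H => H1 H2 H3.
case: k => [|[|[|[|k]]]] Hk; [discriminate Hk|exact H1|exact H2|exact H3|discriminate Hk].
Qed.

Lemma alice_loses n k : 18 <= n -> k < 4 -> ~ alice_wins (box_graph (path_graph 4) (path_graph n)) k.
Proof.
move=> Hn Hk [s ws].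
have v0 : 'I_4 * 'I_n := (ord0, Ordinal (leq_trans (isT : 0 < 18) Hn)).
have ps : play s [::] by apply: play_start.
have [H1 H2] := ws _ ps; have Nf : ~~ finished ([::] : history (box_graph (path_graph 4) (path_graph n)) k).
  by apply/negP=> /H2 /forallP /(_ v0); rewrite /position /= ffunE.
have [m sm L] := H1 isT Nf.
have Hk0 : 0 < k by have := ltn_ord m.2; lia.
(* Of the two disjoint windows starting at columns 0 and 5, Alice's first move misses one, which is
   empty when Bob begins. *)
have [s0 Hs0 Hm] : exists2 s0, s0 + 5 <= n & ~~ inw s0 m.1.
  have [H5|H5] := leqP 5 m.1.2.
    by exists 0; [lia | rewrite /inw /= -leqNgt].
  by exists 5; [lia | rewrite /inw leqNgt H5].
have ph : play s (rcons [::] m) by apply: play_alice.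
have : bobw k 3 (nseq 20 0) by apply: bobw_small; lia.
rewrite (negbTE (bobw_sound Hs0 ws _ ph _ _)) //.
apply: views_out => //; split=> [//|u _].
by rewrite ffunE -/(nseq 20 0) nth_nseq if_same.
Qed.

Theorem mainTheorem1 :
  (forall n : nat, 1 <= n ->
     game_chromatic_number (box_graph (path_graph 4) (path_graph n)) <= 4)
  /\
  (forall n : nat, 18 <= n ->
     game_chromatic_number (box_graph (path_graph 4) (path_graph n)) = 4).
Proof.
split=> n Hn; rewrite /game_chromatic_number; case: ex_minnP => m /boolp.asboolP Hm min.
  by apply: min; apply/boolp.asboolP; apply: alice_wins_four.
apply/eqP; rewrite eqn_leq min; last by apply/boolp.asboolP; apply: alice_wins_four.
by rewrite leqNgt; apply/negP => /(alice_loses Hn).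
Qed.
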